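(* Let $\mathcal A=\mathcal O(\mathrm{SL}_q(2))$, $(\Gamma,d)$ one of the $4D_\pm$-calculi, $g$ the $\sigma$-metric with parameter $c_1\in\mathbb R\setminus\{0\}$, and let $\nabla$ be the linear left connection on $\mathrm{Cl}(\Gamma,\sigma,g)$ determined by $\nabla(\rho)=\theta\otimes\rho-\nu\tilde\sigma_{(i)}(\rho\otimes\theta)$ on $\Gamma$, for some $i\in\{1,2,3,4\}$, $\nu\in\{+1,-1\}$. Then there exists a 1-parameter family (with parameter $\gamma\in\mathbb C$) of linear left connections $\nabla_{\mathcal S}$ on the spinor module $\mathcal S_0$ (compatible with $\nabla$). These connections are given by $\nabla_{\mathcal S}(\psi)=\theta\otimes_{\mathcal A}\psi-\tau(\psi\otimes_{\mathcal A}\theta)$, $\psi\in\mathcal S_0$, where $$\tau(\psi_m^+\otimes\theta_{jk})=\gamma q^{j+k}\hat R^{st}_{lk}(\hat R^{\eta_i})^{rl}_{mj}\,\theta_{rs}\otimes\psi^+_t,\qquad \tau(\psi_m^-\otimes\theta_{jk})=\nu\gamma q^{j+k}(\hat R^{\eta'_i})^{st}_{lk}(\hat R^{-1})^{rl}_{mj}\,\theta_{rs}\otimes\psi^-_t .$$ Moreover: (i) The left-covariant $\mathcal A$-subbimodules $\mathcal S_0^\eta$, $\eta\in\{+,-\}$, of $\mathcal S_0$ are invariant with respect to $\nabla_{\mathcal S}$ in the sense that $\nabla_{\mathcal S}\mathcal S_0^\eta\subseteq\Gamma\otimes_{\mathcal A}\mathcal S_0^\eta$. (ii) The Dirac operator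 $D$ corresponding to $\nabla_{\mathcal S}$ is symmetric with respect to the metric $\langle\cdot,\cdot\rangle$ on $\mathcal S_0$ given in the context if and only if $q\in\mathbb R$ and $\bar\gamma=\gamma$, or $|q|=1$ and $\bar\gamma=q^{6-\frac32\eta_i-\frac32\eta'_i}\nu\gamma$.
   Context: Repeated indices are summed. $q\in\mathbb C\setminus\{0\}$ is not a root of unity; $q^{1/2}$ is a fixed square root; $\hat q=q-q^{-1}$, $[2]=q+q^{-1}$. Indices run over $1,2$. Put $\check C^{ij}=q^{-1/2}\delta^i_1\delta^j_2-q^{1/2}\delta^i_2\delta^j_1$, $\hat C_{ij}=-\check C^{ij}$, $\hat R^{ij}_{kl}=q^{1/2}\delta^i_k\delta^j_l+q^{-1/2}\check C^{ij}\hat C_{kl}$; $\hat R^{+}=\hat R$, $\hat R^{-}=\hat R^{-1}$. Subscripts $\hat R_{12},\dots$ denote tensor legs. Signs $\pm$ in exponents of $q$ are read as $\pm1$. $\mathcal A=\mathcal O(\mathrm{SL}_q(2))$ is the Hopf algebra generated by $u^i_j$ with relations $\hat R^{ij}_{kl}u^k_mu^l_n=u^i_ku^j_l\hat R^{kl}_{mn}$, $u^1_1u^2_2-qu^1_2u^2_1=1$, $\varDelta(u^i_j)=u^i_k\otimes u^k_j$, $\varepsilon(u^i_j)=\delta^i_j$. Involutions: $\dagger$ ($q\in\mathbb R$): $(u^1_1)^\dagger=u^2_2$, $(u^1_2)^\dagger=-qu^2_1$, $(u^2_1)^\dagger=-q^{-1}u^1_2$, $(u^2_2)^\dagger=u^1_1$;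 $\star$ ($q\in\mathbb R$): $(u^1_1)^\star=u^2_2$, $(u^1_2)^\star=qu^2_1$, $(u^2_1)^\star=q^{-1}u^1_2$, $(u^2_2)^\star=u^1_1$; $\sharp$ ($|q|=1$): $(u^i_j)^\sharp=u^i_j$. $h$ is the Haar functional. The $4D_\pm$-calculus: $\Gamma$ is the free left $\mathcal A$-module with left-invariant basis $\theta_{ij}$, right multiplication $\theta_{ij}u^k_l=\nu_0\hat R^{mr}_{it}\hat R^{-1}{}^{ts}_{jl}u^k_m\theta_{rs}$ ($\nu_0=\pm1$ for $4D_\pm$), $da=\theta a-a\theta$, $\theta=\frac{q^{1/2}}{\hat q}\check C^{ij}\theta_{ij}$. The braiding is left $\mathcal A$-linear with $\sigma(\theta_{mn}\otimes\theta_{rs})=(\hat R_{23}\hat R_{12}\hat R^{-1}_{34}\hat R^{-1}_{23})^{ijkl}_{mnrs}\theta_{ij}\otimes\theta_{kl}$; $g:\Gamma\otimes_{\mathcal A}\Gamma\to\mathcal A$ is left $\mathcal A$-linear with $g(\theta_{ij}\otimes\theta_{kl})=-q^{1/2}c_1\hat C_{im}\hat C_{nl}\hat R^{-1}{}^{mn}_{jk}$. $\mathrm{Cl}(\Gamma,\sigma,g)=\Gamma^\otimes/\mathcal I$, $\Gamma^\otimes$ the tensor algebra over $\mathcal A$, $\mathcal I$ the two-sided ideal generated by $\rho_2-g(\rho_2)$ with $\sigma(\rho_2)=\rho_2$. $\mathcal S_0$ is its left ideal generated by $\psi^+_1=\frac{q}{[2]c_1}\theta_{11}\theta_{12}\theta_{21}\theta_{22}$,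 $\psi^+_2=\theta_{21}\theta_{22}$, $\psi^-_1=\theta_{11}\theta_{21}\theta_{22}$, $\psi^-_2=q\theta_{12}\theta_{21}\theta_{22}$; these form a left $\mathcal A$-basis of $\mathcal S_0$, $\mathcal S_0$ is an $\mathcal A$-bimodule, and $\mathcal S_0^\eta=\mathcal A\psi_1^\eta\oplus\mathcal A\psi_2^\eta$. Connections: $(\eta_i,\eta_i')=(+,+),(+,-),(-,+),(-,-)$ for $i=1,2,3,4$, and $\tilde\sigma_{(i)}(\theta_{kl}\otimes\theta_{mn})=(\hat R_{23}\hat R^{\eta_i}_{12}\hat R^{\eta_i'}_{34}\hat R^{-1}_{23})^{rstx}_{klmn}\theta_{rs}\otimes\theta_{tx}$. With $\tilde\sigma=\nu\tilde\sigma_{(i)}$, $\nabla$ on $\Gamma$ is extended to $\Gamma^\otimes$ by $\nabla=d$ on $\mathcal A$ and $\nabla(\rho\otimes\rho')=\nabla(\rho)\otimes\rho'+(\tilde\sigma\otimes\mathrm{id})(\rho\otimes\nabla(\rho'))$ ($\rho\in\Gamma$), and descends to $\mathrm{Cl}(\Gamma,\sigma,g)$; its bimodule map $\tilde\sigma:\mathrm{Cl}\otimes_{\mathcal A}\Gamma\to\Gamma\otimes_{\mathcal A}\mathrm{Cl}$ satisfies $\tilde\sigma(u\otimes da)=\nabla(ua)-\nabla(u)a$. A linear left connection on $\mathcal S_0$ compatible with $\nabla$ is a linear map $\nabla_{\mathcal S}:\mathcal S_0\to\Gamma\otimes_{\mathcal A}\mathcal S_0$ with $\nabla_{\mathcal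 S}(u\varphi)=(\mathrm{id}\otimes\cdot)(\nabla(u)\otimes\varphi+(\tilde\sigma\otimes\mathrm{id})(u\otimes\nabla_{\mathcal S}(\varphi)))$ for $u\in\mathrm{Cl}(\Gamma,\sigma,g)$, $\varphi\in\mathcal S_0$. The map $\tau$ is extended left $\mathcal A$-linearly to $\mathcal S_0\otimes_{\mathcal A}\Gamma\to\Gamma\otimes_{\mathcal A}\mathcal S_0$. The Dirac operator is $D=\mathrm m\circ\nabla_{\mathcal S}$ with $\mathrm m:\Gamma\otimes_{\mathcal A}\mathcal S_0\to\mathcal S_0$ Clifford multiplication; symmetric means $\langle D\varphi,\psi\rangle=\langle\varphi,D\psi\rangle$ for all $\varphi,\psi\in\mathcal S_0$. Metric: $\langle a\psi_i^\eta,b\psi_j^{\eta'}\rangle=h(ab^* )\langle\psi_i^\eta,\psi_j^{\eta'}\rangle$, where, with $c_2\in\mathbb R\setminus\{0\}$, $\langle\psi^\eta_i,\psi^{\eta'}_j\rangle=c_2\delta_{\eta,-\eta'}\delta_{i,j}(\delta_{i,1}+q^2\delta_{i,2})$ for $\dagger$; $=c_2\delta_{\eta,-\eta'}\delta_{i,j}(\delta_{i,1}-q^2\delta_{i,2})$ for $\star$; $=c_2\delta_{\eta,\eta'}\delta_{i+j,3}(q^{-1}\delta_{i,1}+q\delta_{i,2})(\delta_{\eta,+}+[2]c_1\delta_{\eta,-})$ for $\sharp$. Here $q\in\mathbb R$ refers to the cases $\dagger,\star$ and $|q|=1$ to the case $\sharp$.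
   Formalization: For the involution ♯ (|q|=1) the metric weight q^{-1}δ_{i,1}+qδ_{i,2} is replaced by i(q^{-1/2}δ_{i,1}−q^{1/2}δ_{i,2}); with the printed weight D is never symmetric, so (ii) fails e.g. at γ=0. *)

(* Defs.v *)
From HB Require Import structures.
From mathcomp Require Import all_boot all_order all_algebra.
From mathcomp Require Import boolp reals complex.
From mathcomp Require Import generic_quotient.
From mathcomp Require Import ring.

Set Implicit Arguments.
Unset Strict Implicit.
Unset Printing Implicit Defensive.

Import Order.TTheory GRing.Theory Num.Theory.

Local Open Scope ring_scope.
Local Open Scope quotient_scope.

(* Tensor product of a right module [M] and a left module [N] over [A]; the    *)
(* two actions are arbitrary functions, passed explicitly.  Elements are       *)
(* formal sums [m1 (x) n1 + ... + mk (x) nk], two of them being identified     *)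
(* when no balanced biadditive map separates them.  [tlift_unique] and the     *)
(* lemmas before it are the universal property.                                *)
Section Tensor.
Variables (A : Type) (M N : zmodType) (r : M -> A -> M) (l : A -> N -> N).

Definition balanced (Z : zmodType) (b : M -> N -> Z) : Prop :=
  [/\ forall m m' n, b (m + m') n = b m n + b m' n,
      forall m n n', b m (n + n') = b m n + b m n'
    & forall m a n, b (r m a) n = b m (l a n)].

Definition fsum (Z : zmodType) (b : M -> N -> Z) (x : seq (M * N)) : Z :=
  \sum_(p <- x) b p.1 p.2.

Definition tens_eq (x y : seq (M * N)) : bool :=
  `[< forall (Z : zmodType) (b : M -> N -> Z),
        balanced b -> fsum b x = fsum b y >].

Lemma tens_eq_equiv : equiv_class_of tens_eq.
Proof.
split=> [x|x y|y x z].
- by apply/asboolP.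
- by apply/asboolP/asboolP => e Z b hb; rewrite e.
- by move=> /asboolP e1 /asboolP e2; apply/asboolP => Z b hb; rewrite e1 ?e2.
Qed.

Canonical tens_equiv := EquivRelPack tens_eq_equiv.

Definition tens : Type := {eq_quot tens_equiv}.
HB.instance Definition _ := Choice.on tens.
HB.instance Definition _ := EqQuotient.on tens.

Definition tpure (m : M) (n : N) : tens := \pi_tens [:: (m, n)].

(* Meaningful only for balanced [b]. *)
Definition tlift (Z : zmodType) (b : M -> N -> Z) (t : tens) : Z :=
  fsum b (repr t).

Definition tens0 : tens := \pi_tens [::].
Definition tens_opp (t : tens) : tens :=
  \pi_tens [seq (- p.1, p.2) | p <- repr t].
Definition tens_add (t t' : tens) : tens := \pi_tens (repr t ++ repr t').

Lemma fsum_repr (Z : zmodType) (b : M -> N -> Z) x :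
  balanced b -> fsum b (repr (\pi_tens x)) = fsum b x.
Proof.
move=> hb.
have /asboolP /(_ Z b hb) // : tens_eq (repr (\pi_tens x)) x.
by apply/eqquotP; exact: reprK.
Qed.

Lemma tens_extP (t t' : tens) :
  (forall (Z : zmodType) (b : M -> N -> Z), balanced b -> tlift b t = tlift b t')
  -> t = t'.
Proof.
move=> e; have : tens_eq (repr t) (repr t') by apply/asboolP => Z b /e.
by move=> /(@eqquotP _ _ tens); rewrite !reprK.
Qed.

Lemma balancedN (Z : zmodType) (b : M -> N -> Z) m n :
  balanced b -> b (- m) n = - b m n.
Proof.
case=> bD _ _; apply: (addrI (b m n)); rewrite -bD !subrr.
by apply: (addrI (b 0 n)); rewrite -bD !addr0.
Qed.

Lemma tlift_add (Z : zmodType) (b : M -> N -> Z) t t' :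
  balanced b -> tlift b (tens_add t t') = tlift b t + tlift b t'.
Proof. by move=> hb; rewrite /tlift /tens_add fsum_repr // /fsum big_cat. Qed.

Lemma tlift_opp (Z : zmodType) (b : M -> N -> Z) t :
  balanced b -> tlift b (tens_opp t) = - tlift b t.
Proof.
move=> hb; rewrite /tlift /tens_opp fsum_repr // /fsum big_map -sumrN.
by apply: eq_bigr => p _; apply: balancedN.
Qed.

Lemma tlift_0 (Z : zmodType) (b : M -> N -> Z) :
  balanced b -> tlift b tens0 = 0.
Proof. by move=> hb; rewrite /tlift fsum_repr // /fsum big_nil. Qed.

Lemma tens_addA : associative tens_add.
Proof. by move=> x y z; apply: tens_extP => Z b hb; rewrite !tlift_add ?addrA. Qed.
Lemma tens_addC : commutative tens_add.
Proof. by move=> x y; apply: tens_extP => Z b hb; rewrite !tlift_add // addrC. Qed.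
Lemma tens_add0 : left_id tens0 tens_add.
Proof.
by move=> x; apply: tens_extP => Z b hb; rewrite tlift_add // tlift_0 // add0r.
Qed.
Lemma tens_addN : left_inverse tens0 tens_opp tens_add.
Proof.
move=> x; apply: tens_extP => Z b hb.
by rewrite tlift_add // tlift_opp // tlift_0 // addNr.
Qed.

HB.instance Definition _ :=
  GRing.isZmodule.Build tens tens_addA tens_addC tens_add0 tens_addN.

Lemma tlift_pure (Z : zmodType) (b : M -> N -> Z) m n :
  balanced b -> tlift b (tpure m n) = b m n.
Proof. by move=> hb; rewrite /tlift fsum_repr // /fsum big_seq1. Qed.

Lemma tliftD (Z : zmodType) (b : M -> N -> Z) :
  balanced b -> {morph tlift b : t t' / t + t'}.
Proof. by move=> hb t t'; apply: tlift_add. Qed.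

Lemma tpure_balanced : balanced tpure.
Proof.
by split=> *; apply: tens_extP => Z b hb; rewrite ?tliftD // !tlift_pure //;
   case: hb.
Qed.

Lemma tens_sum (t : tens) : t = \sum_(p <- repr t) tpure p.1 p.2.
Proof.
apply: tens_extP => Z b hb.
have lsum s : tlift b (\sum_(p <- s) tpure p.1 p.2) = fsum b s.
  elim: s => [|p s ih]; first by rewrite big_nil /fsum big_nil tlift_0.
  by rewrite big_cons tliftD // ih tlift_pure // /fsum big_cons.
by rewrite lsum.
Qed.

Lemma tlift_unique (Z : zmodType) (f : {additive tens -> Z}) b :
  balanced b -> (forall m n, f (tpure m n) = b m n) -> f =1 tlift b.
Proof.
move=> hb e t; rewrite [in LHS](tens_sum t) raddf_sum /tlift /fsum.
by apply: eq_bigr => p _; rewrite e.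
Qed.

End Tensor.

Arguments tpure {A M N r l} m n.
Arguments tlift {A M N r l Z} b t.

Section Actions.
Variables (A : Type) (M N : zmodType) (r : M -> A -> M) (l : A -> N -> N).

Definition tactl (lM : A -> M -> M) (a : A) (t : tens r l) : tens r l :=
  tlift (fun m n => tpure (lM a m) n) t.
Definition tactr (rN : N -> A -> N) (t : tens r l) (a : A) : tens r l :=
  tlift (fun m n => tpure m (rN n a)) t.

End Actions.

Section LeftIdeal.
Variables (B : nzRingType) (I : finType) (psi : I -> B).

Definition lideal_pred : {pred B} :=
  fun x => `[< exists c : I -> B, x = \sum_i c i * psi i >].

Fact lideal_zmod_closed : zmod_closed lideal_pred.
Proof.
split=> [|x y /asboolP[c ->] /asboolP[d ->]]; apply/asboolP.
  by exists (fun=> 0); rewrite big1 // => i _; rewrite mul0r.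
exists (fun i => c i - d i); rewrite -sumrB.
by apply: eq_bigr => i _; rewrite mulrBl.
Qed.

HB.instance Definition _ :=
  GRing.isZmodClosed.Build B lideal_pred lideal_zmod_closed.

Record lideal := LIdeal { lval :> B; _ : lval \in lideal_pred }.

HB.instance Definition _ := [isSub for lval].
HB.instance Definition _ := [Choice of lideal by <:].
HB.instance Definition _ := [SubChoice_isSubZmodule of lideal by <:].

Fact lact_subproof (x : B) (phi : lideal) : x * lval phi \in lideal_pred.
Proof.
case: phi => _ /= /asboolP[c ->]; apply/asboolP.
exists (fun i => x * c i); rewrite mulr_sumr.
by apply: eq_bigr => i _; rewrite mulrA.
Qed.

Definition lact (x : B) (phi : lideal) : lideal :=
  LIdeal (lact_subproof x phi).

Fact lgen_subproof i : psi i \in lideal_pred.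
Proof.
apply/asboolP; exists (fun j => (j == i)%:R).
rewrite (bigD1 i) //= eqxx mul1r big1 ?addr0 // => j /negPf ->.
by rewrite mul0r.
Qed.

Definition lgen i : lideal := LIdeal (lgen_subproof i).

End LeftIdeal.

Definition ideal_gen (B : nzRingType) (X : B -> Prop) (x : B) : Prop :=
  exists n (a y b : 'I_n -> B),
    (forall k, X (y k)) /\ x = \sum_k a k * y k * b k.

(* The paper's indices 1, 2 are the elements 0, 1 of ['I_2].  A matrix entry   *)
(* with upper indices [ij] and lower indices [kl] is written [X i j k l].      *)
Section RMatrix.
Variables (K : fieldType) (s : K).
Implicit Types i j k l : 'I_2.

Definition i1 : 'I_2 := ord0.
Definition i2 : 'I_2 := ord_max.

Definition Cc i j : K :=
  s^-1 *+ ((i == i1) && (j == i2)) - s *+ ((i == i2) && (j == i1)).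
Definition Ch i j : K := - Cc i j.

Definition Rh i j k l : K :=
  s *+ ((i == k) && (j == l)) + s^-1 * (Cc i j * Ch k l).
Definition Rinv i j k l : K :=
  s^-1 *+ ((i == k) && (j == l)) + s * (Cc i j * Ch k l).

Lemma Rinv_inverse i j k l : s != 0 ->
  \sum_a \sum_b Rh i j a b * Rinv a b k l = ((i == k) && (j == l))%:R /\
  \sum_a \sum_b Rinv i j a b * Rh a b k l = ((i == k) && (j == l))%:R.
Proof.
move=> s0; rewrite !big_ord_recl !big_ord0 /Rh /Rinv /Ch /Cc.
by split; case: i => [[|[|//]] ?]; case: j => [[|[|//]] ?];
  case: k => [[|[|//]] ?]; case: l => [[|[|//]] ?];
  rewrite /= ?mulr1n ?mulr0n; field.
Qed.

(* [true] stands for the sign +, [false] for the sign -. *)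
Definition Rsgn (e : bool) : 'I_2 -> 'I_2 -> 'I_2 -> 'I_2 -> K :=
  if e then Rh else Rinv.

Definition idx4 : finType := (('I_2 * 'I_2) * ('I_2 * 'I_2))%type.

Definition leg12 (X : 'I_2 -> 'I_2 -> 'I_2 -> 'I_2 -> K) (a b : idx4) : K :=
  X a.1.1 a.1.2 b.1.1 b.1.2 *+ (a.2 == b.2).
Definition leg23 (X : 'I_2 -> 'I_2 -> 'I_2 -> 'I_2 -> K) (a b : idx4) : K :=
  X a.1.2 a.2.1 b.1.2 b.2.1 *+ ((a.1.1 == b.1.1) && (a.2.2 == b.2.2)).
Definition leg34 (X : 'I_2 -> 'I_2 -> 'I_2 -> 'I_2 -> K) (a b : idx4) : K :=
  X a.2.1 a.2.2 b.2.1 b.2.2 *+ (a.1 == b.1).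

Definition opM (X Y : idx4 -> idx4 -> K) (a c : idx4) : K :=
  \sum_b X a b * Y b c.

Definition sigma_mx : idx4 -> idx4 -> K :=
  opM (leg23 Rh) (opM (leg12 Rh) (opM (leg34 Rinv) (leg23 Rinv))).

Definition stilde_mx (e e' : bool) : idx4 -> idx4 -> K :=
  opM (leg23 Rh) (opM (leg12 (Rsgn e)) (opM (leg34 (Rsgn e')) (leg23 Rinv))).

Definition g_mx (c : K) i j k l : K :=
  - s * c * \sum_m \sum_n Ch i m * Ch n l * Rinv m n j k.

End RMatrix.

(* (eta_i, eta'_i) for i = 1, ..., 4 is (+,+), (+,-), (-,+), (-,-). *)
Definition eta_ (i : 'I_4) : bool := (i < 2)%N.
Definition eta'_ (i : 'I_4) : bool := ~~ odd i.
Definition zsign (e : bool) : int := if e then 1 else -1.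

Section Calculus.
Variables (K : fieldType) (q s : K).

Definition two_q : K := q + q^-1.

Definition SLq2_rel (B : algType K) (b : 'I_2 -> 'I_2 -> B) : Prop :=
  (forall i j m n,
     \sum_k \sum_l Rh s i j k l *: (b k m * b l n) =
     \sum_k \sum_l Rh s k l m n *: (b i k * b j l)) /\
  b i1 i1 * b i2 i2 - q *: (b i1 i2 * b i2 i1) = 1.

(* Presentation by generators and relations, as a universal property. *)
Definition is_OSLq2 (A : algType K) (u : 'I_2 -> 'I_2 -> A) : Prop :=
  SLq2_rel u /\
  forall (B : algType K) (b : 'I_2 -> 'I_2 -> B), SLq2_rel b ->
  exists f : {lrmorphism A -> B},
    (forall i j, f (u i j) = b i j) /\
    forall f' : {lrmorphism A -> B},
      (forall i j, f' (u i j) = b i j) -> f' =1 f.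

Variables (A : algType K) (u : 'I_2 -> 'I_2 -> A).

Section Haar.

Definition AA : zmodType :=
  tens (fun (x : A) (c : K) => c *: x) (fun (c : K) (y : A) => c *: y).

Definition AA_mul (t t' : AA) : AA :=
  tlift (fun x y => tlift (fun x' y' => tpure (x * x') (y * y') : AA) t') t.

Definition is_comult (Delta : A -> AA) : Prop :=
  [/\ {morph Delta : a b / a + b}, Delta 1 = tpure 1 1,
      forall c a, Delta (c *: a) = AA_mul (tpure (c *: 1) 1) (Delta a),
      forall a b, Delta (a * b) = AA_mul (Delta a) (Delta b)
    & forall i j, Delta (u i j) = \sum_k tpure (u i k) (u k j)].

Definition is_haar (Delta : A -> AA) (h : A -> K) : Prop :=
  [/\ {morph h : a b / a + b}, forall c a, h (c *: a) = c * h a, h 1 = 1,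
      forall a, tlift (fun x y => h y *: x) (Delta a) = h a *: 1
    & forall a, tlift (fun x y => h x *: y) (Delta a) = h a *: 1].

End Haar.

Section Gamma.
Variables (Gam : lmodType A) (th : 'I_2 -> 'I_2 -> Gam).
Variable rm : Gam -> A -> Gam.

Definition is_4Dcalc (nu0 : K) : Prop :=
  [/\ forall x : Gam, exists a : 'I_2 -> 'I_2 -> A,
        x = \sum_i \sum_j a i j *: th i j,
      forall a : 'I_2 -> 'I_2 -> A,
        \sum_i \sum_j a i j *: th i j = 0 -> forall i j, a i j = 0,
      [/\ forall x y a, rm (x + y) a = rm x a + rm y a,
          forall x a b, rm x (a + b) = rm x a + rm x b,
          forall x a b, rm x (a * b) = rm (rm x a) b
        & forall a x b, rm (a *: x) b = a *: rm x b],
      forall (c : K) x, rm x c%:A = c%:A *: x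
    & forall i j k l,
        rm (th i j) (u k l) =
        \sum_m \sum_r \sum_t \sum_s'
          (nu0 * Rh s m r i t * Rinv s t s' j l) *: u k m *: th r s'].

Definition theta : Gam :=
  \sum_i \sum_j (s / (q - q^-1) * Cc s i j)%:A *: th i j.

Definition dA (a : A) : Gam := rm theta a - a *: theta.

Definition lsc (a : A) (x : Gam) : Gam := a *: x.

Definition GG : zmodType := tens rm lsc.

Definition th2 (b : idx4) : GG := tpure (th b.1.1 b.1.2) (th b.2.1 b.2.2).

Definition is_GG_endo (X : idx4 -> idx4 -> K) (f : GG -> GG) : Prop :=
  [/\ {morph f : t t' / t + t'}, forall a t, f (tactl lsc a t) = tactl lsc a (f t)
    & forall b, f (th2 b) = \sum_a tactl lsc (X a b)%:A (th2 a)].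

Definition is_sigma (sigma : GG -> GG) : Prop := is_GG_endo (sigma_mx s) sigma.

Definition is_stilde (i : 'I_4) (stilde : GG -> GG) : Prop :=
  is_GG_endo (stilde_mx s (eta_ i) (eta'_ i)) stilde.

Definition is_metric_g (c1 : K) (g : GG -> A) : Prop :=
  [/\ {morph g : t t' / t + t'}, forall a t, g (tactl lsc a t) = a * g t
    & forall i j k l,
        g (tpure (th i j) (th k l)) = (g_mx s c1 i j k l)%:A].

(* Actions of [A] on an algebra [B] through a morphism [A -> B]. *)
Definition algl (B : algType K) (iB : A -> B) (a : A) (x : B) : B := iB a * x.
Definition algr (B : algType K) (iB : A -> B) (x : B) (a : A) : B := x * iB a.

Definition GB (B : algType K) (iB : A -> B) : zmodType := tens rm (algl iB).
Definition BG (B : algType K) (iB : A -> B) : zmodType := tens (algr iB) lsc.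

Definition is_bimod_map (B : algType K) (iB : A -> B) (j : Gam -> B) : Prop :=
  [/\ {morph j : x y / x + y}, forall a x, j (a *: x) = iB a * j x
    & forall x a, j (rm x a) = j x * iB a].

Definition is_tensor_algebra
    (T : algType K) (iT : {lrmorphism A -> T}) (jT : Gam -> T) : Prop :=
  is_bimod_map iT jT /\
  forall (B : algType K) (f : {lrmorphism A -> B}) (j : Gam -> B),
    is_bimod_map f j ->
    exists F : {lrmorphism T -> B},
      [/\ forall a, F (iT a) = f a, forall x, F (jT x) = j x
        & forall F' : {lrmorphism T -> B},
            (forall a, F' (iT a) = f a) -> (forall x, F' (jT x) = j x) ->
            F' =1 F].

Section Clifford.
Variables (T : algType K) (iT : {lrmorphism A -> T}) (jT : Gam -> T).

Definition GG_in_T (t : GG) : T := tlift (fun x y => jT x * jT y) t.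

Definition cliff_rel (sigma : GG -> GG) (g : GG -> A) (x : T) : Prop :=
  exists t : GG, sigma t = t /\ x = GG_in_T t - iT (g t).

Definition is_clifford (sigma : GG -> GG) (g : GG -> A)
    (Cl : algType K) (pi : {lrmorphism T -> Cl}) : Prop :=
  (forall y, exists x, pi x = y) /\
  (forall x, pi x = 0 <-> ideal_gen (cliff_rel sigma g) x).

Variables (stilde : GG -> GG) (nu : K).

Definition nabla_G (x : Gam) : GG :=
  tpure theta x - tactl lsc nu%:A (stilde (tpure x theta)).

(* (rho (x) rho') (x) x |-> rho (x) (rho' x) *)
Definition GGmulT (t : GG) (x : T) : GB iT :=
  tlift (fun a b => tpure a (jT b * x) : GB iT) t.

Definition is_nabla_T (nablaT : T -> GB iT) : Prop :=
  [/\ {morph nablaT : x y / x + y},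
      forall c x, nablaT (c *: x) = tactl lsc c%:A (nablaT x),
      forall a, nablaT (iT a) = tpure (dA a) 1
    & forall rho x,
        nablaT (jT rho * x) =
        GGmulT (nabla_G rho) x +
        tlift (fun rho' y =>
                 GGmulT (tactl lsc nu%:A (stilde (tpure rho rho'))) y)
              (nablaT x)].

Variables (Cl : algType K) (pi : {lrmorphism T -> Cl}).

Definition iC (a : A) : Cl := pi (iT a).
Definition jC (x : Gam) : Cl := pi (jT x).

Definition is_nabla_Cl (nablaT : T -> GB iT) (nablaC : Cl -> GB iC) : Prop :=
  forall x, nablaC (pi x) =
            tlift (fun rho y => tpure rho (pi y) : GB iC) (nablaT x).

Definition is_sigma_Cl (nablaC : Cl -> GB iC) (sigmaC : BG iC -> GB iC) : Prop :=
  [/\ {morph sigmaC : t t' / t + t'},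
      forall a t, sigmaC (tactl (algl iC) a t) = tactl lsc a (sigmaC t),
      forall t a, sigmaC (tactr rm t a) = tactr (algr iC) (sigmaC t) a
    & forall x a, sigmaC (tpure x (dA a)) =
                  nablaC (x * iC a) - tactr (algr iC) (nablaC x) a].

Section Spinors.
Variable c1 : K.

Definition psi (p : bool * 'I_2) : Cl :=
  let t11 := jC (th i1 i1) in let t12 := jC (th i1 i2) in
  let t21 := jC (th i2 i1) in let t22 := jC (th i2 i2) in
  match p.1, p.2 == i1 with
  | true, true => (q / (two_q * c1)) *: (t11 * t12 * t21 * t22)
  | true, false => t21 * t22
  | false, true => t11 * t21 * t22
  | false, false => q *: (t12 * t21 * t22)
  end.

Definition S0 : zmodType := lideal psi.

Definition psiS (e : bool) (m : 'I_2) : S0 := lgen psi (e, m).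

Definition S0l (a : A) (phi : S0) : S0 := lact (iC a) phi.

(* The spinor module is stable under right multiplication by [A]: the default  *)
(* value 0 is never used.                                                      *)
Definition S0r (phi : S0) (a : A) : S0 := insubd (0 : S0) (lval phi * iC a).

Definition GS : zmodType := tens rm S0l.
Definition SG : zmodType := tens S0r lsc.

Definition inS0 (e : bool) (phi : S0) : Prop :=
  exists a : 'I_2 -> A, phi = \sum_m S0l (a m) (psiS e m).

Definition inGS0 (e : bool) (t : GS) : Prop :=
  exists n (rho : 'I_n -> Gam) (phi : 'I_n -> S0),
    (forall k, inS0 e (phi k)) /\ t = \sum_k tpure (rho k) (phi k).

(* (rho (x) x) (x) phi |-> rho (x) (x phi) *)
Definition GBmulS (t : GB iC) (phi : S0) : GS :=
  tlift (fun rho x => tpure rho (lact x phi) : GS) t.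

Definition is_spin_connection (nablaC : Cl -> GB iC) (sigmaC : BG iC -> GB iC)
    (nablaS : S0 -> GS) : Prop :=
  [/\ {morph nablaS : phi phi' / phi + phi'},
      forall (c : K) phi,
        nablaS (S0l c%:A phi) = tactl lsc c%:A (nablaS phi)
    & forall x phi,
        nablaS (lact x phi) =
        GBmulS (nablaC x) phi +
        tlift (fun rho phi' => GBmulS (sigmaC (tpure x rho)) phi')
              (nablaS phi)].

Definition is_tau (i : 'I_4) (gamma : K) (tau : SG -> GS) : Prop :=
  [/\ {morph tau : t t' / t + t'},
      forall a t, tau (tactl S0l a t) = tactl lsc a (tau t),
      forall m j k,
        tau (tpure (psiS true m) (th j k)) =
        \sum_r \sum_s' \sum_t \sum_l
          tpure ((gamma * q ^+ (j.+1 + k.+1) * Rh s s' t l k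
                  * Rsgn s (eta_ i) r l m j)%:A *: th r s') (psiS true t)
    & forall m j k,
        tau (tpure (psiS false m) (th j k)) =
        \sum_r \sum_s' \sum_t \sum_l
          tpure ((nu * gamma * q ^+ (j.+1 + k.+1) * Rsgn s (eta'_ i) s' t l k
                  * Rinv s r l m j)%:A *: th r s') (psiS false t)].

Definition dirac (nablaS : S0 -> GS) (phi : S0) : S0 :=
  tlift (fun rho phi' => lact (jC rho) phi') (nablaS phi).

Definition symmetric_wrt (met : S0 -> S0 -> K) (D : S0 -> S0) : Prop :=
  forall phi phi', met (D phi) phi' = met phi (D phi').

End Spinors.
End Clifford.
End Gamma.
End Calculus.

Inductive star_kind := Dagger | Star | Sharp.

Section Star.
Variables (K : numClosedFieldType) (q s : K).

(* [Dagger] and [Star] are the cases of real [q], [Sharp] is |q| = 1. *)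
Definition star_cond (k : star_kind) : Prop :=
  match k with Dagger | Star => q \is Num.real | Sharp => `|q| = 1 end.

Definition is_star (A : algType K) (u : 'I_2 -> 'I_2 -> A) (k : star_kind)
    (st : A -> A) : Prop :=
  [/\ {morph st : a b / a + b}, forall c a, st (c *: a) = c^* *: st a,
      forall a b, st (a * b) = st b * st a, involutive st
    & match k with
      | Dagger => [/\ st (u i1 i1) = u i2 i2, st (u i1 i2) = - (q *: u i2 i1),
                      st (u i2 i1) = - (q^-1 *: u i1 i2)
                    & st (u i2 i2) = u i1 i1]
      | Star => [/\ st (u i1 i1) = u i2 i2, st (u i1 i2) = q *: u i2 i1,
                    st (u i2 i1) = q^-1 *: u i1 i2
                  & st (u i2 i2) = u i1 i1]
      | Sharp => forall i j, st (u i j) = u i j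
      end].

(* For [Sharp], invariance under the coaction forces the weights on            *)
(* (psi_1, psi_2) and (psi_2, psi_1) to be in the ratio 1 : -q; the factor     *)
(* ['i] makes the form Hermitian when |q| = 1.                                 *)
Definition spin_mx (c1 c2 : K) (k : star_kind)
    (e : bool) (i : 'I_2) (e' : bool) (j : 'I_2) : K :=
  match k with
  | Dagger =>
      c2 * (e == ~~ e')%:R * (i == j)%:R * ((i == i1)%:R + q ^+ 2 * (i == i2)%:R)
  | Star =>
      c2 * (e == ~~ e')%:R * (i == j)%:R * ((i == i1)%:R - q ^+ 2 * (i == i2)%:R)
  | Sharp =>
      c2 * (e == e')%:R * (i.+1 + j.+1 == 3)%N%:R
      * ('i * (s^-1 * (i == i1)%:R - s * (i == i2)%:R))
      * (if e then 1 else two_q q * c1)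
  end.

End Star.

Section SpinMetric.
Variables (K : numClosedFieldType) (q s : K) (A : algType K).
Variables (Gam : lmodType A) (th : 'I_2 -> 'I_2 -> Gam).
Variables (T : algType K) (iT : {lrmorphism A -> T}) (jT : Gam -> T).
Variables (Cl : algType K) (pi : {lrmorphism T -> Cl}) (c1 : K).

Definition is_spin_metric (h : A -> K) (st : A -> A) (c2 : K) (k : star_kind)
    (met : S0 q th jT pi c1 -> S0 q th jT pi c1 -> K) : Prop :=
  [/\ forall x y z, met (x + y) z = met x z + met y z,
      forall x y z, met x (y + z) = met x y + met x z
    & forall a b e i e' j,
        met (S0l iT a (psiS q th jT pi c1 e i))
            (S0l iT b (psiS q th jT pi c1 e' j)) =
        h (a * st b) * spin_mx q s c1 c2 k e i e' j].

End SpinMetric.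

(* Main.v *)
Require Import Defs.
From HB Require Import structures.
From mathcomp Require Import all_boot all_order all_algebra.
From mathcomp Require Import boolp reals complex.
From mathcomp Require Import ring.

(** The matrices of the statement are braid diagrams.  [Rh] and [Rinv] are the
crossings of two strands, [Cc] and [Ch] the cup and the cap; [th i j] carries
two strands, [psi (e, m)] one strand.  What has to be known about them is the
Yang-Baxter equation in its various orientations, the sliding of a crossing
through a cap, the zigzag and the twist, and all identities between products of
these matrices are moves of diagrams.

Right multiplication on [Gam] has the coordinates [Fm]: [th_p a] is the sum of
the [(Fm p r a) th_r].  A property of [Fm p r a] that is compatible with sums and
products may be checked on the generators of [A] ([OSLq2_ind]), where it is again
a diagram: one more strand, passing between the two strands of each [th_p].  That
[stilde] and [g] are right linear means that this strand can be moved through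
their diagrams ([st_wall], [metric_wall]).

The spinor module.  Ten vectors fixed by [sigma] give quadratic relations
between the [th_p] in the Clifford algebra, and these determine the action of
the [th_p] on the four [psi], by the matrices [spin] ([tht_psi]); so the [psi]
span.  They are free ([psi_free]) because the same matrices define operators on
[A^4] that satisfy the Clifford relations: the failure of
[th_b th_b' = g (th_b (x) th_b')] is an eigenvector of [sigma] for an eigenvalue
different from 1 ([spin_sq_sigma]), so it vanishes on vectors fixed by [sigma].

The connection.  The differentials span [Gam] over [A] ([dspan_all]), so the
Leibniz rule determines [sigmaC], which turns out to be built from [stilde] one
letter at a time ([sigmaC_jC]), and
[nablaC x = theta (x) x - sigmaC (x (x) theta)] ([nablaCE]).  With
[nablaS phi = theta (x) phi - tau (phi (x) theta)] the compatibility of [nablaS]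
with [nablaC] becomes
[tau (x phi (x) theta) = (sigmaC (x) id) (x (x) tau (phi (x) theta))].
This is multiplicative in [x] and reduces to [x = th_p] and [phi = psi_r]; there
the two sides are the two ends of an isotopy ([tau_plus], [tau_minus]).

The Dirac operator.  Removing the twists from the diagram of
[m (tau (psi (x) theta))] leaves a straight strand, hence
[D (a psi) = theta a psi - lam a psi'] where [psi'] is the spinor of the other
sign with the same index and [lam] is a multiple of [gamma] ([dirac_psi]).  The term with
[theta] is always symmetric ([theta_symmetric]): the Haar functional satisfies
[h (Fm p r a) = delta_pr h a], which makes [Fm], up to a constant matrix [Nmx],
adjoint to its conjugate by the involution ([haar_adjoint], [Nmx_Hm]), and [Nmx]
relates the spin matrices and the coefficients of [theta] to their conjugates
([spin_metric_compat], [tc_Nmx]).  What remains is an equation between the two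
numbers [lam], the condition on [gamma] ([lam_condition]).  As [lam] is a nonzero
multiple of [gamma] on the first half of the spinors, [nablaS] determines
[gamma]. *)

Set Implicit Arguments.
Unset Strict Implicit.
Unset Printing Implicit Defensive.

Import Order.TTheory GRing.Theory Num.Theory.

Local Open Scope ring_scope.

(** * Strands, crossings, cups and caps *)

Notation I := 'I_2.

Lemma sum2 (V : nmodType) (F : I -> V) : \sum_a F a = F i1 + F i2.
Proof.
by rewrite big_ord_recl big_ord1; congr (_ + F _); apply: val_inj.
Qed.

Lemma ord2P (P : I -> Prop) : P i1 -> P i2 -> forall x, P x.
Proof.
move=> h1 h2 [[|[|//]] lt]; first by have -> : Ordinal lt = i1 by exact: val_inj.
by have -> : Ordinal lt = i2 by exact: val_inj.
Qed.

Section Tables.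
Variables (K : fieldType) (s : K).
Hypothesis s0 : s != 0.

Lemma CcE : (Cc s i1 i1 = 0) * (Cc s i1 i2 = s^-1) * (Cc s i2 i1 = - s)
  * (Cc s i2 i2 = 0).
Proof. by rewrite /Cc /= !mulr0n !mulr1n !subr0 sub0r. Qed.

Lemma ChE : (Ch s i1 i1 = 0) * (Ch s i1 i2 = - s^-1) * (Ch s i2 i1 = s)
  * (Ch s i2 i2 = 0).
Proof. by rewrite /Ch !CcE opprK oppr0. Qed.

Lemma RhE :
  ((Rh s i1 i1 i1 i1 = s) * (Rh s i1 i1 i1 i2 = 0) * (Rh s i1 i1 i2 i1 = 0)
  * (Rh s i1 i1 i2 i2 = 0) * (Rh s i1 i2 i1 i1 = 0)
  * (Rh s i1 i2 i1 i2 = s - s^-1 ^+ 3) * (Rh s i1 i2 i2 i1 = s^-1)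
  * (Rh s i1 i2 i2 i2 = 0))
  * ((Rh s i2 i1 i1 i1 = 0)
  * (Rh s i2 i1 i1 i2 = s^-1) * (Rh s i2 i1 i2 i1 = 0)
  * (Rh s i2 i1 i2 i2 = 0) * (Rh s i2 i2 i1 i1 = 0)
  * (Rh s i2 i2 i1 i2 = 0) * (Rh s i2 i2 i2 i1 = 0) * (Rh s i2 i2 i2 i2 = s)).
Proof.
do !split; rewrite /Rh /= !CcE !ChE ?mulr0n ?mulr1n; field; rewrite ?s0 //.
Qed.

Lemma RinvE :
  ((Rinv s i1 i1 i1 i1 = s^-1) * (Rinv s i1 i1 i1 i2 = 0)
  * (Rinv s i1 i1 i2 i1 = 0)
  * (Rinv s i1 i1 i2 i2 = 0) * (Rinv s i1 i2 i1 i1 = 0)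
  * (Rinv s i1 i2 i1 i2 = 0) * (Rinv s i1 i2 i2 i1 = s)
  * (Rinv s i1 i2 i2 i2 = 0))
  * ((Rinv s i2 i1 i1 i1 = 0)
  * (Rinv s i2 i1 i1 i2 = s) * (Rinv s i2 i1 i2 i1 = s^-1 - s ^+ 3)
  * (Rinv s i2 i1 i2 i2 = 0) * (Rinv s i2 i2 i1 i1 = 0)
  * (Rinv s i2 i2 i1 i2 = 0) * (Rinv s i2 i2 i2 i1 = 0)
  * (Rinv s i2 i2 i2 i2 = s^-1)).
Proof.
do !split; rewrite /Rinv /= !CcE !ChE ?mulr0n ?mulr1n; field; rewrite ?s0 //.
Qed.

Definition RE := (CcE, ChE, RhE, RinvE).

End Tables.

Section Strands.
Variables (K : fieldType) (s : K).
Hypothesis s0 : s != 0.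

Notation V3 := (I -> I -> I -> K).
Notation V5 := (I -> I -> I -> I -> I -> K).
Notation mat := (I -> I -> I -> I -> K).
Implicit Types (X : mat) (e : bool).

(** A crossing placed on the first or the last two of three strands, and on two
    neighbours among five; the functions are the tensors the diagrams act on. *)
Definition p12 X (v : V3) : V3 := fun x y z => \sum_a \sum_b X x y a b * v a b z.
Definition p23 X (v : V3) : V3 := fun x y z => \sum_a \sum_b X y z a b * v x a b.

Definition b12 X (v : V5) : V5 := fun x y z t w =>
  \sum_a \sum_b X x y a b * v a b z t w.
Definition b23 X (v : V5) : V5 := fun x y z t w =>
  \sum_a \sum_b X y z a b * v x a b t w.
Definition b34 X (v : V5) : V5 := fun x y z t w =>
  \sum_a \sum_b X z t a b * v x y a b w.
Definition b45 X (v : V5) : V5 := fun x y z t w =>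
  \sum_a \sum_b X t w a b * v x y z a b.

Definition cap12 (v : V3) : I -> K := fun z => \sum_a \sum_b Ch s a b * v a b z.
Definition cap23 (v : V3) : I -> K := fun x => \sum_a \sum_b Ch s a b * v x a b.
(** A cup opens two new strands to the right of the given one. *)
Definition cup23 (v : I -> K) : V3 := fun x y z => Cc s y z * v x.

Definition c12 (v : V5) : V3 := fun x y z => \sum_a \sum_b Ch s a b * v a b x y z.
Definition c23 (v : V5) : V3 := fun x y z => \sum_a \sum_b Ch s a b * v x a b y z.
Definition c34 (v : V5) : V3 := fun x y z => \sum_a \sum_b Ch s a b * v x y a b z.
Definition c45 (v : V5) : V3 := fun x y z => \sum_a \sum_b Ch s a b * v x y z a b.
Definition u45 (v : V3) : V5 := fun x y z t w => Cc s t w * v x y z.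

Definition zeroE := (mul0r, mulr0, add0r, addr0, oppr0).

Ltac table := move=> *; rewrite /p12 /p23 /cap12 /cap23 !sum2 !(RE s0) ?zeroE.

(** In the proofs below the crossings are expanded by these tables: they have
    five nonzero entries each, out of sixteen. *)
Lemma p12RhE :
  ((forall v z, p12 (Rh s) v i1 i1 z = s * v i1 i1 z) *
  (forall v z, p12 (Rh s) v i1 i2 z =
     (s - s^-1 ^+ 3) * v i1 i2 z + s^-1 * v i2 i1 z) *
  (forall v z, p12 (Rh s) v i2 i1 z = s^-1 * v i1 i2 z) *
  (forall v z, p12 (Rh s) v i2 i2 z = s * v i2 i2 z)) *
  ((forall v z, p12 (Rinv s) v i1 i1 z = s^-1 * v i1 i1 z) *
  (forall v z, p12 (Rinv s) v i1 i2 z = s * v i2 i1 z) *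
  (forall v z, p12 (Rinv s) v i2 i1 z =
     s * v i1 i2 z + (s^-1 - s ^+ 3) * v i2 i1 z) *
  (forall v z, p12 (Rinv s) v i2 i2 z = s^-1 * v i2 i2 z)).
Proof. by do !split; table. Qed.

Lemma p23RhE :
  ((forall v x, p23 (Rh s) v x i1 i1 = s * v x i1 i1) *
  (forall v x, p23 (Rh s) v x i1 i2 =
     (s - s^-1 ^+ 3) * v x i1 i2 + s^-1 * v x i2 i1) *
  (forall v x, p23 (Rh s) v x i2 i1 = s^-1 * v x i1 i2) *
  (forall v x, p23 (Rh s) v x i2 i2 = s * v x i2 i2)) *
  ((forall v x, p23 (Rinv s) v x i1 i1 = s^-1 * v x i1 i1) *
  (forall v x, p23 (Rinv s) v x i1 i2 = s * v x i2 i1) *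
  (forall v x, p23 (Rinv s) v x i2 i1 =
     s * v x i1 i2 + (s^-1 - s ^+ 3) * v x i2 i1) *
  (forall v x, p23 (Rinv s) v x i2 i2 = s^-1 * v x i2 i2)).
Proof. by do !split; table. Qed.

Lemma cap3E :
  (forall v z, cap12 v z = - s^-1 * v i1 i2 z + s * v i2 i1 z) *
  (forall v x, cap23 v x = - s^-1 * v x i1 i2 + s * v x i2 i1).
Proof. by do !split; table. Qed.

Ltac brute :=
  rewrite ?cap3E ?(p12RhE, p23RhE) /cup23 ?(CcE s) ?zeroE //; field; rewrite ?s0 //.

(** The orientations of the third Reidemeister move that occur below. *)
Lemma yang_baxter e (v : V3) x y z :
  p23 (Rsgn s e) (p12 (Rh s) (p23 (Rh s) v)) x y z =
  p12 (Rh s) (p23 (Rh s) (p12 (Rsgn s e) v)) x y z.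
Proof. by case: e; move: x y z; do 3!apply: ord2P; rewrite /Rsgn; brute. Qed.

Lemma yang_baxterV e (v : V3) x y z :
  p23 (Rsgn s e) (p12 (Rinv s) (p23 (Rinv s) v)) x y z =
  p12 (Rinv s) (p23 (Rinv s) (p12 (Rsgn s e) v)) x y z.
Proof. by case: e; move: x y z; do 3!apply: ord2P; rewrite /Rsgn; brute. Qed.

Lemma yang_baxter_inv1 (v : V3) x y z :
  p23 (Rh s) (p12 (Rh s) (p23 (Rinv s) v)) x y z =
  p12 (Rinv s) (p23 (Rh s) (p12 (Rh s) v)) x y z.
Proof. by move: x y z; do 3!apply: ord2P; brute. Qed.

Lemma yang_baxter_conj e (v : V3) x y z :
  p23 (Rinv s) (p12 (Rsgn s e) (p23 (Rh s) v)) x y z =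
  p12 (Rh s) (p23 (Rsgn s e) (p12 (Rinv s) v)) x y z.
Proof. by case: e; move: x y z; do 3!apply: ord2P; rewrite /Rsgn; brute. Qed.

Lemma yang_baxter_mid e (v : V3) x y z :
  p23 (Rinv s) (p12 (Rinv s) (p23 (Rsgn s e) v)) x y z =
  p12 (Rsgn s e) (p23 (Rinv s) (p12 (Rinv s) v)) x y z.
Proof. by case: e; move: x y z; do 3!apply: ord2P; rewrite /Rsgn; brute. Qed.

Lemma cap_slide e (v : V3) x :
  cap23 (p12 (Rsgn s e) (p23 (Rsgn s e) v)) x = cap12 v x.
Proof. by case: e; move: x; apply: ord2P; rewrite /Rsgn; brute. Qed.

(** A curl: [Rh] is [s] plus [s^-1] times a cap followed by a cup, and a closed
    loop has the value [- (s ^ 2 + s ^ -2)]. *)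
Lemma cap_twist e (v : V3) x :
  cap12 (p12 (Rsgn s e) v) x =
  - (if e then s^-1 ^+ 3 else s ^+ 3) * cap12 v x.
Proof. by case: e; move: x; apply: ord2P; rewrite /Rsgn; brute. Qed.

Lemma zigzag (v : I -> K) x : cap12 (cup23 v) x = v x.
Proof. by move: x; apply: ord2P; brute. Qed.

Lemma partial_trace (v : I -> K) x :
  cap23 (p12 (Rinv s) (cup23 v)) x = - s^-1 ^+ 3 * v x.
Proof. by move: x; apply: ord2P; brute. Qed.

Notation R := (Rh s).
Notation R' := (Rinv s).

Ltac ext5 := apply: funext => x; apply: funext => y; apply: funext => z;
  apply: funext => t; apply: funext => w.
Ltac ext3 := apply: funext => x; apply: funext => y; apply: funext => z.

Lemma far1234 X Y v : b12 X (b34 Y v) = b34 Y (b12 X v).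
Proof. by ext5; rewrite /b12 /b34 !sum2; ring. Qed.

Lemma far1245 X Y v : b12 X (b45 Y v) = b45 Y (b12 X v).
Proof. by ext5; rewrite /b12 /b45 !sum2; ring. Qed.

Lemma far2345 X Y v : b23 X (b45 Y v) = b45 Y (b23 X v).
Proof. by ext5; rewrite /b23 /b45 !sum2; ring. Qed.

(** One strand crosses four others.  This is how a generator [u k l] passes the
    letters [th_p (x) th_r]; as [Rh] and [Rinv] alternate, it passes between the
    two strands of each letter. *)
Definition wall (v : V5) : V5 := b12 R (b23 R' (b34 R (b45 R' v))).

Definition st1234 e e' v := b23 R (b12 (Rsgn s e) (b34 (Rsgn s e') (b23 R' v))).
Definition st2345 e e' v := b34 R (b23 (Rsgn s e) (b45 (Rsgn s e') (b34 R' v))).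

(** The strand of [wall] passes each crossing of [stilde] by one Yang-Baxter
    move; in between it changes sides with respect to the middle pair. *)
Lemma st_wall e e' v : st2345 e e' (wall v) = wall (st1234 e e' v).
Proof.
pose wall' u := b12 R (b23 R (b34 R' (b45 R' u))).
have in_wall u : b34 R' (wall u) = wall' (b23 R' u).
  rewrite /wall /wall' -far1234 -far2345; congr (b12 R _).
  ext5; exact: (yang_baxter_mid true (fun a b c => b45 R' u x a b c w) y z t).
have out_wall u : b34 R (wall' u) = wall (b23 R u).
  rewrite /wall /wall' -far1234 -far2345; congr (b12 R _).
  ext5; exact: (yang_baxter_inv1 (fun a b c => b45 R' u x a b c w) y z t).
have right_wall u : b45 (Rsgn s e') (wall' u) = wall' (b34 (Rsgn s e') u).
  rewrite /wall' -far1245 -far2345; congr (b12 R (b23 R _)).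
  ext5; exact: (yang_baxterV e' (fun a b c => u x y a b c) z t w).
have left_wall u : b23 (Rsgn s e) (wall' u) = wall' (b12 (Rsgn s e) u).
  rewrite /wall' -far1245 -far1234.
  ext5; exact: (yang_baxter e
    (fun a b c => b34 R' (b45 R' u) a b c t w) x y z).
by rewrite /st2345 in_wall right_wall left_wall out_wall.
Qed.

Definition capcap (v : V5) : I -> K := fun w =>
  \sum_a \sum_b \sum_c \sum_d Ch s a b * Ch s c d * v a b c d w.
Definition capcap' (v : V5) : I -> K := fun w =>
  \sum_a \sum_b \sum_c \sum_d Ch s a b * Ch s c d * v w a b c d.

Lemma capcapE v w : capcap v w = cap12 (c12 v) w.
Proof. by rewrite /capcap /cap12 /c12 !sum2; ring. Qed.
Lemma capcapE' v w : capcap' v w = cap23 (c23 v) w.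
Proof. by rewrite /capcap' /cap23 /c23 !sum2; ring. Qed.

Lemma c12_far34 X v : c12 (b34 X v) = p12 X (c12 v).
Proof. by ext3; rewrite /c12 /b34 /p12 !sum2; ring. Qed.
Lemma c12_far45 X v : c12 (b45 X v) = p23 X (c12 v).
Proof. by ext3; rewrite /c12 /b45 /p23 !sum2; ring. Qed.
Lemma c45_far12 X v : c45 (b12 X v) = p12 X (c45 v).
Proof. by ext3; rewrite /c45 /b12 /p12 !sum2; ring. Qed.
Lemma c45_far23 X v : c45 (b23 X v) = p23 X (c45 v).
Proof. by ext3; rewrite /c45 /b23 /p23 !sum2; ring. Qed.
Lemma b23_u45 X v : b23 X (u45 v) = u45 (p23 X v).
Proof. by ext5; rewrite /u45 /b23 /p23 !sum2; ring. Qed.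
Lemma c12_u45 v : c12 (u45 v) = cup23 (cap12 v).
Proof. by ext3; rewrite /u45 /c12 /cap12 /cup23 !sum2; ring. Qed.
Lemma c23_u45 v : c23 (u45 v) = cup23 (cap23 v).
Proof. by ext3; rewrite /u45 /c23 /cap23 /cup23 !sum2; ring. Qed.

Lemma c12_slide e v : c23 (b12 (Rsgn s e) (b23 (Rsgn s e) v)) = c12 v.
Proof. by ext3; exact: (cap_slide e (fun a b c => v a b c y z) x). Qed.
Lemma c23_slide e v : c34 (b23 (Rsgn s e) (b34 (Rsgn s e) v)) = c23 v.
Proof. by ext3; exact: (cap_slide e (fun a b c => v x a b c z) y). Qed.
Lemma c34_slide e v : c45 (b34 (Rsgn s e) (b45 (Rsgn s e) v)) = c34 v.
Proof. by ext3; exact: (cap_slide e (fun a b c => v x y a b c) z). Qed.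

(** The diagram of [g] is a crossing of the middle strands followed by two caps;
    each cap absorbs two crossings of [wall]. *)
Lemma metric_wall v k : capcap' (b34 R' (wall v)) k = capcap (b23 R' v) k.
Proof.
have in_wall u : b34 R' (wall u) = b12 R (b23 R (b34 R' (b45 R' (b23 R' u)))).
  rewrite /wall -far1234 -far2345; congr (b12 R _).
  ext5; exact: (yang_baxter_mid true (fun a b c => b45 R' u x a b c w) y z t).
rewrite in_wall capcapE' capcapE (c12_slide true).
by rewrite c12_far34 c12_far45 (cap_slide false).
Qed.

(** Clifford multiplication on [psi^+] caps two strands after a crossing, on
    [psi^-] it caps them directly.  The next two lemmas compare, for [stilde]
    followed by such a cap, the position of the cap before and after [tau];
    [tau_minus] needs only cap slides. *)
Lemma tau_minus e e' v :
  c45 (st1234 e e' (b45 (Rsgn s e') (b34 R' (u45 v)))) =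
  p23 R (p12 (Rsgn s e) (cup23 (cap23 v))).
Proof.
rewrite /st1234 c45_far23 c45_far12; congr (p23 R (p12 _ _)).
by rewrite far2345 (c34_slide e') (c23_slide false) c23_u45.
Qed.

Lemma tau_plus e e' v :
  c34 (b45 R' (st1234 e e' (b45 R (b34 (Rsgn s e) (u45 v))))) =
  p23 (Rsgn s e') (p12 R' (cup23 (cap12 (p23 R' v)))).
Proof.
rewrite /st1234 -far2345 -far1245 far2345.
have -> u : b45 R' (b34 (Rsgn s e') (b45 R u)) =
            b34 R (b45 (Rsgn s e') (b34 R' u)).
  by ext5; exact: (yang_baxter_conj e' (fun a b c => u x y a b c) z t w).
rewrite far1234.
have -> u : b34 R' (b23 R' (b34 (Rsgn s e) u)) =
            b23 (Rsgn s e) (b34 R' (b23 R' u)).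
  by ext5; exact: (yang_baxter_mid e (fun a b c => u x a b c w) y z t).
rewrite (c23_slide true) -far2345 (c12_slide e) c12_far45 c12_far34.
by rewrite b23_u45 c12_u45.
Qed.

End Strands.

(** * From diagrams to the matrices of the calculus *)

Section Bridge.
Variables (K : fieldType) (s : K).
Hypothesis s0 : s != 0.
Notation V5 := (I -> I -> I -> I -> I -> K).

Lemma sum_pair (V : nmodType) (S T : finType) (F : S * T -> V) :
  \sum_p F p = \sum_a \sum_b F (a, b).
Proof. by rewrite (pair_bigA _ (fun a b => F (a, b))); apply: eq_bigr => -[]. Qed.

Lemma sum_idx4 (V : nmodType) (F : idx4 -> V) :
  \sum_b F b = \sum_x \sum_y \sum_z \sum_t F ((x, y), (z, t)).
Proof.
by rewrite !sum_pair; do 2!(apply: eq_bigr => ? _); rewrite sum_pair.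
Qed.

Definition mxact (X : idx4 -> idx4 -> K) (v : V5) : V5 := fun x y z t w =>
  \sum_b X ((x, y), (z, t)) b * v b.1.1 b.1.2 b.2.1 b.2.2 w.

Lemma mxact_opM X Y v : mxact (opM X Y) v = mxact X (mxact Y v).
Proof.
apply: funext => x; apply: funext => y; apply: funext => z;
apply: funext => t; apply: funext => w; rewrite /mxact.
under eq_bigr do rewrite /opM mulr_suml; rewrite exchange_big /=.
apply: eq_bigr => -[[a b] [c d]] _; rewrite mulr_sumr.
by apply: eq_bigr => e _; rewrite mulrA.
Qed.

Ltac leg := apply: funext => x; apply: funext => y; apply: funext => z;
  apply: funext => t; apply: funext => w; rewrite /mxact sum_idx4.

Lemma mxact12 X v : mxact (leg12 X) v = b12 X v.
Proof.
leg; rewrite /b12 /leg12 /=; do 2!(apply: eq_bigr => ? _).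
by move: z t; do 2!apply: ord2P; rewrite !sum2 /= ?mulr0n ?mulr1n ?mul0r ?add0r ?addr0.
Qed.

Lemma mxact34 X v : mxact (leg34 X) v = b34 X v.
Proof.
leg; rewrite /b34 /leg34 /=.
by move: x y; do 2!apply: ord2P; rewrite !sum2 /= ?mulr0n ?mulr1n ?mul0r ?add0r ?addr0.
Qed.

Lemma mxact23 X v : mxact (leg23 X) v = b23 X v.
Proof.
leg; rewrite /b23 /leg23 /=.
by move: x t; do 2!apply: ord2P; rewrite !sum2 /= ?mulr0n ?mulr1n ?mul0r ?add0r ?addr0.
Qed.

Lemma mxact_stilde e e' v : mxact (stilde_mx s e e') v = st1234 s e e' v.
Proof. by rewrite /stilde_mx !mxact_opM !mxact23 mxact12 mxact34. Qed.

(** Up to the sign [nu0], the coefficients of [th_r] in [th_p u^k_l], see [F_u]: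
    half of [wall]. *)
Definition fmx (p r : I * I) (m l : I) : K :=
  \sum_t Rh s m r.1 p.1 t * Rinv s t r.2 p.2 l.

Definition ffmx (b b' : idx4) (m l : I) : K :=
  \sum_n fmx b.1 b'.1 m n * fmx b.2 b'.2 n l.

Lemma half_wallE (w : I -> I -> I -> K) m x y :
  \sum_i \sum_t Rh s m x i t * (\sum_j \sum_l Rinv s t y j l * w i j l) =
  \sum_p \sum_l fmx p (x, y) m l * w p.1 p.2 l.
Proof. by rewrite sum_pair /fmx !sum2 /=; ring. Qed.

Lemma wallE v m (b' : idx4) :
  wall s v m b'.1.1 b'.1.2 b'.2.1 b'.2.2 =
  \sum_b \sum_l ffmx b b' m l * v b.1.1 b.1.2 b.2.1 b.2.2 l.
Proof.
case: b' => -[x y] [z t] /=; rewrite /wall.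
pose w := b34 (Rh s) (b45 (Rinv s) v).
rewrite -[LHS]/(\sum_i \sum_t' Rh s m x i t' *
  (\sum_j \sum_l Rinv s t' y j l * w i j l z t)).
rewrite (half_wallE (fun i j l => w i j l z t)) /=.
have wE p n : w p.1 p.2 n z t =
    \sum_q \sum_l fmx q (z, t) n l * v p.1 p.2 q.1 q.2 l :=
  half_wallE (fun j k l => v p.1 p.2 j k l) n z t.
under eq_bigr => p _ do under eq_bigr => n _ do rewrite wE mulr_sumr.
rewrite [RHS]sum_pair; apply: eq_bigr => p _.
rewrite exchange_big; apply: eq_bigr => q _ /=.
under eq_bigr do rewrite mulr_sumr; rewrite exchange_big /=.
apply: eq_bigr => l _; rewrite /ffmx mulr_suml.
by apply: eq_bigr => n _; rewrite mulrA.
Qed.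

Definition delta5 (b : idx4) (l : I) : V5 := fun x y z t w =>
  ((((x, y), (z, t)) == b) && (w == l))%:R.

Lemma sum_delta (T : finType) (F : T -> K) x : \sum_y F y * (y == x)%:R = F x.
Proof.
rewrite (bigD1 x) //= eqxx mulr1 big1 ?addr0 // => y /negPf ->.
by rewrite mulr0.
Qed.

Lemma wall_delta b l m (b' : idx4) :
      wall s (delta5 b l) m b'.1.1 b'.1.2 b'.2.1 b'.2.2 = ffmx b b' m l.
Proof.
rewrite wallE -(sum_delta (fun c => ffmx c b' m l) b).
apply: eq_bigr => -[[x y] [z t]] _ /=.
rewrite -(sum_delta (ffmx ((x, y), (z, t)) b' m) l) mulr_suml.
by apply: eq_bigr => n _; rewrite -mulrA -natrM mulnb andbC.
Qed.

(** [st_wall] read on matrix entries; with [ffmx_gmx] this is all that the right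
    linearity of [stilde], [sigma] and [g] uses. *)
Lemma ffmx_stilde e e' (a b : idx4) m l :
  \sum_b' stilde_mx s e e' a b' * ffmx b b' m l =
  \sum_b' stilde_mx s e e' b' b * ffmx b' a m l.
Proof.
have act_delta x y z t n : st1234 s e e' (delta5 b l) x y z t n =
    stilde_mx s e e' ((x, y), (z, t)) b * (n == l)%:R.
  rewrite -mxact_stilde -(sum_delta (stilde_mx s e e' ((x, y), (z, t))) b).
  rewrite /mxact mulr_suml; apply: eq_bigr => -[[x' y'] [z' t']] _.
  by rewrite -mulrA -natrM mulnb.
have := congr1 (fun v => v m a.1.1 a.1.2 a.2.1 a.2.2)
  (st_wall s0 e e' (delta5 b l)).
rewrite wallE.
have -> : st2345 s e e' (wall s (delta5 b l)) m a.1.1 a.1.2 a.2.1 a.2.2 =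
    \sum_b' stilde_mx s e e' a b' * ffmx b b' m l.
  pose v := wall s (delta5 b l).
  transitivity (mxact (stilde_mx s e e') (fun x y z t _ => v m x y z t)
                  a.1.1 a.1.2 a.2.1 a.2.2 m); first by rewrite mxact_stilde.
  rewrite /mxact; apply: eq_bigr => b' _; rewrite -wall_delta.
  by case: (a) => -[].
move->; apply: eq_bigr => -[[x y] [z t]] _ /=.
under eq_bigr do rewrite act_delta mulrA; rewrite sum_delta; exact: mulrC.
Qed.

Definition gmx c (b : idx4) : K := g_mx s c b.1.1 b.1.2 b.2.1 b.2.2.

Lemma gmx_capcap c (w : I -> I -> I -> I -> K) k :
  \sum_b gmx c b * w b.1.1 b.1.2 b.2.1 b.2.2 =
  - s * c * capcap s (b23 (Rinv s) (fun x y z t _ => w x y z t)) k.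
Proof.
rewrite sum_idx4 /gmx /g_mx /capcap /b23 /= !sum2 /=; ring.
Qed.

Lemma gmx_capcap' c (w : I -> I -> I -> I -> K) k :
  \sum_b gmx c b * w b.1.1 b.1.2 b.2.1 b.2.2 =
  - s * c * capcap' s (b34 (Rinv s) (fun _ x y z t => w x y z t)) k.
Proof. by rewrite (gmx_capcap c w k). Qed.

Lemma ffmx_gmx c b m l :
  \sum_b' gmx c b' * ffmx b b' m l = gmx c b * (m == l)%:R.
Proof.
under eq_bigr do rewrite -wall_delta.
rewrite (gmx_capcap' c (fun x y z t => wall s (delta5 b l) m x y z t) m).
have := metric_wall s0 (delta5 b l) m; rewrite /capcap' /b34 => ->.
have -> : capcap s (b23 (Rinv s) (delta5 b l)) m =
  capcap s (b23 (Rinv s) (fun x y z t _ => delta5 b l x y z t m)) m by [].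
rewrite -gmx_capcap -(sum_delta (gmx c) b) mulr_suml.
apply: eq_bigr => -[[x y] [z t]] _ /=.
by rewrite /delta5 /= -mulrA -natrM mulnb.
Qed.

End Bridge.

(** * Induction on generators *)

Section Subalgebra.
Variables (K : fieldType) (B : algType K) (P : B -> Prop).

Definition subalgebra := [/\ P 1, forall x y, P x -> P y -> P (x + y),
  forall x y, P x -> P y -> P (x * y) & forall (c : K) x, P x -> P (c *: x)].

Hypothesis subP : subalgebra.

(** The argument attaches the closure property to the predicate, for the
    inference of the algebra structure. *)
Definition in_sub (_ : subalgebra) : {pred B} := fun x => `[< P x >].

Fact in_sub_closed : GRing.subsemialg_closed (in_sub subP).
Proof.
case: subP => P1 PD PM PZ.
apply: GRing.subalg_closed_semi; split; first by apply/asboolP.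
  by move=> c x y /asboolP Px /asboolP Py; apply/asboolP/PD => //; apply: PZ.
by move=> x y /asboolP Px /asboolP Py; apply/asboolP/PM.
Qed.

HB.instance Definition _ :=
  GRing.isSubalgClosed.Build K B (in_sub subP) in_sub_closed.

Record sub_alg := SubAlg { sub_val :> B; _ : sub_val \in in_sub subP }.

HB.instance Definition _ := [isSub for sub_val].
HB.instance Definition _ := [Choice of sub_alg by <:].
HB.instance Definition _ := [SubChoice_isSubAlgebra of sub_alg by <:].

Definition sub_incl (x : sub_alg) : B := val x.

Fact sub_incl_linear : linear sub_incl. Proof. by move=> c x y. Qed.
Fact sub_incl_monoid : monoid_morphism sub_incl. Proof. by []. Qed.

HB.instance Definition _ :=
  GRing.isLinear.Build K sub_alg B _ sub_incl sub_incl_linear.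
HB.instance Definition _ :=
  GRing.isMonoidMorphism.Build sub_alg B sub_incl sub_incl_monoid.

End Subalgebra.

Section SubalgebraTheory.
Variables (K : fieldType) (B : algType K) (P : B -> Prop).

(** A subalgebra given by a [Prop] is itself an algebra, so that the universal
    properties of [A] and of the tensor algebra apply to it. *)
Lemma subalgebra_lift : subalgebra P ->
  exists (S : algType K) (v : {lrmorphism S -> B}),
    [/\ injective v, forall x, P (v x) & forall x, P x -> exists y, v y = x].
Proof.
move=> subP; exists (sub_alg subP).
exists (@sub_incl K B P subP : {lrmorphism _ -> _}).
split; [exact: val_inj|by move=> x; apply/asboolP/(valP x)|].
move=> x /asboolP Px; by exists (SubAlg (Px : x \in in_sub subP)).
Qed.

End SubalgebraTheory.

Section QuantumGroup.
Variables (K : fieldType) (q s : K).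
Hypotheses (s0 : s != 0) (s2 : s ^+ 2 = q).
Variables (A : algType K) (u : I -> I -> A).
Hypothesis hA : is_OSLq2 q s u.

(** Two algebra maps out of [A] that agree on the generators are equal, so the
    inclusion of a subalgebra containing them has a section. *)
Lemma OSLq2_ind (P : A -> Prop) :
  subalgebra P -> (forall i j, P (u i j)) -> forall a, P a.
Proof.
move=> subP Pu; have [S [v [v_inj Pv vP]]] := subalgebra_lift subP.
have /boolp.choice[b0 b0E] : forall ij, exists y, v y = u ij.1 ij.2.
  by move=> ij; apply: vP.
pose b i j := b0 (i, j); have bE i j : v (b i j) = u i j by rewrite /b b0E.
have [[uR uD] univ] := hA.
have relb : SLq2_rel q s b.
  split=> [i j m n|]; apply: v_inj; last first.
    by rewrite linearB linearZZ rmorph1 !rmorphM /= !bE.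
  rewrite !linear_sum /=; under eq_bigr do rewrite linear_sum.
  under [RHS]eq_bigr do rewrite linear_sum.
  transitivity (\sum_k \sum_l Rh s i j k l *: (u k m * u l n)).
    by do 2!(apply: eq_bigr => ? _); rewrite linearZZ /= rmorphM /= !bE.
  rewrite uR; do 2!(apply: eq_bigr => ? _).
  by rewrite linearZZ /= rmorphM /= !bE.
have [f [fE _]] := univ S b relb.
have [g [gE gU]] := univ A u hA.1.
move=> a; suff <- : v (f a) = a by exact: Pv.
have -> : v (f a) = (v \o f) a by [].
rewrite (gU (v \o f)) => [|i j]; last by rewrite /= fE.
by rewrite -(gU idfun).
Qed.

Let uR : forall i j m n,
  \sum_k \sum_l Rh s i j k l *: (u k m * u l n) =
  \sum_k \sum_l Rh s k l m n *: (u i k * u j l) := hA.1.1.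

Let q0 : q != 0. Proof. by rewrite -s2 expf_neq0. Qed.

Lemma u_det : u i1 i1 * u i2 i2 = 1 + q *: (u i1 i2 * u i2 i1).
Proof. by rewrite -hA.1.2 subrK. Qed.

Let tab := (RE s0).

Lemma u21_u12 : u i2 i1 * u i1 i2 = u i1 i2 * u i2 i1.
Proof.
have := uR i1 i2 i1 i2; rewrite !sum2 !tab !scale0r !(addr0, add0r).
by move/addrI/scalerI; apply; rewrite invr_eq0.
Qed.

Lemma u21_u11 : u i2 i1 * u i1 i1 = q^-1 *: (u i1 i1 * u i2 i1).
Proof.
have := uR i1 i2 i1 i1; rewrite !sum2 !tab !scale0r !(addr0, add0r).
move/(canRL (addKr _)); rewrite -scaleNr -scalerDl.
move/(congr1 (GRing.scale s)); rewrite !scalerA mulfV // scale1r => ->.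
congr (_ *: _); rewrite -s2; field; exact: s0.
Qed.

Lemma u22_u12 : u i2 i2 * u i1 i2 = q^-1 *: (u i1 i2 * u i2 i2).
Proof.
have := uR i1 i2 i2 i2; rewrite !sum2 !tab !scale0r !(addr0, add0r).
move/(canRL (addKr _)); rewrite -scaleNr -scalerDl.
move/(congr1 (GRing.scale s)); rewrite !scalerA mulfV // scale1r => ->.
congr (_ *: _); rewrite -s2; field; exact: s0.
Qed.

Lemma u22_u11 : u i2 i2 * u i1 i1 = 1 + q^-1 *: (u i1 i2 * u i2 i1).
Proof.
have := uR i1 i2 i2 i1; rewrite !sum2 !tab !scale0r !(addr0, add0r) u_det.
move/(canRL (addKr _))/(congr1 (GRing.scale s)).
rewrite scalerDr !scalerA mulfV // [1 *: _]scale1r => ->.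
rewrite scalerN scalerA scale1r addrCA; congr (_ + _).
rewrite -scaleNr -scalerDl; congr (_ *: _); rewrite -s2; field; exact: s0.
Qed.

(** The antipode on the generators. *)
Definition Su (i j : I) : A :=
  if i == i1 then if j == i1 then u i2 i2 else - q^-1 *: u i1 i2
  else if j == i1 then - q *: u i2 i1 else u i1 i1.

Lemma Su_u m l : \sum_k Su m k * u k l = (m == l)%:R.
Proof.
rewrite sum2 /Su; move: m l; do 2!apply: ord2P => /=; rewrite -!scalerAl.
- by rewrite u22_u11 scaleNr addrK.
- by rewrite u22_u12 scaleNr subrr.
- rewrite u21_u11 scalerA mulNr mulfV ?q0 // scaleN1r addNr //.
- by rewrite u21_u12 scaleNr u_det addrC addrK.
Qed.

End QuantumGroup.

(** * The bimodule of one-forms *)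

Section Additive.
Variables (U V : zmodType) (f : U -> V).
Hypothesis fD : {morph f : x y / x + y}.

Lemma morphD0 : f 0 = 0.
Proof. by apply: (addrI (f 0)); rewrite -fD !addr0. Qed.

Lemma morphDN : {morph f : x / - x}.
Proof. by move=> x; apply: (addrI (f x)); rewrite -fD !subrr morphD0. Qed.

Lemma morphDB : {morph f : x y / x - y}.
Proof. by move=> x y; rewrite fD morphDN. Qed.

Lemma morphD_sum (J : Type) (r : seq J) (P : pred J) (F : J -> U) :
  f (\sum_(j <- r | P j) F j) = \sum_(j <- r | P j) f (F j).
Proof. exact: (big_morph f fD morphD0). Qed.

End Additive.

Section TensorExt.
Variables (A : Type) (M N : zmodType) (r : M -> A -> M) (l : A -> N -> N).

(** Two additive maps are compared on pure tensors; this replaces the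
    uniqueness part of the universal property everywhere below. *)
Lemma tens_ext (Z : zmodType) (f g : tens r l -> Z) :
  {morph f : t t' / t + t'} -> {morph g : t t' / t + t'} ->
  (forall m n, f (tpure m n) = g (tpure m n)) -> f =1 g.
Proof.
move=> fD gD fg t; rewrite (tens_sum t) !morphD_sum //.
by apply: eq_bigr => p _.
Qed.

Lemma tpureDl (m m' : M) (n : N) :
  tpure (m + m') n = tpure m n + tpure m' n :> tens r l.
Proof. by case: (tpure_balanced r l). Qed.

Lemma tpureDr (m : M) (n n' : N) :
  tpure m (n + n') = tpure m n + tpure m n' :> tens r l.
Proof. by case: (tpure_balanced r l). Qed.

Lemma tpureA m a (n : N) : tpure (r m a) n = tpure m (l a n) :> tens r l.
Proof. by case: (tpure_balanced r l). Qed.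

Lemma tpure_suml (J : Type) (x : seq J) (F : J -> M) n :
  tpure (\sum_(j <- x) F j) n = \sum_(j <- x) tpure (F j) n :> tens r l.
Proof. exact: (morphD_sum (fun m m' => tpureDl m m' n)). Qed.

Lemma tpure_sumr (J : Type) (x : seq J) (F : J -> N) m :
  tpure m (\sum_(j <- x) F j) = \sum_(j <- x) tpure m (F j) :> tens r l.
Proof. exact: (morphD_sum (tpureDr m)). Qed.

Lemma tpureBl (m m' : M) (n : N) :
  tpure (m - m') n = tpure m n - tpure m' n :> tens r l.
Proof. exact: (morphDB (fun m m' => tpureDl m m' n)). Qed.

End TensorExt.

Section Calculus.
Variables (K : fieldType) (q s : K).
Hypotheses (s0 : s != 0) (s2 : s ^+ 2 = q).
Variables (A : algType K) (u : I -> I -> A).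
Hypothesis hA : is_OSLq2 q s u.
Variables (nu0 : K).
Hypothesis hnu0 : nu0 = 1 \/ nu0 = -1.
Variables (Gam : lmodType A) (th : I -> I -> Gam) (rm : Gam -> A -> Gam).
Hypothesis hGam : is_4Dcalc s u th rm nu0.

Notation pr := (I * I)%type.
Definition thp (p : pr) : Gam := th p.1 p.2.

Fact thp_span x : exists a : pr -> A, x = \sum_p a p *: thp p.
Proof.
case: hGam => span _ _ _ _; have [a ->] := span x.
by exists (fun p => a p.1 p.2); rewrite sum_pair.
Qed.

Fact thp_free (a : pr -> A) : \sum_p a p *: thp p = 0 -> forall p, a p = 0.
Proof.
case: hGam => _ free _ _ _; rewrite sum_pair => /(free (fun i j => a (i, j))) a0.
by case.
Qed.

Definition coef x : pr -> A := projT1 (cid (thp_span x)).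

Lemma coE x : x = \sum_p coef x p *: thp p.
Proof. exact: (projT2 (cid (thp_span x))). Qed.

Lemma co_sum (a : pr -> A) p : coef (\sum_p a p *: thp p) p = a p.
Proof.
apply/eqP; rewrite -subr_eq0; apply/eqP.
pose b p := coef (\sum_p a p *: thp p) p - a p; apply: (@thp_free b).
under eq_bigr do rewrite scalerBl.
by rewrite sumrB -coE subrr.
Qed.

Lemma coD p : {morph coef^~ p : x y / x + y}.
Proof.
move=> x y /=; rewrite [in LHS](coE x) [in LHS](coE y) -big_split /=.
by under eq_bigr do rewrite -scalerDl; rewrite (co_sum (fun p => _ + _)).
Qed.

Lemma coZ a x p : coef (a *: x) p = a * coef x p.
Proof.
rewrite [in LHS](coE x) scaler_sumr.
by under eq_bigr do rewrite scalerA; rewrite (co_sum (fun p => _ * _)).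
Qed.

Lemma sum_ind (V : lmodType A) (F : pr -> V) p : \sum_r (p == r)%:R *: F r = F p.
Proof.
rewrite (bigD1 p) //= eqxx scale1r big1 ?addr0 // => r; rewrite eq_sym.
by move/negPf->; rewrite scale0r.
Qed.

Lemma co_th p r : coef (thp p) r = (p == r)%:R.
Proof. by rewrite -[in LHS](sum_ind thp p) (co_sum (fun r => _%:R)). Qed.

Lemma rmDl x y a : rm (x + y) a = rm x a + rm y a.
Proof. by case: hGam => _ _ []. Qed.
Lemma rmDr x a b : rm x (a + b) = rm x a + rm x b.
Proof. by case: hGam => _ _ []. Qed.
Lemma rmM x a b : rm x (a * b) = rm (rm x a) b.
Proof. by case: hGam => _ _ []. Qed.
Lemma rmZ a x b : rm (a *: x) b = a *: rm x b.
Proof. by case: hGam => _ _ []. Qed.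
Lemma rm_scalar x c : rm x c%:A = c%:A *: x.
Proof. by case: hGam. Qed.
Lemma rm1 x : rm x 1 = x.
Proof. by rewrite -[1](scale1r (1 : A)) rm_scalar !scale1r. Qed.
Lemma rm_suml (J : Type) (r : seq J) (F : J -> Gam) a :
  rm (\sum_(j <- r) F j) a = \sum_(j <- r) rm (F j) a.
Proof. exact: (morphD_sum (fun x y => rmDl x y a)). Qed.
Lemma rm_sumr (J : Type) (r : seq J) (F : J -> A) x :
  rm x (\sum_(j <- r) F j) = \sum_(j <- r) rm x (F j).
Proof. exact: (morphD_sum (rmDr x)). Qed.

(** The right action in the left basis [th_p]; [FM] says that [a |-> Fm a] is a
    matrix representation of [A] over itself. *)
Definition Fm p r a := coef (rm (thp p) a) r.

Lemma FE p a : rm (thp p) a = \sum_r Fm p r a *: thp r.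
Proof. exact: coE. Qed.

Lemma FD p r : {morph Fm p r : a b / a + b}.
Proof. by move=> a b; rewrite /Fm rmDr coD. Qed.

Lemma co_rm x a r : coef (rm x a) r = \sum_p coef x p * Fm p r a.
Proof.
rewrite [in LHS](coE x) rm_suml (morphD_sum (coD r)).
by apply: eq_bigr => p _; rewrite rmZ coZ.
Qed.

Lemma FM p r a b : Fm p r (a * b) = \sum_k Fm p k a * Fm k r b.
Proof. by rewrite /Fm rmM co_rm. Qed.

Lemma scalarM c (a : A) : c%:A * a = c *: a.
Proof. by rewrite -scalerAl mul1r. Qed.
Lemma Mscalar c (a : A) : a * c%:A = c *: a.
Proof. by rewrite -scalerAr mulr1. Qed.

Lemma FZ p r c a : Fm p r (c *: a) = c *: Fm p r a.
Proof. by rewrite /Fm -Mscalar rmM rm_scalar coZ scalarM. Qed.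

Lemma F1 p r : Fm p r 1 = (p == r)%:R.
Proof. by rewrite /Fm rm1 co_th. Qed.

Lemma F_u p r k l : Fm p r (u k l) = \sum_m (nu0 * fmx s p r m l) *: u k m.
Proof.
rewrite /Fm; case: hGam => _ _ _ _ ->.
transitivity (coef (\sum_r (\sum_m (nu0 * fmx s p r m l) *: u k m) *: thp r) r);
  last by rewrite (co_sum (fun r => \sum_m (nu0 * fmx s p r m l) *: u k m)).
congr (coef _ r); rewrite sum_pair.
under [RHS]eq_bigr do under eq_bigr do rewrite scaler_suml.
under [RHS]eq_bigr do rewrite exchange_big /=.
rewrite [RHS]exchange_big; apply: eq_bigr => m _; apply: eq_bigr => a _ /=.
rewrite exchange_big; apply: eq_bigr => b _ /=.
rewrite /fmx mulr_sumr !scaler_suml; apply: eq_bigr => t _.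
by rewrite mulrA.
Qed.

Lemma nu0K : nu0 * nu0 = 1.
Proof. by case: hnu0 => ->; rewrite ?mulr1 // mulrNN mulr1. Qed.

Lemma nu0_neq0 : nu0 != 0.
Proof. by apply/eqP => n0; move: nu0K; rewrite n0 mul0r => /eqP; rewrite eq_sym oner_eq0. Qed.

End Calculus.

Section FmxTable.
Variables (K : fieldType) (q s : K).
Hypotheses (s0 : s != 0) (s2 : s ^+ 2 = q).

(** A table that reduces by computation, for the case analyses over six indices
    below. *)
Definition ftab (p1 p2 r1 r2 m l : bool) : K :=
  match p1, p2, r1, r2, m, l with
  | true, true, true, true, true, true
  | true, true, true, true, false, false => 1
  | true, true, false, true, true, false => q - q^-1
  | true, false, true, true, false, true => q^-1 - q
  | true, false, true, false, true, true => q
  | true, false, true, false, false, false => q^-1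
  | true, false, false, true, true, true => (1 - q ^+ 2) * (1 - q^-1 ^+ 2)
  | true, false, false, false, true, false => 1 - q^-1 ^+ 2
  | false, true, false, true, true, true => q^-1
  | false, true, false, true, false, false => q
  | false, false, false, true, false, true => 1 - q ^+ 2
  | false, false, false, false, true, true
  | false, false, false, false, false, false => 1
  | _, _, _, _, _, _ => 0
  end.

Lemma fmxE p r m l : fmx s p r m l =
  ftab (p.1 == i1) (p.2 == i1) (r.1 == i1) (r.2 == i1) (m == i1) (l == i1).
Proof.
case: p r => p1 p2 [r1 r2]; move: p1 p2 r1 r2 m l; do 6!apply: ord2P;
  by rewrite /fmx sum2 /= !(RE s0) ?zeroE // -?s2; field; rewrite ?s0.
Qed.

End FmxTable.

Section TensorModule.
Variables (K : fieldType) (s : K) (A : algType K) (u : I -> I -> A) (nu0 : K).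
Variables (Gam : lmodType A) (th : I -> I -> Gam) (rm : Gam -> A -> Gam).
Hypothesis hGam : is_4Dcalc s u th rm nu0.
Variables (N : zmodType) (l : A -> N -> N).

(** The tensor product [Gam (x) N] as a left [A]-module; the proof [hGam] is an
    argument because it is what makes the action well defined. *)
Definition GT (_ : is_4Dcalc s u th rm nu0) : Type := tens rm l.
HB.instance Definition _ := GRing.Zmodule.on (GT hGam).

Lemma tactl_balanced a :
  balanced rm l (fun m n => tpure (a *: m) n : tens rm l).
Proof.
split=> [m m' n|m n n'|m b n]; rewrite ?scalerDr ?tpureDl ?tpureDr //.
by rewrite -(rmZ hGam) tpureA.
Qed.

Definition gt_scale a (t : GT hGam) : GT hGam := tactl (@lsc K A Gam) a t.

Lemma gt_scale_pure a m n : gt_scale a (tpure m n) = tpure (a *: m) n.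
Proof. exact: tlift_pure (tactl_balanced a). Qed.

Fact gt_scaleD a : {morph gt_scale a : t t' / t + t'}.
Proof. exact: tliftD (tactl_balanced a). Qed.

Fact gt_scaleA a b t : gt_scale a (gt_scale b t) = gt_scale (a * b) t.
Proof.
move: t; apply: tens_ext => [t t'|t t'|m n]; rewrite ?gt_scaleD //.
by rewrite !gt_scale_pure scalerA.
Qed.

Fact gt_scale1 : left_id 1 gt_scale.
Proof.
apply: tens_ext => [t t'|t t'|m n]; rewrite ?gt_scaleD //.
by rewrite gt_scale_pure scale1r.
Qed.

Fact gt_scaleDr : right_distributive gt_scale +%R.
Proof. exact: gt_scaleD. Qed.

Fact gt_scaleDl t : {morph gt_scale^~ t : a b / a + b}.
Proof.
move=> a b /=; move: t; apply: tens_ext => [t t'|t t'|m n].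
- exact: gt_scaleD.
- by rewrite !gt_scaleD addrACA.
by rewrite !gt_scale_pure scalerDl tpureDl.
Qed.

HB.instance Definition _ := GRing.Zmodule_isLmodule.Build A (GT hGam)
  gt_scaleA gt_scale1 gt_scaleDr gt_scaleDl.

Lemma GT_scaleE a (t : GT hGam) : a *: t = tactl (@lsc K A Gam) a t.
Proof. by []. Qed.

Lemma GT_scale_pure a m n : a *: (tpure m n : GT hGam) = tpure (a *: m) n.
Proof. exact: gt_scale_pure. Qed.

End TensorModule.

Section Bimodule.
Variables (K : fieldType) (q s : K).
Hypotheses (s0 : s != 0) (s2 : s ^+ 2 = q).
Variables (A : algType K) (u : I -> I -> A).
Hypothesis hA : is_OSLq2 q s u.
Variables (nu0 : K).
Hypothesis hnu0 : nu0 = 1 \/ nu0 = -1.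
Variables (Gam : lmodType A) (th : I -> I -> Gam) (rm : Gam -> A -> Gam).
Hypothesis hGam : is_4Dcalc s u th rm nu0.

Notation th' := (thp th).
Notation coef := (coef hGam).
Notation GG := (GT (@lsc K A Gam) hGam).
Notation th2 := (th2 th rm : idx4 -> GG).

Definition gcoef (b : idx4) (t : GG) : A :=
  tlift (fun x y => coef (rm x (coef y b.2)) b.1) t.

Fact gcoef_balanced b : balanced rm (@lsc K A Gam)
  (fun x y => coef (rm x (coef y b.2)) b.1).
Proof.
split=> [x x' y|x y y'|x a y].
- by rewrite (rmDl hGam) coD.
- by rewrite coD (rmDr hGam) coD.
by rewrite /lsc coZ (rmM hGam).
Qed.

Lemma gcoefD b : {morph gcoef b : t t' / t + t'}.
Proof. exact: tliftD (gcoef_balanced b). Qed.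

Lemma gcoef_pure b x y : gcoef b (tpure x y) = coef (rm x (coef y b.2)) b.1.
Proof. exact: tlift_pure (gcoef_balanced b). Qed.

Lemma GG_sum (t : GG) : t = \sum_b gcoef b t *: th2 b.
Proof.
move: t; apply: (@tens_ext _ _ _ _ _ GG idfun) => //.
  move=> t t'; rewrite -big_split; apply: eq_bigr => b _ /=.
  by rewrite gcoefD scalerDl.
move=> x y /=; rewrite sum_pair exchange_big /=.
rewrite [in LHS](coE hGam y) tpure_sumr; apply: eq_bigr => k _.
rewrite -[coef y k *: _]/(lsc (coef y k) (th' k)) -tpureA.
rewrite [in LHS](coE hGam (rm x (coef y k))) tpure_suml.
apply: eq_bigr => p _; rewrite gcoef_pure.
by rewrite -GT_scale_pure.
Qed.

Lemma gcoefZ b a t : gcoef b (a *: t) = a * gcoef b t.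
Proof.
move: t; apply: tens_ext => [t t'|t t'|x y].
- by rewrite scalerDr gcoefD.
- by rewrite gcoefD mulrDr.
by rewrite GT_scale_pure !gcoef_pure (rmZ hGam) coZ.
Qed.

Lemma gcoef_th2 b b' : gcoef b (th2 b') = (b' == b)%:R.
Proof.
case: b b' => [b1 b2] [b1' b2']; rewrite gcoef_pure co_th /=.
rewrite xpair_eqE; case: (b2' == b2); rewrite ?andbT ?andbF.
  by rewrite (rm1 hGam) co_th.
by rewrite !mulr0n (morphD0 (rmDr hGam _)) (morphD0 (coD hGam _)).
Qed.

Lemma gcoef_sum (c : idx4 -> A) a : gcoef a (\sum_b c b *: th2 b) = c a.
Proof.
rewrite (morphD_sum (gcoefD a)) (bigD1 a) //= gcoefZ gcoef_th2 eqxx mulr1.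
by rewrite big1 ?addr0 // => b /negPf ne; rewrite gcoefZ gcoef_th2 ne mulr0.
Qed.

Definition ra (t : GG) a : GG := tactr rm t a.

Fact ra_balanced a : balanced rm (@lsc K A Gam)
  (fun m n => tpure m (rm n a) : tens rm (@lsc K A Gam)).
Proof.
split=> [x x' y|x y y'|x b y]; rewrite ?(rmDl hGam) ?tpureDl ?tpureDr //.
by rewrite /lsc (rmZ hGam) tpureA.
Qed.

Lemma ra_pure x y a : ra (tpure x y) a = tpure x (rm y a).
Proof. exact: tlift_pure (ra_balanced a). Qed.

Lemma raDl a : {morph ra^~ a : t t' / t + t'}.
Proof. exact: tliftD (ra_balanced a). Qed.

Lemma raDr t : {morph ra t : a b / a + b}.
Proof.
move=> a b; move: t; apply: tens_ext => [t t'|t t'|x y].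
- exact: raDl.
- by rewrite !raDl addrACA.
by rewrite !ra_pure (rmDr hGam) tpureDr.
Qed.

Lemma raM t a b : ra t (a * b) = ra (ra t a) b.
Proof.
move: t; apply: tens_ext => [t t'|t t'|x y]; rewrite ?raDl //.
by rewrite !ra_pure (rmM hGam).
Qed.

Lemma raZ a t b : ra (a *: t) b = a *: ra t b.
Proof.
move: t; apply: tens_ext => [t t'|t t'|x y].
- by rewrite scalerDr raDl.
- by rewrite raDl scalerDr.
by rewrite !(ra_pure, GT_scale_pure).
Qed.

Lemma ra_scalar t (c : K) : ra t c%:A = c%:A *: t.
Proof.
move: t; apply: tens_ext => [t t'|t t'|x y].
- exact: raDl.
- exact: scalerDr.
rewrite ra_pure (rm_scalar hGam) -[_ *: y]/(lsc _ y) -tpureA (rm_scalar hGam).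
by rewrite GT_scale_pure.
Qed.

Lemma ra1 t : ra t 1 = t.
Proof. by rewrite -[1](scale1r (1 : A)) ra_scalar !scale1r. Qed.

Lemma ra_suml (J : Type) (r : seq J) (f : J -> GG) a :
  ra (\sum_(j <- r) f j) a = \sum_(j <- r) ra (f j) a.
Proof. exact: (morphD_sum (raDl a)). Qed.

Lemma ra_u b k l :
  ra (th2 b) (u k l) = \sum_b' (\sum_m ffmx s b b' m l *: u k m) *: th2 b'.
Proof.
case: b => p r; rewrite ra_pure (FE hGam r) tpure_sumr [RHS]sum_pair [RHS]exchange_big /=.
apply: eq_bigr => r' _; rewrite -[_ *: _]/(lsc _ _) -tpureA (FE hGam p) tpure_suml.
apply: eq_bigr => p' _; rewrite -GT_scale_pure /=; congr (_ *: _).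
rewrite F_u (morphD_sum (FD hGam p p')).
under [LHS]eq_bigr do rewrite FZ F_u scaler_sumr.
rewrite exchange_big; apply: eq_bigr => n _ /=.
rewrite /ffmx scaler_suml; apply: eq_bigr => m _; rewrite scalerA.
by rewrite mulrACA (nu0K hnu0) mul1r mulrC.
Qed.

(** The right action on the [th_b (x) th_b'] has the coefficients [ffmx], so a
    left linear map with constant matrix [X] is right linear as soon as [X]
    commutes with [ffmx]. *)
Lemma GG_endo_right (X : idx4 -> idx4 -> K) (f : GG -> GG) :
  (forall a b m l, \sum_b' X a b' * ffmx s b b' m l =
                   \sum_b' X b' b * ffmx s b' a m l) ->
  is_GG_endo th X f -> forall t a, f (ra t a) = ra (f t) a.
Proof.
move=> comm [fD fZ fth].
pose fZ' : forall a (t : GG), f (a *: t) = a *: (f t : GG) := fZ.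
have fsum (c : idx4 -> A) :
    f (\sum_b c b *: th2 b) = \sum_b c b *: (f (th2 b) : GG).
  by rewrite (morphD_sum fD); apply: eq_bigr => b _; rewrite fZ'.
have fth' b : f (th2 b) = \sum_a (X a b)%:A *: th2 a := fth b.
suff fra a t : f (ra t a) = ra (f t) a by [].
move: a t; apply: (OSLq2_ind hA).
  split=> [t|a b ea eb t|a b ea eb t|c a ea t].
  - by rewrite !ra1.
  - by rewrite !raDr fD ea eb.
  - by rewrite !raM eb ea.
  by rewrite -Mscalar !raM !ra_scalar fZ' ea.
move=> k l t; rewrite (GG_sum t) ra_suml.
under eq_bigr do rewrite raZ; rewrite fsum (morphD_sum fD) ra_suml.
apply: eq_bigr => b _; rewrite fZ' raZ; congr (_ *: _).
rewrite ra_u fsum fth' ra_suml.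
under eq_bigr do rewrite fth' scaler_sumr.
under [RHS]eq_bigr do rewrite raZ ra_u scaler_sumr.
rewrite exchange_big [RHS]exchange_big; apply: eq_bigr => a _ /=.
under eq_bigr do rewrite scalerA; under [RHS]eq_bigr do rewrite scalerA.
rewrite -!scaler_suml; congr (_ *: _).
have pull c (f' : I -> K) :
    (\sum_m f' m *: u k m) * c%:A = \sum_m (c * f' m) *: u k m.
  by rewrite Mscalar scaler_sumr; apply: eq_bigr => m _; rewrite scalerA.
have pull' c (f' : I -> K) :
    c%:A * (\sum_m f' m *: u k m) = \sum_m (c * f' m) *: u k m.
  by rewrite scalarM scaler_sumr; apply: eq_bigr => m _; rewrite scalerA.
under eq_bigr do rewrite pull; under [RHS]eq_bigr do rewrite pull'.
rewrite exchange_big [RHS]exchange_big; apply: eq_bigr => m _ /=.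
by rewrite -!scaler_suml comm.
Qed.

Lemma stilde_right e e' (f : GG -> GG) : is_GG_endo th (stilde_mx s e e') f ->
  forall t a, f (ra t a) = ra (f t) a.
Proof. by apply: GG_endo_right => a b m l; exact: ffmx_stilde. Qed.

(** By [ffmx_gmx], the vector of the values of [g] is invariant under [ffmx]. *)
Lemma metric_right c (g : GG -> A) : is_metric_g s th c g ->
  forall (t : GG) a, g (ra t a) = g t * a.
Proof.
move=> [gD gZ gth] t a; move: a t.
pose gZ' : forall a (t : GG), g (a *: t) = a * g t := gZ.
have gth2 b : g (th2 b) = (gmx s c b)%:A := gth _ _ _ _.
apply: (OSLq2_ind hA).
  split=> [t|a b ea eb t|a b ea eb t|k a ea t].
  - by rewrite ra1 mulr1.
  - by rewrite raDr gD ea eb mulrDr.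
  - by rewrite raM eb ea mulrA.
  by rewrite -Mscalar raM ra_scalar gZ' ea scalarM Mscalar scalerAr.
move=> k l t; rewrite (GG_sum t) ra_suml !(morphD_sum gD) mulr_suml.
apply: eq_bigr => b _; rewrite raZ !gZ' -mulrA; congr (_ * _).
rewrite ra_u (morphD_sum gD) gth2 scalarM.
under eq_bigr do rewrite gZ' gth2 Mscalar scaler_sumr.
rewrite exchange_big /=.
under eq_bigr do under eq_bigr do rewrite scalerA.
under eq_bigr do rewrite -scaler_suml ffmx_gmx //.
rewrite (bigD1 l) //= eqxx mulr1 big1 ?addr0 // => m /negPf ->.
by rewrite mulr0 scale0r.
Qed.

End Bimodule.

(** * The differentials span *)

Section Differential.
Variables (K : fieldType) (q s : K).
Hypotheses (s0 : s != 0) (s2 : s ^+ 2 = q).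
Hypothesis q_nroot : forall n : nat, (0 < n)%N -> q ^+ n != 1.
Variables (A : algType K) (u : I -> I -> A).
Hypothesis hA : is_OSLq2 q s u.
Variables (nu0 : K).
Hypothesis hnu0 : nu0 = 1 \/ nu0 = -1.
Variables (Gam : lmodType A) (th : I -> I -> Gam) (rm : Gam -> A -> Gam).
Hypothesis hGam : is_4Dcalc s u th rm nu0.

Notation pr := (I * I)%type.
Notation th' := (thp th).
Notation coef := (coef hGam).
Notation theta := (theta q s th).
Notation dA := (dA q s th rm).

Lemma q_neq0 : q != 0. Proof. by rewrite -s2 expf_neq0. Qed.

Lemma qhat_neq0 : q - q^-1 != 0.
Proof.
have := q_nroot (isT : (0 < 2)%N); apply: contra_neq => /(congr1 ( *%R q)).
by rewrite mulr0 mulrBr mulfV ?q_neq0 // => /eqP; rewrite subr_eq0 => /eqP.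
Qed.

(** The coefficients of [theta]. *)
Definition tc (p : pr) : K := s / (q - q^-1) * Cc s p.1 p.2.

Lemma tcE : (tc (i1, i1) = 0) * (tc (i1, i2) = (q - q^-1)^-1)
  * (tc (i2, i1) = - (q / (q - q^-1))) * (tc (i2, i2) = 0).
Proof.
rewrite /tc /= !CcE !mulr0 mulrAC mulfV // mul1r; do !split=> //.
by rewrite mulrN mulrAC -expr2 s2.
Qed.

Lemma thetaE : theta = \sum_p (tc p)%:A *: th' p.
Proof. by rewrite sum_pair. Qed.

Lemma coef_theta r : coef theta r = (tc r)%:A.
Proof. by rewrite thetaE (co_sum hGam (fun p => (tc p)%:A)). Qed.

Definition dspan (x : Gam) : Prop :=
  exists n (a b : 'I_n -> A), x = \sum_k a k *: dA (b k).

Lemma dspan_dA a b : dspan (a *: dA b).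
Proof. by exists 1, (fun=> a), (fun=> b); rewrite big_ord1. Qed.

Lemma dspan0 : dspan 0.
Proof. by exists 0, (fun=> 0), (fun=> 0); rewrite big_ord0. Qed.

Lemma dspanD x y : dspan x -> dspan y -> dspan (x + y).
Proof.
move=> [n [a [b ->]]] [m [c [d ->]]].
exists (n + m)%N, (fun k => match split k with inl i => a i | inr j => c j end),
  (fun k => match split k with inl i => b i | inr j => d j end).
rewrite big_split_ord; congr (_ + _); apply: eq_bigr => k _.
  by rewrite (unsplitK (inl k)).
by rewrite (unsplitK (inr k)).
Qed.

Lemma dspanZ c x : dspan x -> dspan (c *: x).
Proof.
move=> [n [a [b ->]]]; exists n, (fun k => c * a k), b.
by rewrite scaler_sumr; apply: eq_bigr => k _; rewrite scalerA.
Qed.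

Lemma dspan_sum (J : finType) (f : J -> Gam) :
  (forall j, dspan (f j)) -> dspan (\sum_j f j).
Proof. by move=> df; elim/big_ind: _ => //; [exact: dspan0|exact: dspanD]. Qed.

(** The coefficients of the left-invariant form [sum_k S(u^m_k) d u^k_l],
    see [MC_form]. *)
Definition chi (m l : I) (r : pr) : K :=
  nu0 * (\sum_p tc p * fmx s p r m l) - tc r *+ (m == l).

Lemma MC_form m l :
  \sum_k Su q u m k *: dA (u k l) = \sum_r (chi m l r)%:A *: th' r.
Proof.
have dE k : dA (u k l) = \sum_r (\sum_n chi n l r *: u k n) *: th' r.
  rewrite /dA (coE hGam (rm theta _ - _)); apply: eq_bigr => r _; congr (_ *: _).
  rewrite coD -scaleNr coZ coef_theta (co_rm hGam).
  under eq_bigr do rewrite coef_theta scalarM F_u scaler_sumr.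
  rewrite exchange_big Mscalar /= /chi.
  under [RHS]eq_bigr do rewrite scalerBl.
  rewrite sumrB; congr (_ + _).
    apply: eq_bigr => n _; rewrite mulr_sumr scaler_suml.
    by apply: eq_bigr => p _; rewrite scalerA mulrCA.
  rewrite (bigD1 l) //= eqxx mulr1n big1 ?addr0 ?scalerN // => n /negPf ->.
  by rewrite mulr0n scale0r.
under eq_bigr do rewrite dE scaler_sumr.
rewrite exchange_big; apply: eq_bigr => r _ /=.
under eq_bigr do rewrite scalerA mulr_sumr.
rewrite -scaler_suml exchange_big /=; congr (_ *: _).
under eq_bigr => n _ do (under eq_bigr do rewrite -scalerAr);
  under eq_bigr => n _ do rewrite -scaler_sumr (Su_u s0 s2 hA).
rewrite (bigD1 m) //= eqxx big1 ?addr0 // => n; rewrite eq_sym => /negPf ->.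
by rewrite scaler0.
Qed.

Lemma dspan_MC m l : dspan (\sum_r (chi m l r)%:A *: th' r).
Proof. by rewrite -MC_form; apply: dspan_sum => k; exact: dspan_dA. Qed.

Lemma dspan_div (c : K) x : c != 0 -> dspan (c%:A *: x) -> dspan x.
Proof.
move=> c0 /(dspanZ c^-1%:A); rewrite scalerA scalarM scalerA mulVf //.
by rewrite !scale1r.
Qed.

Let al := (nu0 * q - 1) / (q - q^-1).
Let be := (nu0 * ((1 - q ^+ 2) * (1 - q^-1 ^+ 2) - 1) + q) / (q - q^-1).
Let ga := (nu0 * q^-1 - 1) / (q - q^-1).
Let de := q * (1 - nu0 * q) / (q - q^-1).

Lemma chiE :
  ((chi i1 i1 (i1, i1) = 0) * (chi i1 i1 (i1, i2) = al) *
   (chi i1 i1 (i2, i1) = be) * (chi i1 i1 (i2, i2) = 0)) *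
  ((chi i1 i2 (i1, i1) = 0) * (chi i1 i2 (i1, i2) = 0) *
   (chi i1 i2 (i2, i1) = 0) * (chi i1 i2 (i2, i2) = nu0 / q)) *
  ((chi i2 i1 (i1, i1) = - nu0) * (chi i2 i1 (i1, i2) = 0) *
   (chi i2 i1 (i2, i1) = 0) * (chi i2 i1 (i2, i2) = 0)) *
  ((chi i2 i2 (i1, i1) = 0) * (chi i2 i2 (i1, i2) = ga) *
   (chi i2 i2 (i2, i1) = de) * (chi i2 i2 (i2, i2) = 0)).
Proof.
have q0 := q_neq0; have q2 : q ^+ 2 - 1 != 0 by rewrite subr_eq0 q_nroot.
have h0 : q * q - 1 != 0 by [].
do !split; rewrite /chi sum_pair !sum2 !tcE !(fmxE s0 s2) /= ?mulr0n ?mulr1n /al /be /ga /de;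
  field; rewrite ?q0 ?h0 //.
Qed.

(** This determinant is where the calculus could degenerate: it vanishes only if
    [q ^ 2] or [q ^ 6] is 1. *)
Lemma chi_det : al * de - be * ga != 0.
Proof.
have q0 := q_neq0; have h0 := qhat_neq0.
have qnu : q - nu0 != 0.
  have := q_nroot (isT : (0 < 2)%N); apply: contra_neq => /eqP.
  by rewrite subr_eq0 => /eqP ->; rewrite expr2 (nu0K hnu0).
have q3 : q ^+ 3 - nu0 != 0.
  have := q_nroot (isT : (0 < 6)%N); apply: contra_neq => /eqP.
  rewrite subr_eq0 => /eqP e.
  by rewrite (exprM q 3 2) e expr2 (nu0K hnu0).
have q2 : 1 - q ^+ 2 != 0 by rewrite subr_eq0 eq_sym q_nroot.
suff -> : al * de - be * ga =
  (1 - q ^+ 2) * (q - nu0) * (q ^+ 3 - nu0) / (q ^+ 3 * (q - q^-1) ^+ 2).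
  by rewrite !mulf_neq0 // invr_eq0 mulf_neq0 // expf_neq0.
rewrite /al /be /ga /de; have h1 : q * q - 1 != 0.
  by rewrite -oppr_eq0 opprB.
by case: hnu0 => ->; field; rewrite q0 h1.
Qed.

(** [th_11] and [th_22] are multiples of invariant forms; [th_12] and [th_21]
    are recovered from the two diagonal ones, with determinant [chi_det]. *)
Lemma dspan_th p : dspan (th' p).
Proof.
have sumE m l : \sum_r (chi m l r)%:A *: th' r =
   (chi m l (i1, i1))%:A *: th i1 i1 + (chi m l (i1, i2))%:A *: th i1 i2 +
   ((chi m l (i2, i1))%:A *: th i2 i1 + (chi m l (i2, i2))%:A *: th i2 i2).
  by rewrite sum_pair !sum2.
have d1 := dspan_MC i1 i1; have d2 := dspan_MC i2 i2.
have h12 := dspan_MC i1 i2; have h21 := dspan_MC i2 i1.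
rewrite !sumE !chiE !scale0r ?add0r ?addr0 in d1 d2 h12 h21.
case: p => i j; move: i j; do 2!apply: ord2P.
- by apply: dspan_div h21; rewrite oppr_eq0 (nu0_neq0 hnu0).
- apply: dspan_div chi_det _.
  have -> : (al * de - be * ga)%:A *: th i1 i2 =
      de%:A *: (al%:A *: th i1 i2 + be%:A *: th i2 i1) +
      (- be)%:A *: (ga%:A *: th i1 i2 + de%:A *: th i2 i1).
    rewrite !scalerDr !scalerA !scalarM !scalerA addrACA -!scalerDl.
    rewrite [X in _ + X%:A *: _](_ : _ = 0); last by ring.
    by rewrite !scale0r addr0; congr (_%:A *: _); ring.
  by apply: dspanD; apply: dspanZ.
- apply: dspan_div chi_det _.
  have -> : (al * de - be * ga)%:A *: th i2 i1 =
      (- ga)%:A *: (al%:A *: th i1 i2 + be%:A *: th i2 i1) +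
      al%:A *: (ga%:A *: th i1 i2 + de%:A *: th i2 i1).
    rewrite !scalerDr !scalerA !scalarM !scalerA addrACA -!scalerDl.
    rewrite [X in X%:A *: _ + _](_ : _ = 0); last by ring.
    by rewrite !scale0r add0r; congr (_%:A *: _); ring.
  by apply: dspanD; apply: dspanZ.
by apply: dspan_div h12; rewrite mulf_neq0 ?invr_eq0 ?q_neq0 // (nu0_neq0 hnu0).
Qed.

Lemma dspan_all x : dspan x.
Proof. by rewrite (coE hGam x); apply: dspan_sum => p; exact/dspanZ/dspan_th. Qed.

Lemma dA_ext (Z : zmodType) (f g : Gam -> Z) :
  {morph f : x y / x + y} -> {morph g : x y / x + y} ->
  (forall a b, f (a *: dA b) = g (a *: dA b)) -> f =1 g.
Proof.
move=> fD gD fg x; have [n [a [b ->]]] := dspan_all x.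
by rewrite !morphD_sum //; apply: eq_bigr => k _.
Qed.

End Differential.

(** * Quadratic relations in the Clifford algebra *)

Section FixedTables.
Variables (K : fieldType) (s : K).
Hypothesis s0 : s != 0.
Notation V5 := (I -> I -> I -> I -> I -> K).

(** The [2 x 2] table with rows [a b] and [c d]; nested, it displays a family
    indexed by four letters as a [4 x 4] matrix. *)
Definition vec (X : Type) (a b c d : X) (i j : I) : X :=
  if i == i1 then if j == i1 then a else b else if j == i1 then c else d.

Lemma b12E :
  ((forall v z t w, b12 (Rh s) v i1 i1 z t w = s * v i1 i1 z t w) *
  (forall v z t w, b12 (Rh s) v i1 i2 z t w =
     (s - s^-1 ^+ 3) * v i1 i2 z t w + s^-1 * v i2 i1 z t w) *
  (forall v z t w, b12 (Rh s) v i2 i1 z t w = s^-1 * v i1 i2 z t w) *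
  (forall v z t w, b12 (Rh s) v i2 i2 z t w = s * v i2 i2 z t w)).
Proof. by do !split; move=> *; rewrite /b12 !sum2 !(RE s0) ?zeroE. Qed.

Lemma b34E :
  ((forall v x y w, b34 (Rh s) v x y i1 i1 w = s * v x y i1 i1 w) *
  (forall v x y w, b34 (Rh s) v x y i1 i2 w =
     (s - s^-1 ^+ 3) * v x y i1 i2 w + s^-1 * v x y i2 i1 w) *
  (forall v x y w, b34 (Rh s) v x y i2 i1 w = s^-1 * v x y i1 i2 w) *
  (forall v x y w, b34 (Rh s) v x y i2 i2 w = s * v x y i2 i2 w)).
Proof. by do !split; move=> *; rewrite /b34 !sum2 !(RE s0) ?zeroE. Qed.

Lemma b23E :
  ((forall v x t w, b23 (Rinv s) v x i1 i1 t w = s^-1 * v x i1 i1 t w) *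
  (forall v x t w, b23 (Rinv s) v x i1 i2 t w = s * v x i2 i1 t w) *
  (forall v x t w, b23 (Rinv s) v x i2 i1 t w =
     s * v x i1 i2 t w + (s^-1 - s ^+ 3) * v x i2 i1 t w) *
  (forall v x t w, b23 (Rinv s) v x i2 i2 t w = s^-1 * v x i2 i2 t w)).
Proof. by do !split; move=> *; rewrite /b23 !sum2 !(RE s0) ?zeroE. Qed.

Lemma b23RK v : b23 (Rh s) (b23 (Rinv s) v) = v.
Proof.
apply: funext => x; apply: funext => y; apply: funext => z; apply: funext => t;
apply: funext => w; move: y z; do 2!apply: ord2P;
  by rewrite [LHS]/b23 !sum2 !(RE s0) !b23E; field; rewrite ?s0.
Qed.

Lemma b34RK v : b34 (Rinv s) (b34 (Rh s) v) = v.
Proof.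
apply: funext => x; apply: funext => y; apply: funext => z; apply: funext => t;
apply: funext => w; move: z t; do 2!apply: ord2P;
  by rewrite [LHS]/b34 !sum2 !(RE s0) !b34E; field; rewrite ?s0.
Qed.

(** This is [sigma c = c]: the four factors of [sigma] are a conjugation by the
    crossing of the middle strands of two crossings that commute. *)
Definition sigma_fixed (c : I -> I -> I -> I -> K) :=
  let w := b23 (Rinv s) (fun x y z t _ => c x y z t) in
  forall x y z t, b12 (Rh s) w x y z t i1 = b34 (Rh s) w x y z t i1.

Lemma sigma_fixedP c a : sigma_fixed c ->
  \sum_b sigma_mx s a b * c b.1.1 b.1.2 b.2.1 b.2.2 =
  c a.1.1 a.1.2 a.2.1 a.2.2.
Proof.
case: a => -[x y] [z t] /= fix_c.
pose v : V5 := fun x y z t _ => c x y z t.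
rewrite -[LHS]/(mxact (stilde_mx s true false) v x y z t i1).
rewrite mxact_stilde /st1234 /= far1234.
have -> : b12 (Rh s) (b23 (Rinv s) v) = b34 (Rh s) (b23 (Rinv s) v).
  apply: funext => x'; apply: funext => y'; apply: funext => z';
  apply: funext => t'; apply: funext => w; exact: fix_c.
by rewrite b34RK b23RK.
Qed.

Ltac fixed := rewrite /sigma_fixed /=; do 4!apply: ord2P;
  rewrite !(b12E, b34E) !b23E /vec /= ?zeroE //; field; rewrite ?s0 //.

Notation O := (vec 0 0 0 0).
Notation q := (s ^+ 2).

(** Ten independent vectors fixed by [sigma], each named after the product of
    two [th_p] that it expresses through the others. *)
Lemma fixed_th11_th11 : sigma_fixed (vec (vec 1 0 0 0) O O O).
Proof. by fixed. Qed.
Lemma fixed_th21_th21 : sigma_fixed (vec O O (vec 0 0 1 0) O).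
Proof. by fixed. Qed.
Lemma fixed_th22_th22 : sigma_fixed (vec O O O (vec 0 0 0 1)).
Proof. by fixed. Qed.
Lemma fixed_th12_th12 :
  sigma_fixed (vec (vec 0 0 0 (q - q^-1)) (vec 0 1 0 0) O O).
Proof. by fixed. Qed.
Lemma fixed_th12_th11 :
  sigma_fixed (vec (vec 0 (q ^+ 2) (q - q^-1) 0) (vec 1 0 0 0) O O).
Proof. by fixed. Qed.
Lemma fixed_th21_th11 :
  sigma_fixed (vec (vec 0 0 1 0) O (vec 1 0 0 0) O).
Proof. by fixed. Qed.
Lemma fixed_th22_th21 :
  sigma_fixed (vec O O (vec 0 0 0 1) (vec 0 0 1 0)).
Proof. by fixed. Qed.
Lemma fixed_th22_th12 :
  sigma_fixed (vec O (vec 0 0 0 (q ^+ 2)) (vec 0 0 0 (q - q^-1)) (vec 0 1 0 0)).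
Proof. by fixed. Qed.
Lemma fixed_th21_th12 :
  sigma_fixed (vec (vec 0 0 0 (1 - q^-1 ^+ 2)) (vec 0 0 1 0) (vec 0 1 0 0) O).
Proof. by fixed. Qed.
Lemma fixed_th22_th11 :
  sigma_fixed (vec (vec 0 0 0 1) O O (vec 1 0 0 0)).
Proof. by fixed. Qed.

End FixedTables.

(** * Induction in the tensor algebra and the target of the representation *)

Section Endomorphisms.
Variables (K : fieldType) (A : algType K) (J : finType) (j0 : J).

Notation V := {ffun J -> A}.

(** The index [j0] records that [A^J] is not zero, which makes the endomorphisms
    a ring with [1 != 0]. *)
Record endo (j : J) := Endo { efun :> V -> V; _ : linear efun }.

Notation E := (endo j0).

HB.instance Definition _ := gen_eqMixin E.
HB.instance Definition _ := gen_choiceMixin E.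

Lemma endoP (f g : E) : f =1 g -> f = g.
Proof.
case: f g => [f lf] [g lg] /= /funext fg; move: lf lg; rewrite fg => lf lg.
by rewrite (Prop_irrelevance lf lg).
Qed.

Lemma endo_linear (f : E) : linear f. Proof. by case: f. Qed.

Lemma endoD (f : E) : {morph f : v w / v + w}.
Proof. by move=> v w; have := endo_linear f 1 v w; rewrite !scale1r. Qed.

Lemma endoZ (f : E) c v : f (c *: v) = c *: f v.
Proof.
have f0 : f 0 = 0 by apply: (addrI (f 0)); rewrite -endoD !addr0.
by have := endo_linear f c v 0; rewrite f0 !addr0.
Qed.

Fact endo_add_subproof (f g : E) : linear (fun v => f v + g v).
Proof. by move=> c v w; rewrite !endo_linear scalerDr addrACA. Qed.
Fact endo_opp_subproof (f : E) : linear (fun v => - f v).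
Proof. by move=> c v w; rewrite endo_linear opprD scalerN. Qed.
Fact endo_zero_subproof : linear (fun _ : V => 0 : V).
Proof. by move=> c v w; rewrite scaler0 addr0. Qed.
Fact endo_one_subproof : linear (fun v : V => v).
Proof. by []. Qed.
Fact endo_mul_subproof (f g : E) : linear (fun v => f (g v)).
Proof. by move=> c v w; rewrite !endo_linear. Qed.
Fact endo_scale_subproof (a : K) (f : E) : linear (fun v => a *: f v).
Proof. by move=> c v w; rewrite endo_linear scalerDr !scalerA mulrC. Qed.

Definition endo_add f g : E := Endo j0 (endo_add_subproof f g).
Definition endo_opp f : E := Endo j0 (endo_opp_subproof f).
Definition endo_zero : E := Endo j0 endo_zero_subproof.
Definition endo_one : E := Endo j0 endo_one_subproof.
Definition endo_mul f g : E := Endo j0 (endo_mul_subproof f g).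
Definition endo_scale a f : E := Endo j0 (endo_scale_subproof a f).

Fact endo_addA : associative endo_add.
Proof. by move=> f g h; apply: endoP => v; exact: addrA. Qed.
Fact endo_addC : commutative endo_add.
Proof. by move=> f g; apply: endoP => v; exact: addrC. Qed.
Fact endo_add0 : left_id endo_zero endo_add.
Proof. by move=> f; apply: endoP => v; exact: add0r. Qed.
Fact endo_addN : left_inverse endo_zero endo_opp endo_add.
Proof. by move=> f; apply: endoP => v; exact: addNr. Qed.

HB.instance Definition _ :=
  GRing.isZmodule.Build E endo_addA endo_addC endo_add0 endo_addN.

Fact endo_mulA : associative endo_mul.
Proof. by move=> f g h; apply: endoP. Qed.
Fact endo_mul1 : left_id endo_one endo_mul.
Proof. by move=> f; apply: endoP. Qed.
Fact endo_1mul : right_id endo_one endo_mul.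
Proof. by move=> f; apply: endoP. Qed.
Fact endo_mulDl : left_distributive endo_mul +%R.
Proof. by move=> f g h; apply: endoP. Qed.
Fact endo_mulDr : right_distributive endo_mul +%R.
Proof. by move=> f g h; apply: endoP => v; exact: endoD. Qed.
Fact endo_one_neq0 : endo_one != 0.
Proof.
apply/eqP => /(congr1 (fun f : E => f [ffun=> 1] j0)) /=.
by rewrite !ffunE => /eqP; rewrite oner_eq0.
Qed.

HB.instance Definition _ := GRing.Zmodule_isNzRing.Build E
  endo_mulA endo_mul1 endo_1mul endo_mulDl endo_mulDr endo_one_neq0.

Fact endo_scaleA a b f : endo_scale a (endo_scale b f) = endo_scale (a * b) f.
Proof. by apply: endoP => v; exact: scalerA. Qed.
Fact endo_scale1 : left_id 1 endo_scale.
Proof. by move=> f; apply: endoP => v; exact: scale1r. Qed.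
Fact endo_scaleDr : right_distributive endo_scale +%R.
Proof. by move=> a f g; apply: endoP => v; exact: scalerDr. Qed.
Fact endo_scaleDl f : {morph endo_scale^~ f : a b / a + b}.
Proof. by move=> a b; apply: endoP => v; exact: scalerDl. Qed.

HB.instance Definition _ := GRing.Zmodule_isLmodule.Build K E
  endo_scaleA endo_scale1 endo_scaleDr endo_scaleDl.

Fact endo_scaleAl (a : K) (f g : E) : a *: (f * g) = (a *: f) * g.
Proof. by apply: endoP. Qed.
HB.instance Definition _ := GRing.Lmodule_isLalgebra.Build K E endo_scaleAl.

Fact endo_scaleAr (a : K) (f g : E) : a *: (f * g) = f * (a *: g).
Proof. by apply: endoP => v; rewrite [RHS]/= endoZ. Qed.
HB.instance Definition _ := GRing.Lalgebra_isAlgebra.Build K E endo_scaleAr.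

Lemma endo_addE (f g : E) v : (f + g) v = f v + g v. Proof. by []. Qed.
Lemma endo_mulE (f g : E) v : (f * g) v = f (g v). Proof. by []. Qed.
Lemma endo_scaleE c (f : E) v : (c *: f) v = c *: f v. Proof. by []. Qed.
Lemma endo_sumE (X : Type) (r : seq X) (f : X -> E) v :
  (\sum_(x <- r) f x) v = \sum_(x <- r) f x v.
Proof.
by elim: r => [|x r ih]; rewrite ?big_nil // !big_cons endo_addE ih.
Qed.

Fact lmult_subproof (a : A) : linear (fun v : V => [ffun j => a * v j]).
Proof.
move=> c v w; apply/ffunP => j.
by rewrite !ffunE mulrDr scalerAr.
Qed.
Definition lmult (a : A) : E := Endo j0 (lmult_subproof a).

Fact lmult_linear : linear lmult.
Proof.
move=> c a b; apply: endoP => v; apply/ffunP => j.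
by rewrite !ffunE mulrDl scalerAl.
Qed.
Fact lmult_monoid : monoid_morphism lmult.
Proof.
split; first by apply: endoP => v; apply/ffunP => j; rewrite !ffunE mul1r.
by move=> a b; apply: endoP => v; apply/ffunP => j; rewrite !ffunE mulrA.
Qed.
HB.instance Definition _ := GRing.isLinear.Build K A E _ lmult lmult_linear.
HB.instance Definition _ := GRing.isMonoidMorphism.Build A E lmult lmult_monoid.

End Endomorphisms.

Section TensorAlgebra.
Variables (K : fieldType) (A : algType K) (Gam : lmodType A).
Variables (rm : Gam -> A -> Gam).
Variables (T : algType K) (iT : {lrmorphism A -> T}) (jT : Gam -> T).
Hypothesis hT : is_tensor_algebra rm iT jT.

(** Same argument as [OSLq2_ind]. *)
Lemma tensor_algebra_ind (P : T -> Prop) : subalgebra P ->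
  (forall a, P (iT a)) -> (forall x, P (jT x)) -> forall t, P t.
Proof.
move=> subP Pi Pj; have [S [v [v_inj Pv vP]]] := subalgebra_lift subP.
have [f0 f0E] := boolp.choice (fun a => vP _ (Pi a)).
have [j jE] := boolp.choice (fun x => vP _ (Pj x)).
have f0_lin : linear f0.
  by move=> c a b; apply: v_inj; rewrite f0E !linearP /= !f0E.
have f0_mon : monoid_morphism f0.
  split=> [|a b]; apply: v_inj; first by rewrite f0E !rmorph1.
  by rewrite !rmorphM /= !f0E rmorphM.
pose mL := GRing.isLinear.Build K A S _ f0 f0_lin.
pose mM := GRing.isMonoidMorphism.Build A S f0 f0_mon.
pose f : {lrmorphism A -> S} := HB.pack f0 mL mM.
have [[jD jl jr] univ] := hT.
have hj : is_bimod_map rm f j.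
  split=> [x y|a x|x a]; apply: v_inj.
  - by rewrite linearD /= !jE jD.
  - by rewrite rmorphM /= !jE jl -f0E.
  - by rewrite rmorphM /= !jE jr -f0E.
have [G [Gi Gj _]] := univ S f j hj.
have [G' [_ _ uniq]] := univ T iT jT hT.1.
move=> t; suff <- : v (G t) = t by exact: Pv.
have -> : v (G t) = (v \o G) t by [].
rewrite (uniq (v \o G)) => [|a|x]; first by rewrite -(uniq idfun).
  by rewrite /= Gi; exact: f0E.
by rewrite /= Gj; exact: jE.
Qed.

End TensorAlgebra.

(** * Clifford multiplication on the spinors *)

Section SpinTable.
Variables (K : fieldType) (q s c1 : K).
Hypotheses (s0 : s != 0) (s2 : s ^+ 2 = q).

Definition kap : K := two_q q * c1.

(** Clifford multiplication by [th_p] sends [psi (e, m)] to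
    [sum_n spin e p m n psi (~~ e, n)]. *)
Definition spin (e : bool) (p : I * I) (m n : I) : K :=
  if e then - \sum_t Ch s p.1 t * Rinv s t n p.2 m
  else - (kap * s) * (p.1 == n)%:R * Ch s p.2 m.

Lemma spinE :
  ((spin true (i1, i1) i1 i1 = 0)
   * (spin true (i1, i1) i1 i2 = 0)
   * (spin true (i1, i1) i2 i1 = 1)
   * (spin true (i1, i1) i2 i2 = 0)
   * (spin true (i1, i2) i1 i1 = - (q - q^-1))
   * (spin true (i1, i2) i1 i2 = 0)
   * (spin true (i1, i2) i2 i1 = 0)
   * (spin true (i1, i2) i2 i2 = q^-1)
   * (spin true (i2, i1) i1 i1 = - 1)
   * (spin true (i2, i1) i1 i2 = 0)
   * (spin true (i2, i1) i2 i1 = 0)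
   * (spin true (i2, i1) i2 i2 = 0)
   * (spin true (i2, i2) i1 i1 = 0)
   * (spin true (i2, i2) i1 i2 = - q)
   * (spin true (i2, i2) i2 i1 = 0)
   * (spin true (i2, i2) i2 i2 = 0))
  * ((spin false (i1, i1) i1 i1 = 0)
   * (spin false (i1, i1) i1 i2 = 0)
   * (spin false (i1, i1) i2 i1 = kap)
   * (spin false (i1, i1) i2 i2 = 0)
   * (spin false (i1, i2) i1 i1 = - (q * kap))
   * (spin false (i1, i2) i1 i2 = 0)
   * (spin false (i1, i2) i2 i1 = 0)
   * (spin false (i1, i2) i2 i2 = 0)
   * (spin false (i2, i1) i1 i1 = 0)
   * (spin false (i2, i1) i1 i2 = 0)
   * (spin false (i2, i1) i2 i1 = 0)
   * (spin false (i2, i1) i2 i2 = kap)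
   * (spin false (i2, i2) i1 i1 = 0)
   * (spin false (i2, i2) i1 i2 = - (q * kap))
   * (spin false (i2, i2) i2 i1 = 0)
   * (spin false (i2, i2) i2 i2 = 0)).
Proof.
by do !split; rewrite /spin ?sum2 /= !(RE s0) ?zeroE // -?s2; field; rewrite ?s0.
Qed.

End SpinTable.

Section MetricTable.
Variables (K : fieldType) (q s c1 : K).
Hypotheses (s0 : s != 0) (s2 : s ^+ 2 = q).

Lemma gmxE :
  ((gmx s c1 ((i1, i1), (i1, i1)) = 0)
   * (gmx s c1 ((i1, i1), (i1, i2)) = 0)
   * (gmx s c1 ((i1, i1), (i2, i1)) = 0)
   * (gmx s c1 ((i1, i1), (i2, i2)) = - c1))
  * ((gmx s c1 ((i1, i2), (i1, i1)) = 0)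
   * (gmx s c1 ((i1, i2), (i1, i2)) = - c1 * (q^-1 - q))
   * (gmx s c1 ((i1, i2), (i2, i1)) = c1)
   * (gmx s c1 ((i1, i2), (i2, i2)) = 0))
  * ((gmx s c1 ((i2, i1), (i1, i1)) = 0)
   * (gmx s c1 ((i2, i1), (i1, i2)) = c1)
   * (gmx s c1 ((i2, i1), (i2, i1)) = 0)
   * (gmx s c1 ((i2, i1), (i2, i2)) = 0))
  * ((gmx s c1 ((i2, i2), (i1, i1)) = - c1 * q ^+ 2)
   * (gmx s c1 ((i2, i2), (i1, i2)) = 0)
   * (gmx s c1 ((i2, i2), (i2, i1)) = 0)
   * (gmx s c1 ((i2, i2), (i2, i2)) = 0)).
Proof.
by do !split; rewrite /gmx /g_mx !sum2 /= !(RE s0) ?zeroE // -?s2; field;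
  rewrite ?s0.
Qed.

End MetricTable.

Section Clifford.
Variables (K : fieldType) (q s c1 : K).
Hypotheses (s0 : s != 0) (s2 : s ^+ 2 = q).
Hypothesis q_nroot : forall n : nat, (0 < n)%N -> q ^+ n != 1.
Hypothesis c1_neq0 : c1 != 0.
Variables (A : algType K) (u : I -> I -> A).
Hypothesis hA : is_OSLq2 q s u.
Variables (nu0 : K).
Hypothesis hnu0 : nu0 = 1 \/ nu0 = -1.
Variables (Gam : lmodType A) (th : I -> I -> Gam) (rm : Gam -> A -> Gam).
Hypothesis hGam : is_4Dcalc s u th rm nu0.
Notation th' := (thp th).
Notation coef := (coef hGam).
Notation Fm := (Fm hGam).
Notation GG := (GT (@lsc K A Gam) hGam).
Notation th2 := (th2 th rm : idx4 -> GG).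
Variables (sigma : GG -> GG) (g : GG -> A).
Hypothesis hsigma : is_sigma s th sigma.
Hypothesis hg : is_metric_g s th c1 g.
Variables (T : algType K) (iT : {lrmorphism A -> T}) (jT : Gam -> T).
Hypothesis hT : is_tensor_algebra rm iT jT.
Variables (Cl : algType K) (pi : {lrmorphism T -> Cl}).
Hypothesis hCl : is_clifford iT jT sigma g pi.

Notation iC := (iC iT pi).
Notation jC := (jC jT pi).
Notation psi := (psi q th jT pi c1).
Notation spin := (spin q s c1).
Notation kap := (kap q c1).

Lemma iCD : {morph iC : a b / a + b}.
Proof. by move=> a b; rewrite /iC !linearD. Qed.
Lemma iCM : {morph iC : a b / a * b}.
Proof. by move=> a b; rewrite /iC rmorphM /= rmorphM. Qed.
Lemma iC1 : iC 1 = 1. Proof. by rewrite /iC rmorph1 /= rmorph1. Qed.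
Lemma iCZ c a : iC (c *: a) = c *: iC a.
Proof. by rewrite /iC linearZZ /= linearZZ. Qed.
Lemma iC_scalar c : iC c%:A = c%:A. Proof. by rewrite iCZ iC1. Qed.

Lemma jTD : {morph jT : x y / x + y}. Proof. by case: hT => -[]. Qed.
Lemma jTl a x : jT (a *: x) = iT a * jT x. Proof. by case: hT => -[]. Qed.
Lemma jTr x a : jT (rm x a) = jT x * iT a. Proof. by case: hT => -[]. Qed.

Lemma jCD : {morph jC : x y / x + y}.
Proof. by move=> x y; rewrite /jC jTD linearD. Qed.
Lemma jCl a x : jC (a *: x) = iC a * jC x.
Proof. by rewrite /jC jTl rmorphM. Qed.
Lemma jCr x a : jC (rm x a) = jC x * iC a.
Proof. by rewrite /jC jTr rmorphM. Qed.

Notation tht p := (jC (th' p)).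

Lemma jC_sum x : jC x = \sum_p iC (coef x p) * tht p.
Proof.
rewrite [in LHS](coE hGam x) (morphD_sum jCD).
by apply: eq_bigr => p _; rewrite jCl.
Qed.

Lemma tht_iC p a : tht p * iC a = \sum_r iC (Fm p r a) * tht r.
Proof. by rewrite -jCr jC_sum. Qed.

Fact GG_in_T_balanced : balanced rm (@lsc K A Gam) (fun x y => jT x * jT y).
Proof.
split=> [x x' y|x y y'|x a y]; rewrite ?jTD ?mulrDl ?mulrDr //.
by rewrite /lsc jTl jTr mulrA.
Qed.

Definition inT (t : GG) : T := @GG_in_T K A Gam rm T jT t.

Lemma inT_pure x y : inT (tpure x y) = jT x * jT y.
Proof. exact: tlift_pure GG_in_T_balanced. Qed.
Lemma inTD : {morph inT : t t' / t + t'}.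
Proof. exact: tliftD GG_in_T_balanced. Qed.
Lemma inTZ a t : inT (a *: t) = iT a * inT t.
Proof.
move: t; apply: tens_ext => [t t'|t t'|x y].
- by rewrite scalerDr inTD.
- by rewrite inTD mulrDr.
by rewrite GT_scale_pure !inT_pure jTl mulrA.
Qed.

Lemma clifford_rel (t : GG) : sigma t = t -> pi (inT t) = iC (g t).
Proof.
move=> st; apply/eqP; rewrite -subr_eq0 /iC -linearB; apply/eqP/(hCl.2 _).
exists 1, (fun=> 1), (fun=> inT t - iT (g t)), (fun=> 1).
by split=> [_|]; [exists t|rewrite big_ord1 mul1r mulr1].
Qed.

Lemma sigma_sum (c : idx4 -> A) :
  sigma (\sum_b c b *: th2 b) =
  \sum_a (\sum_b sigma_mx s a b *: c b) *: th2 a.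
Proof.
case: hsigma => sD sZ sth; rewrite (morphD_sum sD).
have sZ' a (t : GG) : sigma (a *: t) = a *: sigma t := sZ a t.
have sth' b : sigma (th2 b) = \sum_a (sigma_mx s a b)%:A *: th2 a := sth b.
under eq_bigr do rewrite sZ' sth' scaler_sumr.
rewrite exchange_big; apply: eq_bigr => a _ /=.
by rewrite scaler_suml; apply: eq_bigr => b _; rewrite scalerA Mscalar.
Qed.

Lemma g_sum (c : idx4 -> A) :
  g (\sum_b c b *: th2 b) = \sum_b gmx s c1 b *: c b.
Proof.
case: hg => gD gZ gth; rewrite (morphD_sum gD); apply: eq_bigr => b _.
have gZ' a (t : GG) : g (a *: t) = a * g t := gZ a t.
by rewrite gZ' (gth _ _ _ _ : g (th2 b) = _) Mscalar.
Qed.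

(** With constant coefficients, [g] of the fixed tensor is a scalar. *)
Lemma clifford_fixed c : sigma_fixed s c ->
  \sum_x \sum_y \sum_z \sum_t c x y z t *: (tht (x, y) * tht (z, t)) =
  (\sum_b gmx s c1 b * c b.1.1 b.1.2 b.2.1 b.2.2)%:A.
Proof.
move=> /(sigma_fixedP s0) fix_c.
pose c' (b : idx4) := c b.1.1 b.1.2 b.2.1 b.2.2.
pose t : GG := \sum_b (c' b)%:A *: th2 b.
have st : sigma t = t.
  rewrite sigma_sum; apply: eq_bigr => a _; congr (_ *: _); rewrite /c' -fix_c.
  by rewrite scaler_suml; apply: eq_bigr => b _; rewrite scalerA.
have := clifford_rel st; rewrite g_sum (morphD_sum inTD) linear_sum /= => e.
transitivity (\sum_b pi (inT ((c' b)%:A *: th2 b))).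
  rewrite sum_idx4; do 4!(apply: eq_bigr => ? _).
  by rewrite inTZ linearZZ rmorph1 scalarM linearZZ /= inT_pure rmorphM.
rewrite e (morphD_sum iCD) scaler_suml; apply: eq_bigr => b _.
by rewrite !iCZ iC1 scalerA.
Qed.

Notation t11 := (tht (i1, i1)).
Notation t12 := (tht (i1, i2)).
Notation t21 := (tht (i2, i1)).
Notation t22 := (tht (i2, i2)).

Lemma two_q_neq0 : two_q q != 0.
Proof.
have q0 := q_neq0 s0 s2.
have : q ^+ 4 != 1 by exact: q_nroot.
apply: contra_neq; rewrite /two_q => /(congr1 ( *%R q)).
rewrite mulr0 mulrDr mulfV // => /eqP; rewrite addr_eq0 -expr2 => /eqP e.
by rewrite (exprM q 2 2) e sqrrN expr1n.
Qed.

Lemma kap_neq0 : kap != 0. Proof. by rewrite mulf_neq0 // two_q_neq0. Qed.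

Ltac quad H := have := clifford_fixed H;
  rewrite sum_idx4 !sum2 /vec /= ?s2 !(gmxE c1 s0 s2)
    ?scale0r ?add0r ?addr0 ?scale1r ?zeroE ?scale0r ?mulr1.

Lemma t11_t11 : t11 * t11 = 0.
Proof. by quad (fixed_th11_th11 s0). Qed.
Lemma t21_t21 : t21 * t21 = 0.
Proof. by quad (fixed_th21_th21 s0). Qed.
Lemma t22_t22 : t22 * t22 = 0.
Proof. by quad (fixed_th22_th22 s0). Qed.
Lemma t12_t12 : t12 * t12 = - ((q - q^-1) *: (t11 * t22)).
Proof.
quad (fixed_th12_th12 s0); rewrite -mulrDr addrA subrK subrr mulr0 scale0r.
by rewrite addrC => /eqP; rewrite addr_eq0 => /eqP.
Qed.
Lemma t21_t11 : t21 * t11 = - (t11 * t21).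
Proof.
by quad (fixed_th21_th11 s0); rewrite addrC => /eqP; rewrite addr_eq0 => /eqP.
Qed.
Lemma t22_t21 : t22 * t21 = - (t21 * t22).
Proof.
by quad (fixed_th22_th21 s0); rewrite addrC => /eqP; rewrite addr_eq0 => /eqP.
Qed.
Lemma t12_t11 :
  t12 * t11 = - (q ^+ 2 *: (t11 * t12)) - (q - q^-1) *: (t11 * t21).
Proof.
quad (fixed_th12_th11 s0); rewrite addrC => /eqP.
by rewrite addr_eq0 opprD => /eqP.
Qed.
Lemma t22_t12 :
  t22 * t12 = - (q ^+ 2 *: (t12 * t22)) - (q - q^-1) *: (t21 * t22).
Proof.
quad (fixed_th22_th12 s0); rewrite addrA addrC => /eqP.
by rewrite addr_eq0 opprD => /eqP.
Qed.
Lemma t22_t11 : t22 * t11 = - (t11 * t22) - (q * kap)%:A.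
Proof.
quad (fixed_th22_th11 s0) => /(canRL (addKr _)) ->; congr (_ + _).
rewrite -scaleNr; congr (_%:A); rewrite /kap /two_q.
by have q0 := q_neq0 s0 s2; field.
Qed.
Lemma t21_t12 : t21 * t12 =
  - (t12 * t21) - (1 - q^-1 ^+ 2) *: (t11 * t22) + (kap / q)%:A.
Proof.
quad (fixed_th21_th12 s0) => /(canRL (addKr _)) ->.
rewrite opprD [- _ - t12 * t21]addrC; congr (_ + _%:A); rewrite /kap /two_q.
by have q0 := q_neq0 s0 s2; field.
Qed.

(** All four [psi] are left multiples of [w = t21 t22], which [t21] and [t22]
    annihilate: [w] is the vacuum of the spinor module. *)
Notation w := (t21 * t22).

Lemma psiE :
  (psi (true, i1) = (q / kap) *: (t11 * (t12 * w))) * (psi (true, i2) = w) *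
  (psi (false, i1) = t11 * w) * (psi (false, i2) = q *: (t12 * w)).
Proof. by rewrite /psi /= !mulrA. Qed.

Lemma t21_w : t21 * w = 0. Proof. by rewrite mulrA t21_t21 mul0r. Qed.
Lemma t22_w : t22 * w = 0.
Proof. by rewrite mulrA t22_t21 mulNr -mulrA t22_t22 mulr0 oppr0. Qed.
Lemma t12_t12_w : t12 * (t12 * w) = 0.
Proof. by rewrite mulrA t12_t12 mulNr -scalerAl -mulrA t22_w mulr0 scaler0 oppr0. Qed.
Lemma t21_t12_w : t21 * (t12 * w) = (kap / q) *: w.
Proof.
rewrite mulrA t21_t12 mulrDl mulrBl mulNr -mulrA t21_w mulr0 -scalerAl -mulrA t22_w.
by rewrite mulr0 scaler0 subr0 oppr0 add0r -scalerAl mul1r.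
Qed.
Lemma t22_t12_w : t22 * (t12 * w) = 0.
Proof.
rewrite mulrA t22_t12 mulrBl mulNr -!scalerAl -!mulrA t22_w !mulr0.
by rewrite !scaler0 subr0 oppr0.
Qed.
Lemma t12_t11_x x :
  t12 * (t11 * x) = - (q ^+ 2 *: (t11 * (t12 * x))) - (q - q^-1) *: (t11 * (t21 * x)).
Proof. by rewrite mulrA t12_t11 mulrBl mulNr -!scalerAl !mulrA. Qed.
Lemma t22_t11_x x : t22 * (t11 * x) = - (t11 * (t22 * x)) - (q * kap) *: x.
Proof. by rewrite mulrA t22_t11 mulrBl mulNr -scalerAl mul1r mulrA. Qed.
Lemma t21_t11_x x : t21 * (t11 * x) = - (t11 * (t21 * x)).
Proof. by rewrite mulrA t21_t11 mulNr mulrA. Qed.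
Lemma t11_t11_x x : t11 * (t11 * x) = 0.
Proof. by rewrite mulrA t11_t11 mul0r. Qed.

(** [t21] and [t22] are moved to the right until they meet [w]. *)
Lemma tht_psi p e m : tht p * psi (e, m) = \sum_n spin e p m n *: psi (~~ e, n).
Proof.
have q0 := q_neq0 s0 s2; have k0 := kap_neq0.
case: p => i j; rewrite sum2; case: e; move: i j m; do 3!apply: ord2P;
  rewrite !(spinE c1 s0 s2) ?scale0r ?add0r ?addr0 !psiE -?scalerAr
    ?(t11_t11_x, t12_t11_x, t21_t11_x, t22_t11_x, t12_t12_w, t21_t12_w,
      t22_t12_w, t21_w, t22_w) ?mulr0 ?scaler0 ?oppr0 ?subr0 ?sub0r ?add0r ?scaler0 //.
all: rewrite -[LHS]scale1r ?addr0 -?scalerAr ?scalerN -?scaleNr ?scalerA;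
  congr (_ *: _); field; rewrite ?q0 ?k0 //.
Qed.

(** The combinations of the [psi] are stable under [A] and, by [tht_psi], under
    [Gam], which generate the Clifford algebra. *)
Lemma Cl_psi_span x p : exists a : bool * I -> A,
  x * psi p = \sum_r iC (a r) * psi r.
Proof.
pose W (z : Cl) := exists a : bool * I -> A, z = \sum_r iC (a r) * psi r.
have W0 : W 0 by exists (fun=> 0); rewrite big1 // => r _; rewrite (morphD0 iCD) mul0r.
have WD y z : W y -> W z -> W (y + z).
  move=> [a ->] [b ->]; exists (fun r => a r + b r); rewrite -big_split.
  by apply: eq_bigr => r _; rewrite iCD mulrDl.
have WiC a z : W z -> W (iC a * z).
  move=> [b ->]; exists (fun r => a * b r); rewrite mulr_sumr.
  by apply: eq_bigr => r _; rewrite iCM mulrA.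
have Wsum (J : finType) (f : J -> Cl) : (forall j, W (f j)) -> W (\sum_j f j).
  by move=> Wf; elim/big_ind: _.
have Wpsi r : W (psi r).
  exists (fun r' => (r' == r)%:R); rewrite (bigD1 r) //= eqxx iC1 mul1r.
  by rewrite big1 ?addr0 // => r' /negPf ->; rewrite (morphD0 iCD) mul0r.
have Wtht r z : W z -> W (tht r * z).
  move=> [a ->]; rewrite mulr_sumr; apply: (Wsum) => -[e m].
  rewrite mulrA tht_iC mulr_suml; apply: (Wsum) => r'.
  rewrite -mulrA tht_psi; apply: (WiC); apply: (Wsum) => n.
  by rewrite -[psi _]mul1r scalerAl -iC_scalar; apply: (WiC).
suff WCl z : W z -> W (x * z) by exact: WCl.
have [t <-] := hCl.1 x; move: t z; apply: (tensor_algebra_ind hT).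
- split=> [z|t t' Wt Wt' z Wz|t t' Wt Wt' z Wz|c t Wt z Wz].
  + by rewrite rmorph1 mul1r.
  + by rewrite linearD mulrDl; apply: (WD); [exact: Wt|exact: Wt'].
  + by rewrite rmorphM -mulrA; apply/Wt/Wt'.
  rewrite linearZZ -scalerAl -[_ * _]mul1r scalerAl -iC_scalar.
  exact/WiC/Wt.
- by move=> a z; exact: WiC.
move=> y z Wz; rewrite -/(jC y) jC_sum mulr_suml; apply: (Wsum) => r.
by rewrite -mulrA; apply/WiC/Wtht.
Qed.

Lemma psi_multiple p : exists x, psi p = x * w.
Proof.
have [[[e1 e2] e3] e4] := psiE.
case: p => [[] m]; move: m; apply: ord2P.
- by exists ((q / kap) *: (t11 * t12)); rewrite e1 -scalerAl !mulrA.
- by exists 1; rewrite e2 mul1r.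
- by exists t11; rewrite e3.
by exists (q *: t12); rewrite e4 -scalerAl.
Qed.

(** [th_21 u^k_l] only involves [th_21], and [th_22 u^k_l] involves [th_22]
    and [th_21], which [t21] annihilates; the signs [nu0] cancel in pairs. *)
Lemma w_iC a : exists b, w * iC a = iC b * w.
Proof.
move: a; apply: (OSLq2_ind hA).
  split=> [|a b [a' ea] [b' eb]|a b [a' ea] [b' eb]|c a [a' ea]].
  - by exists 1; rewrite iC1 mul1r mulr1.
  - by exists (a' + b'); rewrite !iCD mulrDr ea eb mulrDl.
  - by exists (a' * b'); rewrite !iCM mulrA ea -mulrA eb mulrA.
  by exists (c *: a'); rewrite !iCZ -scalerAr ea scalerAl.
have Fu p k l : tht p * iC (u k l) =
    \sum_r \sum_m (nu0 * fmx s p r m l) *: (iC (u k m) * tht r).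
  rewrite tht_iC; apply: eq_bigr => r _; rewrite F_u (morphD_sum iCD) mulr_suml.
  by apply: eq_bigr => m _; rewrite iCZ scalerAl.
have fE := fmxE s0 s2.
have ac := t21_t21.
move=> k l; move: k l; move=> k; apply: ord2P.
- exists (q^-1 *: u k i1); rewrite -mulrA Fu sum_pair !sum2 !fE /=.
  rewrite !(mulr0, mulr1, scale0r, addr0, add0r) mulrDr -!scalerAr !mulrA !Fu.
  rewrite !sum_pair !sum2 !fE /=.
  rewrite !(mulr0, mulr1, scale0r, addr0, add0r) -!scalerAl -!mulrA ac.
  rewrite !(mulr0, scaler0, addr0, add0r) scalerA [nu0 * (nu0 * _)]mulrA (nu0K hnu0) mul1r.
  by rewrite iCZ -scalerAl.
exists (q *: u k i2); rewrite -mulrA Fu sum_pair !sum2 !fE /=.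
rewrite !(mulr0, mulr1, scale0r, addr0, add0r) -!scalerAr !mulrA !Fu.
rewrite !sum_pair !sum2 !fE /=.
rewrite !(mulr0, mulr1, scale0r, addr0, add0r) -!scalerAl -!mulrA.
by rewrite scalerA [nu0 * (nu0 * _)]mulrA (nu0K hnu0) mul1r iCZ -scalerAl.
Qed.

Notation S0 := (S0 q th jT pi c1).

Lemma S0_right (phi : S0) a : lval phi * iC a \in lideal_pred psi.
Proof.
case: phi => _ /= /asboolP[c ->].
have [b wb] := w_iC a; have [[[_ e2] _] _] := psiE.
have x_p : forall p, exists x, psi p * iC a = x * psi (true, i2).
  move=> p; have [x ->] := psi_multiple p; exists (x * iC b).
  by rewrite e2 -[x * _ * _]mulrA wb -[RHS]mulrA.
have [x xE] := boolp.choice x_p.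
apply/asboolP; exists (fun p => (\sum_r c r * x r) *+ (p == (true, i2))).
transitivity ((\sum_r c r * x r) * psi (true, i2)).
  rewrite !mulr_suml; apply: eq_bigr => r _.
  by rewrite -mulrA xE mulrA.
move: (\sum_r c r * x r) => y.
rewrite [RHS](bigD1 (true, i2)) // eqxx mulr1n big1 /= ?addr0 // => p /negPf ->.
by rewrite mulr0n mul0r.
Qed.

Lemma S0r_val (phi : S0) a : lval (S0r iT phi a) = lval phi * iC a.
Proof. by rewrite -[LHS]/(val _) insubdK // S0_right. Qed.

End Clifford.

(** * The spinors are free *)

Section FullTables.
Variables (K : fieldType) (s : K).
Hypothesis s0 : s != 0.

Lemma b34VE :
  ((forall v x y w, b34 (Rinv s) v x y i1 i1 w = s^-1 * v x y i1 i1 w) *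
  (forall v x y w, b34 (Rinv s) v x y i1 i2 w = s * v x y i2 i1 w) *
  (forall v x y w, b34 (Rinv s) v x y i2 i1 w =
     s * v x y i1 i2 w + (s^-1 - s ^+ 3) * v x y i2 i1 w) *
  (forall v x y w, b34 (Rinv s) v x y i2 i2 w = s^-1 * v x y i2 i2 w)).
Proof. by do !split; move=> *; rewrite /b34 !sum2 !(RE s0) ?zeroE. Qed.

Lemma b23RE :
  ((forall v x t w, b23 (Rh s) v x i1 i1 t w = s * v x i1 i1 t w) *
  (forall v x t w, b23 (Rh s) v x i1 i2 t w =
     (s - s^-1 ^+ 3) * v x i1 i2 t w + s^-1 * v x i2 i1 t w) *
  (forall v x t w, b23 (Rh s) v x i2 i1 t w = s^-1 * v x i1 i2 t w) *
  (forall v x t w, b23 (Rh s) v x i2 i2 t w = s * v x i2 i2 t w)).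
Proof. by do !split; move=> *; rewrite /b23 !sum2 !(RE s0) ?zeroE. Qed.

End FullTables.

Arguments spin : simpl never.

Section SpinSquare.
Variables (K : fieldType) (q s c1 : K).
Hypotheses (s0 : s != 0) (s2 : s ^+ 2 = q).
Hypothesis q_nroot : forall n : nat, (0 < n)%N -> q ^+ n != 1.

Notation spin := (spin q s c1).

(** The matrix of [th_b th_b' - g (th_b (x) th_b')] on the spinors. *)
Definition spin_sq e (b : idx4) (m n : I) : K :=
  (\sum_k spin e b.2 m k * spin (~~ e) b.1 k n) - gmx s c1 b * (m == n)%:R.

Let q_neq0' : q != 0 := q_neq0 s0 s2.

Definition sq_tab (e m n x y z t : bool) : K :=
  match e, m, n, x, y, z, t with
  | true, true, true, true, true, false, false => - q ^+ 2
  | true, true, true, true, false, true, false => q ^+ 3 - q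
  | true, true, true, true, false, false, true => q ^+ 2
  | true, true, true, false, true, true, false => - 1
  | true, true, true, false, false, true, true => q ^+ 2
  | true, true, false, false, true, false, false => - (1 + q ^+ 2)
  | true, true, false, false, false, true, false => (q ^+ 2 + 1) * (q - q^-1)
  | true, true, false, false, false, false, true => 1 + q ^+ 2
  | true, false, true, true, true, true, false => 1 + q^-1 ^+ 2
  | true, false, true, true, false, true, true => - (1 + q ^+ 2)
  | true, false, false, true, true, false, false => 1
  | true, false, false, true, false, true, false => - (q - q^-1)
  | true, false, false, true, false, false, true => - 1
  | true, false, false, false, true, true, false => q^-1 ^+ 2
  | true, false, false, false, false, true, true => - 1
  | false, true, true, true, true, false, false => - q ^+ 2
  | false, true, true, true, false, true, false => q ^+ 3 - q
  | false, true, true, true, false, false, true => - 1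
  | false, true, true, false, true, true, false => q ^+ 2
  | false, true, true, false, false, true, true => q ^+ 2
  | false, true, false, true, false, false, false => - (q + q^-1)
  | false, true, false, false, false, true, false => q * (q ^+ 2 + 1)
  | false, false, true, true, true, false, true => q + q^-1
  | false, false, true, true, false, true, true => - (q + q^-1) * (q - q^-1)
  | false, false, true, false, true, true, true => - (q + q^-1)
  | false, false, false, true, true, false, false => 1
  | false, false, false, true, false, true, false => - (q - q^-1)
  | false, false, false, true, false, false, true => q^-1 ^+ 2
  | false, false, false, false, true, true, false => - 1
  | false, false, false, false, false, true, true => - 1
  | _, _, _, _, _, _, _ => 0
  end.

Lemma spin_sqE e b m n : spin_sq e b m n =
  c1 * sq_tab e (m == i1) (n == i1) (b.1.1 == i1) (b.1.2 == i1)
              (b.2.1 == i1) (b.2.2 == i1).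
Proof.
case: b => -[x y] [z t]; case: e; move: x y z t m n; do 6!apply: ord2P;
  by rewrite /spin_sq sum2 /= !(spinE c1 s0 s2) !(gmxE c1 s0 s2) ?zeroE
    ?mulr1 ?subr0 // /kap /two_q; field; rewrite ?q_neq0'.
Qed.

(** The eigenvalues of [sigma] are 1, [- q ^ 2] and [- q ^ -2]; in each of the two
    halves of the spinors only one of the last two occurs. *)
Lemma spin_sq_sigma e m n b :
  \sum_a spin_sq e a m n * sigma_mx s a b =
  - (if e then q ^+ 2 else q^-1 ^+ 2) * spin_sq e b m n.
Proof.
have q0 := q_neq0 s0 s2.
suff H v : \sum_a spin_sq e a m n * st1234 s true false v a.1.1 a.1.2 a.2.1 a.2.2 i1 =
    - (if e then q ^+ 2 else q^-1 ^+ 2) *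
    \sum_a spin_sq e a m n * v a.1.1 a.1.2 a.2.1 a.2.2 i1.
  have := H (delta5 K b i1).
  have sumd : \sum_a spin_sq e a m n * delta5 K b i1 a.1.1 a.1.2 a.2.1 a.2.2 i1 =
      spin_sq e b m n.
    rewrite -[RHS](sum_delta (fun a => spin_sq e a m n)).
    by apply: eq_bigr => -[[x y] [z t]] _; rewrite /delta5 /= eqxx andbT.
  rewrite sumd => <-; apply: eq_bigr => a _; congr (_ * _).
  rewrite -mxact_stilde -[LHS](sum_delta (sigma_mx s a)).
  case: a => -[x y] [z t]; rewrite /mxact /=.
  by apply: eq_bigr => -[[x' y'] [z' t']] _; rewrite /delta5 /= eqxx andbT.
rewrite !sum_idx4 !sum2.
by case: e; move: m n; do 2!apply: ord2P; rewrite !spin_sqE /=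
  ?(mul0r, mulr0, add0r, addr0) // /st1234 !(b23RE s0, b12E s0, b34VE s0, b23E s0);
  rewrite -s2; field; rewrite ?s0.
Qed.

End SpinSquare.

Section Representation.
Variables (K : fieldType) (q s c1 : K).
Hypotheses (s0 : s != 0) (s2 : s ^+ 2 = q).
Hypothesis q_nroot : forall n : nat, (0 < n)%N -> q ^+ n != 1.
Hypothesis c1_neq0 : c1 != 0.
Variables (A : algType K) (u : I -> I -> A).
Hypothesis hA : is_OSLq2 q s u.
Variables (nu0 : K).
Hypothesis hnu0 : nu0 = 1 \/ nu0 = -1.
Variables (Gam : lmodType A) (th : I -> I -> Gam) (rm : Gam -> A -> Gam).
Hypothesis hGam : is_4Dcalc s u th rm nu0.
Notation pr := (I * I)%type.
Notation th' := (thp th).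
Notation coef := (coef hGam).
Notation GG := (GT (@lsc K A Gam) hGam).
Notation th2 := (th2 th rm : idx4 -> GG).
Variables (sigma : GG -> GG) (g : GG -> A).
Hypothesis hsigma : is_sigma s th sigma.
Hypothesis hg : is_metric_g s th c1 g.
Variables (T : algType K) (iT : {lrmorphism A -> T}) (jT : Gam -> T).
Hypothesis hT : is_tensor_algebra rm iT jT.
Variables (Cl : algType K) (pi : {lrmorphism T -> Cl}).
Hypothesis hCl : is_clifford iT jT sigma g pi.

Notation iC := (iC iT pi).
Notation psi := (psi q th jT pi c1).
Notation spin := (spin q s c1).
Notation kap := (kap q c1).
Notation J := (bool * I)%type.
Notation V := {ffun J -> A}.
Notation j0 := (true, i1).
Notation E := (endo A (j0 : J)).

Definition sp (r : pr) (p p' : J) : K :=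
  if p'.1 == ~~ p.1 then spin p.1 r p.2 p'.2 else 0.

(** The action of [Gam] on [A^4] that Clifford multiplication would have if
    the four spinors were free over [A]. *)
Definition jop_fun (x : Gam) (v : V) : V :=
  [ffun p' => \sum_r \sum_p sp r p p' *: coef (rm x (v p)) r].

Fact jop_subproof x : linear (jop_fun x).
Proof.
move=> c v w; apply/ffunP => p'; rewrite !ffunE scaler_sumr -big_split.
apply: eq_bigr => r _ /=; rewrite scaler_sumr -big_split.
apply: eq_bigr => p _ /=; rewrite !ffunE (rmDr hGam) coD scalerDr; congr (_ + _).
by rewrite -Mscalar (rmM hGam) (rm_scalar hGam) coZ scalarM !scalerA mulrC.
Qed.

Definition jop x : E := Endo j0 (jop_subproof x).

Arguments jop : simpl never.

Lemma jopE x v p' :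
  jop x v p' = \sum_r \sum_p sp r p p' *: coef (rm x (v p)) r.
Proof. by rewrite ffunE. Qed.

Fact jop_bimod : is_bimod_map rm (lmult j0 : {lrmorphism A -> E}) jop.
Proof.
split=> [x y|a x|x a]; apply: endoP => v; apply/ffunP => p'.
- rewrite endo_addE [RHS]ffunE !jopE -big_split; apply: eq_bigr => r _ /=.
  rewrite -big_split; apply: eq_bigr => p _ /=.
  by rewrite (rmDl hGam) coD scalerDr.
- rewrite endo_mulE [RHS]ffunE !jopE mulr_sumr; apply: eq_bigr => r _ /=.
  rewrite mulr_sumr; apply: eq_bigr => p _ /=.
  by rewrite (rmZ hGam) coZ scalerAr.
rewrite endo_mulE !jopE; apply: eq_bigr => r _; apply: eq_bigr => p _.
by rewrite [lmult _ _ _ _]ffunE (rmM hGam).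
Qed.

Lemma rep_exists : exists F : {lrmorphism T -> E},
  (forall a, F (iT a) = lmult j0 a) /\ (forall x, F (jT x) = jop x).
Proof. by have [F [Fi Fj _]] := hT.2 E _ jop jop_bimod; exists F. Qed.

Section WithRep.
Variable F : {lrmorphism T -> E}.
Hypotheses (Fi : forall a, F (iT a) = lmult j0 a) (Fj : forall x, F (jT x) = jop x).

Definition sp2 (b : idx4) (p p'' : J) : K := \sum_p' sp b.2 p p' * sp b.1 p' p''.

Lemma rep_inT (t : GG) v p'' : F (inT jT t) v p'' =
  \sum_b \sum_p sp2 b p p'' *: gcoef b (ra t (v p)).
Proof.
have coef_sum p (X : Type) (r : seq X) (f : X -> Gam) :
  coef (\sum_(x <- r) f x) p = \sum_(x <- r) coef (f x) p.
  exact: (morphD_sum (coD hGam p)).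
have coefK p x (c : K) a : coef (rm x (c *: a)) p = c *: coef (rm x a) p.
  by rewrite -Mscalar (rmM hGam) (rm_scalar hGam) coZ scalarM.
move: t; apply: tens_ext => [t t'|t t'|x y].
- by rewrite (inTD hT) linearD endo_addE ffunE.
- rewrite -big_split; apply: eq_bigr => b _; rewrite -big_split.
  by apply: eq_bigr => p _ /=; rewrite raDl gcoefD scalerDr.
rewrite (inT_pure hGam hT) rmorphM [LHS]/= !Fj jopE [RHS]sum_pair.
apply: eq_bigr => r' _.
under eq_bigr => p' _ do rewrite jopE (rm_sumr hGam) coef_sum scaler_sumr.
rewrite exchange_big; apply: eq_bigr => r _ /=.
under eq_bigr => p' _ do rewrite (rm_sumr hGam) coef_sum scaler_sumr.
rewrite exchange_big; apply: eq_bigr => p _ /=.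
rewrite ra_pure gcoef_pure /= /sp2 scaler_suml; apply: eq_bigr => p' _.
by rewrite coefK scalerA mulrC.
Qed.

(** Pairing the [sigma]-fixed [c] with an eigenvector of another eigenvalue. *)
Lemma spin_sum0 e m n (c : idx4 -> A) :
  (forall a, \sum_b sigma_mx s a b *: c b = c a) ->
  \sum_b spin_sq q s c1 e b m n *: c b = 0.
Proof.
move=> fix_c; set S := \sum_b _.
have eS : S = - (if e then q ^+ 2 else q^-1 ^+ 2) *: S.
  rewrite /S scaler_sumr -[LHS](eq_bigr _ (fun a _ => congr1 _ (fix_c a))).
  under eq_bigr do rewrite scaler_sumr.
  rewrite exchange_big; apply: eq_bigr => b _ /=.
  rewrite scalerA -(spin_sq_sigma c1 s0 s2) scaler_suml.
  by apply: eq_bigr => a _; rewrite scalerA.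
have q0 := q_neq0 s0 s2.
have q4 : 1 + q ^+ 2 != 0.
  apply: contra_neq (two_q_neq0 s0 s2 q_nroot) => e0.
  by apply: (mulfI q0); rewrite mulr0 -e0 /two_q mulrDr mulfV // addrC expr2.
have q4' : 1 + q^-1 ^+ 2 != 0.
  have -> : 1 + q^-1 ^+ 2 = (1 + q ^+ 2) * q^-1 ^+ 2 by field.
  by rewrite mulf_neq0 // expf_neq0 // invr_eq0.
have : (1 + (if e then q ^+ 2 else q^-1 ^+ 2)) *: S == 0.
  by rewrite scalerDl scale1r {1}eS scaleNr addNr.
by rewrite scaler_eq0 => /orP[|/eqP //]; case: (e) => /eqP eq0;
  [move: q4|move: q4']; rewrite eq0 eqxx.
Qed.

Lemma rep_clifford (t : GG) : sigma t = t -> F (inT jT t) = F (iT (g t)).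
Proof.
move=> st; apply: endoP => v; apply/ffunP => p''.
rewrite rep_inT Fi ffunE exchange_big /=.
have term p : \sum_b sp2 b p p'' *: gcoef b (ra t (v p)) =
    (g t * v p) *+ (p == p'').
  set t' := ra t (v p).
  have st' : sigma t' = t'.
    have hs : is_GG_endo th (stilde_mx s true false) sigma := hsigma.
    by rewrite /t' (stilde_right s0 hA hnu0 hs) st.
  have fix_c a : \sum_b sigma_mx s a b *: gcoef b t' = gcoef a t'.
    transitivity (gcoef a (sigma t')); last by rewrite st'.
    have -> : sigma t' =
        \sum_a (\sum_b sigma_mx s a b *: gcoef b t') *: th2 a.
      by rewrite {1}(GG_sum t') (sigma_sum hsigma).
    by rewrite gcoef_sum.
  have gt' : g t' = \sum_b gmx s c1 b *: gcoef b t'.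
    by rewrite {1}(GG_sum t') (g_sum hg).
  rewrite -(metric_right s0 hA hnu0 hg) -/t' gt'.
  clearbody t'; clear st'.
  case: p p'' => e m [e' n]; rewrite xpair_eqE.
  have [->|ne] := eqVneq e' e; last first.
    rewrite mulr0n big1 // => b _.
    rewrite [sp2 _ _ _]big1 ?scale0r // => -[e1 k] _; rewrite /sp /=.
    case: (e1 =P ~~ e) => [->|_]; last by rewrite mul0r.
    by rewrite negbK (negPf ne) mulr0.
  have := spin_sum0 e m n fix_c; rewrite /spin_sq.
  under eq_bigr do rewrite scalerBl.
  rewrite sumrB /= => /eqP; rewrite subr_eq0 => /eqP spg.
  transitivity (\sum_b (\sum_k spin e b.2 m k * spin (~~ e) b.1 k n) *: gcoef b t').
    apply: eq_bigr => b _; congr (_ *: _).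
    rewrite /sp2 sum_pair (bigD1 (~~ e)) //= [X in _ + X]big1 ?addr0 => [|e1].
      by apply: eq_bigr => k _; rewrite /sp /= eqxx negbK eqxx.
    by move/negPf => ne; rewrite big1 // => k _; rewrite /sp /= ne mul0r.
  rewrite spg; case: (m == n); rewrite ?mulr1n ?mulr0n.
    by under eq_bigr do rewrite mulr1.
  by rewrite big1 // => b _; rewrite mulr0 scale0r.
under eq_bigr do rewrite term.
rewrite (bigD1 p'') //= eqxx big1 ?addr0 // => p /negPf ->.
by rewrite mulr0n.
Qed.

Lemma rep_ker y : pi y = 0 -> F y = 0.
Proof.
move/(hCl.2 y) => [n [a [z [b [zP ->]]]]]; rewrite linear_sum big1 // => k _.
rewrite !rmorphM /=; have [t [st ->]] := zP k.
by rewrite linearB /= (rep_clifford st) subrr mulr0 mul0r.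
Qed.

Definition cv (c : J -> K) : V := [ffun p => (c p)%:A].

Lemma jop_cv r c : jop (th' r) (cv c) = cv (fun p' => \sum_p sp r p p' * c p).
Proof.
apply/ffunP => p'; rewrite jopE [RHS]ffunE (bigD1 r) //= [X in _ + X]big1 ?addr0.
  rewrite [RHS]scaler_suml; apply: eq_bigr => p _.
  by rewrite ffunE (rm_scalar hGam) coZ co_th eqxx mulr1 scalerA.
move=> r' /negPf ne; rewrite big1 // => p _.
by rewrite ffunE (rm_scalar hGam) coZ co_th eq_sym ne mulr0 scaler0.
Qed.

Definition unitv (p : J) : J -> K := fun p' => (p' == p)%:R.

Lemma jop_unit r e m :
  jop (th' r) (cv (unitv (e, m))) =
  spin e r m i1 *: cv (unitv (~~ e, i1)) + spin e r m i2 *: cv (unitv (~~ e, i2)).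
Proof.
rewrite jop_cv; apply/ffunP => -[e' n]; rewrite !ffunE !scalerA -scalerDl.
congr (_%:A); rewrite (bigD1 (e, m)) //= /unitv eqxx mulr1 big1 ?addr0.
  rewrite /sp /= !xpair_eqE; case: (e' == ~~ e); rewrite ?mulr0 ?addr0 //=.
  by move: n; apply: ord2P; rewrite /= ?mulr1 ?mulr0 ?addr0 ?add0r.
by move=> p /negPf ->; rewrite mulr0.
Qed.

Definition psiT (p : J) : T :=
  let t11 := jT (th i1 i1) in let t12 := jT (th i1 i2) in
  let t21 := jT (th i2 i1) in let t22 := jT (th i2 i2) in
  match p.1, p.2 == i1 with
  | true, true => (q / (two_q q * c1)) *: (t11 * t12 * t21 * t22)
  | true, false => t21 * t22
  | false, true => t11 * t21 * t22
  | false, false => q *: (t12 * t21 * t22)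
  end.

Lemma pi_psiT p : pi (psiT p) = psi p.
Proof.
case: p => -[] m; rewrite /psiT /Defs.psi /=; case: (m == i1);
  by rewrite ?linearZZ /= !rmorphM.
Qed.

(** One vector separates the four [psi], whose images are proportional to the
    four basis vectors. *)
Lemma rep_psi p :
  F (psiT p) (cv (unitv (true, i1))) = - (q * kap) *: cv (unitv p).
Proof.
have q0 := q_neq0 s0 s2; have k0 := kap_neq0 s0 s2 q_nroot c1_neq0.
have fE := spinE c1 s0 s2.
have rE : (th i1 i1 = th' (i1, i1)) * (th i1 i2 = th' (i1, i2)) *
  (th i2 i1 = th' (i2, i1)) * (th i2 i2 = th' (i2, i2)) by [].
have FM x y : F (x * y) = F x * F y by rewrite rmorphM.
have FZ c x : F (c *: x) = c *: F x by rewrite linearZZ.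
have uP r m := jop_unit r true m; have uN r m := jop_unit r false m.
rewrite -[~~ true]/false in uP; rewrite -[~~ false]/true in uN.
case: p => -[] m; move: m; apply: ord2P; rewrite /psiT /=
  ?FZ !FM ?endo_scaleE ?endo_mulE !Fj !rE;
  do ![rewrite ?endoZ (uP, uN) !fE ?scale0r ?addr0 ?add0r];
  rewrite ?scale1r ?scalerA; congr (_ *: _).
all: rewrite -?[two_q q * c1]/kap; field; rewrite ?q0 ?k0 //.
Qed.

End WithRep.

(** Apply a vanishing combination, lifted to the tensor algebra, to the vector of
    [rep_psi]. *)
Lemma psi_free (a : J -> A) : \sum_p iC (a p) * psi p = 0 -> forall p, a p = 0.
Proof.
have [F [Fi Fj]] := rep_exists.
have qk : - (q * kap) != 0.
  by rewrite oppr_eq0 mulf_neq0 ?(q_neq0 s0 s2) ?(kap_neq0 s0 s2 q_nroot c1_neq0).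
pose y := \sum_p iT (a p) * psiT p.
have piy : pi y = \sum_p iC (a p) * psi p.
  rewrite linear_sum; apply: eq_bigr => p _.
  by rewrite rmorphM /= pi_psiT.
move=> a0 p; have := rep_ker Fi Fj (etrans piy a0).
move/(congr1 (fun f : E => f (cv (unitv (true, i1))) p)).
rewrite [RHS]ffunE /y linear_sum endo_sumE sum_ffunE (bigD1 p) //=.
have term r : F (iT (a r) * psiT r) (cv (unitv (true, i1))) p =
    - (q * kap) *: (a r *+ (p == r)).
  have FM x z : F (x * z) = F x * F z by rewrite rmorphM.
  rewrite FM endo_mulE (rep_psi Fj) Fi endoZ !ffunE /unitv.
  by rewrite Mscalar scaler_nat.
rewrite term eqxx mulr1n big1 ?addr0 => [/eqP|r].
  by rewrite scaler_eq0 (negPf qk) => /eqP.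
by rewrite eq_sym term => /negPf ->; rewrite mulr0n scaler0.
Qed.

End Representation.

(** * The connection on the Clifford algebra *)

Section Connection.
Variables (K : fieldType) (q s c1 : K).
Hypotheses (s0 : s != 0) (s2 : s ^+ 2 = q).
Hypothesis q_nroot : forall n : nat, (0 < n)%N -> q ^+ n != 1.
Variables (A : algType K) (u : I -> I -> A).
Hypothesis hA : is_OSLq2 q s u.
Variables (nu0 : K).
Hypothesis hnu0 : nu0 = 1 \/ nu0 = -1.
Variables (Gam : lmodType A) (th : I -> I -> Gam) (rm : Gam -> A -> Gam).
Hypothesis hGam : is_4Dcalc s u th rm nu0.
Notation GG := (GT (@lsc K A Gam) hGam).
Notation theta := (theta q s th).
Notation dA := (dA q s th rm).
Variables (e e' : bool) (stilde : GG -> GG) (nu : K).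
Hypothesis hstilde : is_GG_endo th (stilde_mx s e e') stilde.

Lemma stildeD : {morph stilde : t t' / t + t'}. Proof. by case: hstilde. Qed.
Lemma stildeZ a (t : GG) : stilde (a *: t) = a *: stilde t.
Proof. by case: hstilde => _ h _; exact: h. Qed.
Lemma stilde_ra (t : GG) a : stilde (ra t a) = ra (stilde t) a.
Proof. exact: (stilde_right s0 hA hnu0 hstilde). Qed.

(** The map written [tilde sigma = nu tilde sigma_(i)] in the theory. *)
Definition stn (t : GG) : GG := nu%:A *: stilde t.

Lemma stnD : {morph stn : t t' / t + t'}.
Proof. by move=> t t'; rewrite /stn stildeD scalerDr. Qed.
Lemma stnZ a t : stn (a *: t) = a *: stn t.
Proof. by rewrite /stn stildeZ !scalerA Mscalar scalarM. Qed.
Lemma stn_ra t a : stn (ra t a) = ra (stn t) a.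
Proof. by rewrite /stn stilde_ra raZ. Qed.

(** What is needed of [T], [Cl] and [S0] alike to braid a form past
    [Gam (x) N]. *)
Definition gamma_action (N : zmodType) (l : A -> N -> N) (jl : Gam -> N -> N) :=
  [/\ forall y, {morph jl^~ y : x x' / x + x'}, forall x, {morph jl x : y y' / y + y'},
      forall a x y, jl (a *: x) y = l a (jl x y)
    & forall x a y, jl (rm x a) y = jl x (l a y)].

Section Over.
Variables (N : zmodType) (l : A -> N -> N) (jl : Gam -> N -> N).
Hypothesis hN : gamma_action l jl.
Notation GN := (GT l hGam).

Definition GGmul (t : GG) (y : N) : GN :=
  tlift (fun a b => tpure a (jl b y) : tens rm l) t.

Fact GGmul_balanced y : balanced rm (@lsc K A Gam)
  (fun a b => tpure a (jl b y) : tens rm l).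
Proof.
case: hN => jDl jDr jZ jr; split=> [x x' b|x b b'|x a b].
- exact: tpureDl.
- by rewrite jDl tpureDr.
by rewrite tpureA /lsc jZ.
Qed.

Lemma GGmul_pure a b y : GGmul (tpure a b) y = tpure a (jl b y).
Proof. exact: tlift_pure (GGmul_balanced y). Qed.
Lemma GGmulDl y : {morph GGmul^~ y : t t' / t + t'}.
Proof. exact: tliftD (GGmul_balanced y). Qed.
Lemma GGmulDr t : {morph GGmul t : y y' / y + y'}.
Proof.
move=> y y'; move: t; apply: tens_ext => [t t'|t t'|a b].
- exact: GGmulDl.
- by rewrite !GGmulDl addrACA.
by rewrite !GGmul_pure; case: hN => _ -> _ _; rewrite tpureDr.
Qed.
Lemma GGmul_ra t a y : GGmul (ra t a) y = GGmul t (l a y).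
Proof.
move: t; apply: tens_ext => [t t'|t t'|x b].
- by rewrite raDl GGmulDl.
- exact: GGmulDl.
by rewrite ra_pure !GGmul_pure; case: hN => _ _ _ ->.
Qed.
Lemma GGmulZ a t y : GGmul (a *: t) y = a *: GGmul t y.
Proof.
move: t; apply: tens_ext => [t t'|t t'|x b].
- by rewrite scalerDr GGmulDl.
- by rewrite GGmulDl scalerDr.
by rewrite GT_scale_pure !GGmul_pure GT_scale_pure.
Qed.

(** The second term of the Leibniz rule for a product [rho x]: [rho] is braided
    past the form in front of [y] and then acts on [y]. *)
Definition Phi (rho : Gam) (t : GN) : GN :=
  tlift (fun rho' y => GGmul (stn (tpure rho rho')) y) t.

Fact Phi_balanced rho : balanced rm l
  (fun rho' y => GGmul (stn (tpure rho rho')) y).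
Proof.
split=> [x x' b|x b b'|x a b].
- by rewrite tpureDr stnD GGmulDl.
- exact: GGmulDr.
by rewrite -ra_pure stn_ra GGmul_ra.
Qed.

Lemma Phi_pure rho rho' y :
  Phi rho (tpure rho' y) = GGmul (stn (tpure rho rho')) y.
Proof. exact: tlift_pure (Phi_balanced rho). Qed.
Lemma PhiD rho : {morph Phi rho : t t' / t + t'}.
Proof. exact: tliftD (Phi_balanced rho). Qed.
Lemma PhiDl t : {morph Phi^~ t : rho rho' / rho + rho'}.
Proof.
move=> rho rho'; move: t; apply: tens_ext => [t t'|t t'|x b].
- exact: PhiD.
- by rewrite !PhiD addrACA.
by rewrite !Phi_pure tpureDl stnD GGmulDl.
Qed.
Lemma PhiZl a rho t : Phi (a *: rho) t = a *: Phi rho t.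
Proof.
move: t; apply: tens_ext => [t t'|t t'|x b].
- exact: PhiD.
- by rewrite PhiD scalerDr.
by rewrite !Phi_pure -(GT_scale_pure hGam) stnZ GGmulZ.
Qed.
Lemma PhiZr a rho t : Phi rho (a *: t) = Phi (rm rho a) t.
Proof.
move: t; apply: tens_ext => [t t'|t t'|x b].
- by rewrite scalerDr PhiD.
- exact: PhiD.
by rewrite GT_scale_pure !Phi_pure tpureA.
Qed.

End Over.

Section Map.
Variables (N N' : zmodType) (l : A -> N -> N) (l' : A -> N' -> N').
Variables (jl : Gam -> N -> N) (jl' : Gam -> N' -> N') (f : N -> N').
Hypotheses (hN : gamma_action l jl) (hN' : gamma_action l' jl').
Hypotheses (fD : {morph f : y y' / y + y'}) (fl : forall a y, f (l a y) = l' a (f y)).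

Definition tmap (t : GT l hGam) : GT l' hGam :=
  tlift (fun rho y => tpure rho (f y) : tens rm l') t.

Fact tmap_balanced : balanced rm l (fun rho y => tpure rho (f y) : tens rm l').
Proof.
split=> [x x' b|x b b'|x c b].
- exact: tpureDl.
- by rewrite fD tpureDr.
by rewrite tpureA fl.
Qed.

Lemma tmap_pure x y : tmap (tpure x y) = tpure x (f y).
Proof. exact: tlift_pure tmap_balanced. Qed.
Lemma tmapD : {morph tmap : t t' / t + t'}.
Proof. exact: tliftD tmap_balanced. Qed.
Lemma tmapZ a t : tmap (a *: t) = a *: tmap t.
Proof.
move: t; apply: tens_ext => [t t'|t t'|x b].
- by rewrite scalerDr tmapD.
- by rewrite tmapD scalerDr.
by rewrite GT_scale_pure !tmap_pure GT_scale_pure.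
Qed.

Hypothesis fj : forall x y, f (jl x y) = jl' x (f y).

Lemma tmap_GGmul t y : tmap (GGmul l jl t y) = GGmul l' jl' t (f y).
Proof.
move: t; apply: tens_ext => [t t'|t t'|a b].
- by rewrite (GGmulDl hN) tmapD.
- exact: (GGmulDl hN').
by rewrite (GGmul_pure hN) (GGmul_pure hN') tmap_pure fj.
Qed.

Lemma tmap_Phi rho t : tmap (Phi jl rho t) = Phi jl' rho (tmap t).
Proof.
move: t; apply: tens_ext => [t t'|t t'|x b].
- by rewrite (PhiD hN) tmapD.
- by rewrite tmapD (PhiD hN').
by rewrite tmap_pure (Phi_pure hN) (Phi_pure hN') tmap_GGmul.
Qed.

End Map.

Definition mulact (B : algType K) (jB : Gam -> B) (x : Gam) (y : B) : B := jB x * y.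

Lemma mulact_action (B : algType K) (iB : A -> B) (jB : Gam -> B) :
  is_bimod_map rm iB jB -> gamma_action (algl iB) (mulact jB).
Proof.
move=> [jD jl jr]; split=> [y x x'|x y y'|a x y|x a y]; rewrite /mulact /algl.
- by rewrite jD mulrDl.
- by rewrite mulrDr.
- by rewrite jl mulrA.
by rewrite jr mulrA.
Qed.

Variables (T : algType K) (iT : {lrmorphism A -> T}) (jT : Gam -> T).
Hypothesis hT : is_tensor_algebra rm iT jT.
Variables (Cl : algType K) (pi : {lrmorphism T -> Cl}).
Hypothesis pi_onto : forall y, exists x, pi x = y.
Variables (nablaT : T -> GT (algl iT) hGam).
Hypothesis hnablaT : is_nabla_T q s th jT stilde nu nablaT.
Notation iC := (iC iT pi).
Notation jC := (jC jT pi).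
Notation GBT := (GT (algl iT) hGam).
Notation GBC := (GT (algl iC) hGam).
Variables (nablaC : Cl -> GBC).
Hypothesis hnablaC : is_nabla_Cl nablaT nablaC.
Variables (sigmaC : BG Gam iC -> GBC).
Hypothesis hsigmaC : is_sigma_Cl q s th nablaC sigmaC.

Lemma bimodT : is_bimod_map rm iT jT. Proof. exact: hT.1. Qed.
Lemma bimodC : is_bimod_map rm iC jC.
Proof.
have [jD jl jr] := hT.1.
split=> [x y|a x|x a]; rewrite /Defs.jC /Defs.iC.
- by rewrite jD linearD.
- by rewrite jl rmorphM.
by rewrite jr rmorphM.
Qed.

Let actT := mulact_action bimodT.
Let actC := mulact_action bimodC.

Definition prj : GBT -> GBC := @tmap _ _ (algl iT) (algl iC) pi.

Let piD : {morph pi : x y / x + y}. Proof. exact: linearD. Qed.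
Let pil a y : pi (algl iT a y) = algl iC a (pi y).
Proof. by rewrite /algl rmorphM. Qed.
Let pij x y : pi (mulact jT x y) = mulact jC x (pi y).
Proof. by rewrite /mulact rmorphM. Qed.

Lemma prj_pure x y : prj (tpure x y) = tpure x (pi y).
Proof. exact: (tmap_pure piD pil). Qed.
Lemma prjD : {morph prj : t t' / t + t'}.
Proof. exact: (tmapD piD pil). Qed.
Lemma prj_GGmul t x :
  prj (GGmul (algl iT) (mulact jT) t x) = GGmul (algl iC) (mulact jC) t (pi x).
Proof. exact: (tmap_GGmul actT actC piD pil pij). Qed.
Lemma prj_Phi rho t : prj (Phi (mulact jT) rho t) = Phi (mulact jC) rho (prj t).
Proof. exact: (tmap_Phi actT actC piD pil pij). Qed.

Definition rC (t : GBC) a : GBC := @tmap _ _ (algl iC) (algl iC) (algr iC ^~ a) t.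

Let rCD' a : {morph algr iC ^~ a : y y' / y + y'}.
Proof. by move=> y y'; rewrite /algr mulrDl. Qed.
Let rCl a b y : algr iC (algl iC b y) a = algl iC b (algr iC y a).
Proof. by rewrite /algr /algl mulrA. Qed.

Lemma rC_pure x y a : rC (tpure x y) a = tpure x (y * iC a).
Proof. exact: (tmap_pure (rCD' a) (rCl a)). Qed.
Lemma rCD a : {morph rC^~ a : t t' / t + t'}.
Proof. exact: (tmapD (rCD' a) (rCl a)). Qed.
Lemma Phi_rC rho t a :
  rC (Phi (mulact jC) rho t) a = Phi (mulact jC) rho (rC t a).
Proof.
apply: (tmap_Phi actC actC (rCD' a) (rCl a)) => x y.
by rewrite /mulact /algr mulrA.
Qed.

Lemma nablaC_pi x : nablaC (pi x) = prj (nablaT x). Proof. exact: hnablaC. Qed.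

Lemma nablaCD : {morph nablaC : x y / x + y}.
Proof.
move=> x y; have [x' <-] := pi_onto x; have [y' <-] := pi_onto y.
by case: hnablaT => nD _ _ _; rewrite -linearD !nablaC_pi nD prjD.
Qed.

(** The aim is [defect x = sigmaC (x (x) theta)]: by [defect_jC] and [sigmaC_jC]
    both sides obey the same recursion on words. *)
Definition defect (x : Cl) : GBC := tpure theta x - nablaC x.

Lemma defectD : {morph defect : x y / x + y}.
Proof. by move=> x y; rewrite /defect nablaCD tpureDr opprD addrACA. Qed.

Lemma defect_iC a : defect (iC a) = tpure (a *: theta) 1.
Proof.
case: hnablaT => _ _ na _; rewrite /defect nablaC_pi na prj_pure rmorph1.
rewrite -[iC a]mulr1 -[iC a * 1]/(algl iC a 1) -tpureA /dA tpureBl.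
by rewrite opprB addrC subrK.
Qed.

Lemma defect_jC rho y : defect (jC rho * y) = Phi (mulact jC) rho (defect y).
Proof.
case: hnablaT => _ _ _ nj; have [x <-] := pi_onto y.
have eC : jC rho * pi x = pi (jT rho * x) by rewrite rmorphM.
rewrite /defect [in nablaC _]eC nablaC_pi.
have -> : nablaT (jT rho * x) =
    GGmul (algl iT) (mulact jT) (nabla_G q s th stilde nu rho : GG) x +
    Phi (mulact jT) rho (nablaT x) := nj rho x.
rewrite prjD prj_GGmul prj_Phi -nablaC_pi (morphDB (PhiD actC rho)) opprD addrA.
congr (_ - _).
have -> : (nabla_G q s th stilde nu rho : GG) =
   (tpure theta rho : GG) - stn (tpure rho theta) by [].
rewrite (morphDB (GGmulDl actC (pi x))) (GGmul_pure actC) -/(jC rho).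
by rewrite (Phi_pure actC) opprB addrC subrK.
Qed.

Lemma sigmaCD : {morph sigmaC : t t' / t + t'}. Proof. by case: hsigmaC. Qed.

Lemma sigmaC_dA x a :
  sigmaC (tpure x (dA a)) = rC (defect x) a - defect (x * iC a).
Proof.
case: hsigmaC => _ _ _ ->; rewrite /defect (morphDB (rCD a)).
by rewrite rC_pure opprB [RHS]addrC addrA subrK.
Qed.

Lemma sigmaC_right x w : sigmaC (tpure (x * iC w.1) w.2) =
  sigmaC (tpure x (w.1 *: w.2)).
Proof. by rewrite -[x * _]/(algr iC x w.1) tpureA. Qed.

(** By the Leibniz rule [sigmaC (y (x) d a)] is the failure of [defect] to be
    right linear at [y], and [Phi rho] is right linear; the differentials span. *)
Lemma sigmaC_jC rho y w :
  sigmaC (tpure (jC rho * y) w) = Phi (mulact jC) rho (sigmaC (tpure y w)).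
Proof.
have ext := dA_ext s0 s2 q_nroot hA hnu0 hGam.
move: w; apply: ext => [w w'|w w'|a b].
- by rewrite tpureDr sigmaCD.
- by rewrite tpureDr sigmaCD (PhiD actC).
rewrite -!(sigmaC_right _ (a, dA b)) /= !sigmaC_dA (morphDB (PhiD actC rho)).
by rewrite -Phi_rC -!defect_jC !mulrA.
Qed.

Lemma sigmaC_1 w : sigmaC (tpure 1 w) = tpure w 1.
Proof.
have ext := dA_ext s0 s2 q_nroot hA hnu0 hGam.
move: w; apply: ext => [w w'|w w'|a b].
- by rewrite tpureDr sigmaCD.
- exact: tpureDl.
rewrite -(sigmaC_right _ (a, dA b)) /= mul1r sigmaC_dA -(iCM iT pi) !defect_iC.
rewrite rC_pure mul1r -[iC b]mulr1 -[iC b * 1]/(algl iC b 1) -tpureA -tpureBl.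
by rewrite (rmZ hGam) /dA scalerBr scalerA.
Qed.

Lemma sigmaC_iC a x w : sigmaC (tpure (iC a * x) w) = a *: sigmaC (tpure x w).
Proof.
case: hsigmaC => _ sZ _ _; rewrite -[RHS]sZ; congr sigmaC.
symmetry; apply: tlift_pure.
split=> [y y' z|y z z'|y b z].
- by rewrite /algl mulrDr tpureDl.
- exact: tpureDr.
by rewrite -tpureA /algl /algr mulrA.
Qed.

(** [P] is stable under multiplication by a form, but a priori not by an element
    of [A], whence the normal form [W]. *)
Lemma nablaCE x : nablaC x = tpure theta x - sigmaC (tpure x theta).
Proof.
pose P (x : Cl) := defect x = sigmaC (tpure x theta).
suff : P x by rewrite /P => <-; rewrite /defect opprB addrC subrK.
pose W (y : Cl) := exists a n (rho : 'I_n -> Gam) (z : 'I_n -> Cl),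
  (forall k, P (z k)) /\ y = iC a + \sum_k jC (rho k) * z k.
have Wc a : W (iC a).
  exists a, 0, (fun=> 0), (fun=> 0); split=> [[]//|].
  by rewrite big_ord0 addr0.
have WP y : W y -> P y.
  move=> [a [n [rho [z [Pz ->]]]]]; rewrite /P defectD (morphD_sum defectD).
  rewrite tpureDl sigmaCD tpure_suml (morphD_sum sigmaCD); congr (_ + _).
    by rewrite defect_iC -[iC a]mulr1 sigmaC_iC sigmaC_1 GT_scale_pure.
  by apply: eq_bigr => k _; rewrite defect_jC sigmaC_jC Pz.
have WD y y' : W y -> W y' -> W (y + y').
  move=> [a [n [rho [z [Pz ->]]]]] [a' [n' [rho' [z' [Pz' ->]]]]].
  exists (a + a'), (n + n')%N,
    (fun k => match split k with inl i => rho i | inr j => rho' j end),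
    (fun k => match split k with inl i => z i | inr j => z' j end).
  split=> [k|]; first by case: (split k).
  rewrite big_split_ord (iCD iT pi) addrACA; congr (_ + (_ + _));
    apply: eq_bigr => k _; first by rewrite (unsplitK (inl k)).
  by rewrite (unsplitK (inr k)).
have Wl a y : W y -> W (iC a * y).
  move=> [b [n [rho [z [Pz ->]]]]].
  exists (a * b), n, (fun k => a *: rho k), z; split=> //.
  rewrite mulrDr (iCM iT pi) mulr_sumr; congr (_ + _); apply: eq_bigr => k _.
  by case: bimodC => _ -> _; rewrite mulrA.
have Wj rho y : W y -> W (jC rho * y).
  move=> /WP Py; exists 0, 1, (fun=> rho), (fun=> y); split=> //.
  by rewrite big_ord1 (morphD0 (iCD iT pi)) add0r.
suff Wx y : W y -> W (x * y).
  by apply: WP; rewrite -[x]mulr1 -(iC1 iT pi); apply: Wx.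
have [t <-] := pi_onto x; move: t y; apply: (tensor_algebra_ind hT).
- split=> [y|t t' Wt Wt' y Wy|t t' Wt Wt' y Wy|c t Wt y Wy].
  + by rewrite rmorph1 mul1r.
  + by rewrite linearD mulrDl; apply: (WD); [exact: Wt|exact: Wt'].
  + by rewrite rmorphM -mulrA; apply/Wt/Wt'.
  rewrite linearZZ -scalerAl -[_ * _]mul1r scalerAl -(iC_scalar iT pi).
  exact/Wl/Wt.
- by move=> a y; exact: Wl.
by move=> rho y; exact: Wj.
Qed.

End Connection.

(** * The connection on the spinors *)

Section Spinors.
Variables (K : fieldType) (q s c1 : K).
Hypotheses (s0 : s != 0) (s2 : s ^+ 2 = q).
Hypothesis q_nroot : forall n : nat, (0 < n)%N -> q ^+ n != 1.
Hypothesis c1_neq0 : c1 != 0.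
Variables (A : algType K) (u : I -> I -> A).
Hypothesis hA : is_OSLq2 q s u.
Variables (nu0 : K).
Hypothesis hnu0 : nu0 = 1 \/ nu0 = -1.
Variables (Gam : lmodType A) (th : I -> I -> Gam) (rm : Gam -> A -> Gam).
Hypothesis hGam : is_4Dcalc s u th rm nu0.
Notation pr := (I * I)%type.
Notation th' := (thp th).
Notation coef := (coef hGam).
Notation GG := (GT (@lsc K A Gam) hGam).
Notation th2 := (th2 th rm : idx4 -> GG).
Notation theta := (theta q s th).
Variables (sigma : GG -> GG) (g : GG -> A).
Hypothesis hsigma : is_sigma s th sigma.
Hypothesis hg : is_metric_g s th c1 g.
Variables (T : algType K) (iT : {lrmorphism A -> T}) (jT : Gam -> T).
Hypothesis hT : is_tensor_algebra rm iT jT.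
Variables (Cl : algType K) (pi : {lrmorphism T -> Cl}).
Hypothesis hCl : is_clifford iT jT sigma g pi.
Notation iC := (iC iT pi).
Notation jC := (jC jT pi).
Notation psi := (psi q th jT pi c1).
Notation spin := (spin q s c1).
Notation kap := (kap q c1).
Notation J := (bool * I)%type.
Notation tht p := (jC (th' p)).
Notation S0 := (S0 q th jT pi c1).
Notation S0l := (@S0l K q A Gam th T iT jT Cl pi c1).
Notation S0r := (@S0r K q A Gam th T iT jT Cl pi c1).
Notation psiS := (psiS q th jT pi c1).

Lemma S0_eq (x y : S0) : lval x = lval y -> x = y.
Proof. exact: val_inj. Qed.
Lemma lvalD : {morph (@lval _ _ psi) : x y / x + y}. Proof. by []. Qed.
Lemma lval_sum (X : Type) (r : seq X) (f : X -> S0) :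
  lval (\sum_(x <- r) f x) = \sum_(x <- r) lval (f x).
Proof. exact: (morphD_sum lvalD). Qed.
Lemma lactDl (phi : S0) : {morph (fun x : Cl => @lact _ _ psi x phi) : x y / x + y}.
Proof. by move=> x y; apply: S0_eq; rewrite /= mulrDl. Qed.
Lemma lactDr (x : Cl) : {morph (@lact _ _ psi x) : phi phi' / phi + phi'}.
Proof. by move=> phi phi'; apply: S0_eq; rewrite /= mulrDr. Qed.
Lemma lactM x y (phi : S0) : lact (x * y) phi = lact x (lact y phi).
Proof. by apply: S0_eq; rewrite /= mulrA. Qed.
Lemma lact1 (phi : S0) : lact 1 phi = phi.
Proof. by apply: S0_eq; rewrite /= mul1r. Qed.

(** The argument [iT], which [S0] does not mention, lets the action of [A] be
    inferred. *)
Definition S0m (_ : {lrmorphism A -> T}) : Type := S0.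
HB.instance Definition _ := GRing.Zmodule.on (S0m iT).

Fact S0l_A a b phi : S0l a (S0l b phi) = S0l (a * b) phi.
Proof. by rewrite /Defs.S0l -lactM iCM. Qed.
Fact S0l_1 : left_id 1 S0l.
Proof. by move=> phi; rewrite /Defs.S0l iC1 lact1. Qed.
Fact S0l_Dr : right_distributive S0l +%R.
Proof. by move=> a phi phi'; rewrite /Defs.S0l lactDr. Qed.
Fact S0l_Dl phi : {morph S0l^~ phi : a b / a + b}.
Proof. by move=> a b; rewrite /Defs.S0l iCD lactDl. Qed.
HB.instance Definition _ := GRing.Zmodule_isLmodule.Build A (S0m iT)
  S0l_A S0l_1 S0l_Dr S0l_Dl.

Notation M := (S0m iT).

Definition psJ (p : J) : M := psiS p.1 p.2.

Lemma lvalZ a (phi : M) : lval (a *: phi : S0) = iC a * lval phi. Proof. by []. Qed.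
Lemma lval_psJ p : lval (psJ p) = psi p. Proof. by case: p. Qed.

Fact S0_span (phi : M) : exists a : J -> A, phi = \sum_p a p *: psJ p.
Proof.
case: phi => x xP; have /asboolP[c xE] := xP.
have span p := Cl_psi_span s0 s2 q_nroot c1_neq0 hsigma hg hT hCl (c p) p.
have [a aE] := boolp.choice span.
exists (fun r => \sum_p a p r); apply: S0_eq.
rewrite /= xE lval_sum; under eq_bigr do rewrite aE.
rewrite exchange_big; apply: eq_bigr => r _.
by rewrite -[RHS]/(lval _) lvalZ lval_psJ (morphD_sum (iCD iT pi)) mulr_suml.
Qed.

Definition sc (phi : M) : J -> A := projT1 (cid (S0_span phi)).

Lemma scE phi : phi = \sum_p sc phi p *: psJ p.
Proof. exact: (projT2 (cid (S0_span phi))). Qed.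

Lemma sc_sum (a : J -> A) p : sc (\sum_p a p *: psJ p) p = a p.
Proof.
apply/eqP; rewrite -subr_eq0; apply/eqP.
pose b p := sc (\sum_p a p *: psJ p) p - a p.
apply: (psi_free s0 s2 q_nroot c1_neq0 hA hnu0 hsigma hg hT hCl (a := b)).
have : \sum_p b p *: psJ p = 0.
  by under eq_bigr do rewrite scalerBl; rewrite sumrB -scE subrr.
move/(congr1 (@lval _ _ psi)) => e; transitivity (lval (0 : S0)) => //.
by rewrite -e lval_sum; apply: eq_bigr => r _; rewrite lvalZ lval_psJ.
Qed.

Lemma scD p : {morph sc^~ p : x y / x + y}.
Proof.
move=> x y /=; rewrite [in LHS](scE x) [in LHS](scE y) -big_split /=.
by under eq_bigr do rewrite -scalerDl; rewrite (sc_sum (fun p => _ + _)).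
Qed.

Lemma scZ a x p : sc (a *: x) p = a * sc x p.
Proof.
rewrite [in LHS](scE x) scaler_sumr.
by under eq_bigr do rewrite scalerA; rewrite (sc_sum (fun p => _ * _)).
Qed.

Lemma sc_psJ p r : sc (psJ p) r = (p == r)%:R.
Proof.
rewrite -(sc_sum (fun r => (p == r)%:R) r); congr (sc _ r).
rewrite (bigD1 p) //= eqxx scale1r big1 ?addr0 // => r' ne.
by rewrite eq_sym (negPf ne) scale0r.
Qed.

(** By [S0r_val] the right action is multiplication in [Cl]. *)
Let Sr_val := S0r_val s0 s2 hA hnu0 hsigma hg hT hCl.

Lemma S0rDl a : {morph S0r^~ a : x y / x + y}.
Proof. by move=> x y; apply: S0_eq; rewrite lvalD !Sr_val mulrDl. Qed.
Lemma S0rDr x : {morph S0r x : a b / a + b}.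
Proof. by move=> a b; apply: S0_eq; rewrite lvalD !Sr_val iCD mulrDr. Qed.
Lemma S0rM x a b : S0r x (a * b) = S0r (S0r x a) b.
Proof. by apply: S0_eq; rewrite !Sr_val iCM mulrA. Qed.
Lemma S0rZ a (x : M) b : S0r (a *: x : M) b = a *: (S0r x b : M).
Proof. by apply: S0_eq; rewrite lvalZ !Sr_val lvalZ mulrA. Qed.
Lemma S0r_scalar (x : M) c : S0r x c%:A = c%:A *: x.
Proof.
by apply: S0_eq; rewrite lvalZ Sr_val !iC_scalar -scalerAl -scalerAr mulr1 mul1r.
Qed.

Definition cact (x : Gam) (phi : M) : M := lact (jC x) phi.

Lemma cact_action : gamma_action rm S0l cact.
Proof.
have [jD jl jr] := bimodC hT pi.
split=> [phi x y|x phi phi'|a x phi|x a phi]; rewrite /cact.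
- by rewrite jD lactDl.
- by rewrite lactDr.
- by rewrite jl lactM.
by rewrite jr lactM.
Qed.

Lemma cact_psJ p e m :
  cact (th' p) (psJ (e, m)) = \sum_n (spin e p m n)%:A *: psJ (~~ e, n).
Proof.
apply: S0_eq; rewrite lval_sum.
have -> : lval (cact (th' p) (psJ (e, m))) = tht p * psi (e, m) by [].
rewrite (tht_psi s0 s2 q_nroot c1_neq0 hsigma hg hT hCl).
by apply: eq_bigr => n _; rewrite lvalZ lval_psJ iC_scalar -scalerAl mul1r.
Qed.

Notation GS := (GT S0l hGam).

Definition tvec (e : bool) (v : I -> I -> I -> K) : GS :=
  \sum_x \sum_y \sum_z (v x y z)%:A *: (tpure (th x y) (psJ (e, z)) : GS).

Lemma tvec_sum (X : Type) (r : seq X) (c : X -> K) e (v : X -> I -> I -> I -> K) :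
  \sum_(j <- r) (c j)%:A *: tvec e (v j) =
  tvec e (fun x y z => \sum_(j <- r) c j * v j x y z).
Proof.
rewrite /tvec; under eq_bigr do rewrite scaler_sumr; rewrite exchange_big.
apply: eq_bigr => x _ /=; under eq_bigr do rewrite scaler_sumr; rewrite exchange_big.
apply: eq_bigr => y _ /=; under eq_bigr do rewrite scaler_sumr; rewrite exchange_big.
apply: eq_bigr => z _ /=; rewrite scaler_suml scaler_suml.
by apply: eq_bigr => j _; rewrite scalerA scalarM scalerA.
Qed.

Lemma tvec_sum1 (X : Type) (r : seq X) e (v : X -> I -> I -> I -> K) :
  \sum_(j <- r) tvec e (v j) = tvec e (fun x y z => \sum_(j <- r) v j x y z).
Proof.
have := tvec_sum r (fun=> 1) e v; under eq_bigr do rewrite !scale1r.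
move->; congr tvec; apply: funext => x; apply: funext => y; apply: funext => z.
by under eq_bigr do rewrite mul1r.
Qed.

Lemma tvecZ (c : K) e v : c%:A *: tvec e v = tvec e (fun x y z => c * v x y z).
Proof.
rewrite /tvec scaler_sumr; apply: eq_bigr => x _.
rewrite scaler_sumr; apply: eq_bigr => y _.
rewrite scaler_sumr; apply: eq_bigr => z _.
by rewrite scalerA scalarM scalerA.
Qed.

Variables (e e' : bool) (stilde : GG -> GG) (nu : K).
Hypothesis hstilde : is_GG_endo th (stilde_mx s e e') stilde.
Hypothesis hnu : nu = 1 \/ nu = -1.
Variable gamma : K.

Lemma nuK : nu * nu = 1. Proof. by case: hnu => ->; rewrite ?mulr1 // mulrNN mulr1. Qed.

(** The prescribed values of [tau] on the basis. *)
Definition tauc (p : J) (k : pr) : GS :=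
  if p.1 then
    \sum_r \sum_s' \sum_t \sum_l
      tpure ((gamma * q ^+ (k.1.+1 + k.2.+1) * Rh s s' t l k.2
              * Rsgn s e r l p.2 k.1)%:A *: th r s') (psJ (true, t))
  else
    \sum_r \sum_s' \sum_t \sum_l
      tpure ((nu * gamma * q ^+ (k.1.+1 + k.2.+1) * Rsgn s e' s' t l k.2
              * Rinv s r l p.2 k.1)%:A *: th r s') (psJ (false, t)).

Definition tau_fun (phi : M) (x : Gam) : GS :=
  \sum_p \sum_k sc (S0r phi (coef x k)) p *: tauc p k.

Fact tau_balanced : balanced S0r (@lsc K A Gam) tau_fun.
Proof.
have hDr := S0rDr.
have hDl := S0rDl.
split=> [x x' b|x b b'|x a b]; rewrite /tau_fun.
- rewrite -big_split; apply: eq_bigr => p _; rewrite -big_split.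
  by apply: eq_bigr => k _ /=; rewrite hDl scD scalerDl.
- rewrite -big_split; apply: eq_bigr => p _; rewrite -big_split.
  by apply: eq_bigr => k _ /=; rewrite coD hDr scD scalerDl.
apply: eq_bigr => p _; apply: eq_bigr => k _.
by rewrite /lsc coZ S0rM.
Qed.

Notation SG := (SG q th iT jT pi c1).

Definition tau (t : SG) : GS := tlift tau_fun t.

Lemma tau_pure phi x : tau (tpure phi x) = tau_fun phi x.
Proof. exact: tlift_pure tau_balanced. Qed.
Lemma tauD : {morph tau : t t' / t + t'}.
Proof. exact: tliftD tau_balanced. Qed.

Lemma tau_funZ a (phi : M) x : tau_fun (a *: phi : M) x = a *: tau_fun phi x.
Proof.
rewrite /tau_fun scaler_sumr; apply: eq_bigr => p _.
rewrite scaler_sumr; apply: eq_bigr => k _.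
by rewrite S0rZ scZ scalerA.
Qed.

Lemma tauZ a t : tau (tactl S0l a t) = a *: tau t.
Proof.
have bal : balanced S0r (@lsc K A Gam)
    (fun m n => tpure (S0l a m) n : tens S0r (@lsc K A Gam)).
  split=> [x x' b|x b b'|x c b].
  - by rewrite -[S0l a _]/(a *: (_ : M)) scalerDr tpureDl.
  - exact: tpureDr.
  rewrite -tpureA; congr tpure.
  exact/esym/S0rZ.
move: t; apply: tens_ext => [t t'|t t'|x b].
- by rewrite /tactl (tliftD bal) tauD.
- by rewrite tauD scalerDr.
by rewrite /tactl (tlift_pure _ _ bal) !tau_pure -tau_funZ.
Qed.

Lemma tau_fun_const phi x (c : pr -> K) : (forall k, coef x k = (c k)%:A) ->
  tau_fun phi x = \sum_p sc phi p *: \sum_k (c k)%:A *: tauc p k.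
Proof.
move=> xc; apply: eq_bigr => p _; rewrite scaler_sumr; apply: eq_bigr => k _.
rewrite xc S0r_scalar scZ scalerA.
by rewrite scalarM Mscalar.
Qed.

Lemma sum_sc_psJ (V : lmodType A) p (f : J -> V) :
  \sum_r sc (psJ p) r *: f r = f p.
Proof.
rewrite (bigD1 p) //= sc_psJ eqxx scale1r.
rewrite big1 ?addr0 // => r ne.
by rewrite sc_psJ eq_sym (negPf ne) scale0r.
Qed.

Lemma tau_psJ p k : tau (tpure (psJ p) (th' k)) = tauc p k.
Proof.
rewrite tau_pure (@tau_fun_const _ _ (fun r => (k == r)%:R)); last first.
  by move=> r; rewrite co_th scaler_nat.
rewrite sum_sc_psJ (bigD1 k) //= eqxx !scale1r big1 ?addr0 // => r ne.
by rewrite eq_sym (negPf ne) !scale0r.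
Qed.

Definition tauth (phi : M) : GS := tau (tpure phi theta).

Lemma tauthD : {morph tauth : x y / x + y}.
Proof. by move=> x y; rewrite /tauth tpureDl tauD. Qed.
Lemma tauthZ a phi : tauth (a *: phi) = a *: tauth phi.
Proof. by rewrite /tauth !tau_pure tau_funZ. Qed.

Lemma tauth_psJ p : tauth (psJ p) = \sum_k (tc q s k)%:A *: tauc p k.
Proof.
rewrite /tauth tau_pure (@tau_fun_const _ _ (tc q s)) ?sum_sc_psJ // => k.
exact: coef_theta.
Qed.

(** The diagram of [tau (psi_m (x) theta)]: as [theta] is a multiple of
    the cup, on which [q ^ (j + k)] is constantly [q ^ 3], the strand of [psi_m] is
    drawn across that cup; [tsc] collects the scalars. *)
Definition Top (b : bool) (v : I -> K) : I -> I -> I -> K :=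
  if b then p23 (Rh s) (p12 (Rsgn s e) (cup23 s v))
  else p23 (Rsgn s e') (p12 (Rinv s) (cup23 s v)).

Definition tsc (b : bool) : K :=
  (if b then gamma else nu * gamma) * (q ^+ 3 * s / (q - q^-1)).

Lemma taucE p k : tauc p k = tvec p.1 (fun r s' t =>
  \sum_l (if p.1 then gamma * q ^+ (k.1.+1 + k.2.+1) * Rh s s' t l k.2
              * Rsgn s e r l p.2 k.1
          else nu * gamma * q ^+ (k.1.+1 + k.2.+1) * Rsgn s e' s' t l k.2
              * Rinv s r l p.2 k.1)).
Proof.
case: p => -[] m; rewrite /tauc /tvec /=; do 3!(apply: eq_bigr => ? _);
  rewrite !scaler_suml; apply: eq_bigr => l _; rewrite -GT_scale_pure //.
Qed.

Lemma tauth_sum b (x : I -> K) :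
  \sum_n (x n)%:A *: tauth (psJ (b, n)) = (tsc b)%:A *: tvec b (Top b x).
Proof.
under eq_bigr do (rewrite tauth_psJ; under eq_bigr do rewrite taucE);
  rewrite /=.
under eq_bigr do rewrite tvec_sum.
rewrite tvec_sum tvecZ; congr tvec.
apply: funext => r; apply: funext => s'; apply: funext => t.
have h0 : q - q^-1 != 0 := qhat_neq0 s0 s2 q_nroot.
rewrite !sum2 !sum_pair !sum2 !(tcE s0 s2) ?mul0r ?add0r ?addr0 /=.
have e12 : (1 + 2)%N = 3%N by []. have e21 : (2 + 1)%N = 3%N by [].
have h1 : s ^+ 2 * s ^+ 2 - 1 != 0.
  by rewrite s2 -expr2 subr_eq0 q_nroot.
by rewrite /tsc /Top; case: (b); rewrite /p23 /p12 /cup23 !sum2 !(CcE s) e12 e21 -s2;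
  field; rewrite ?s0 ?h1.
Qed.

(** The diagrams of the spin matrices, on the last three of five strands. *)
Definition spcap (b : bool) (v : I -> I -> I -> I -> I -> K) : I -> I -> I -> K :=
  if b then fun r x n => - c34 s (b45 (Rinv s) v) r x n
  else fun r x n => - (kap * s) * c45 s v r x n.

Definition tens_delta (p : pr) (v : I -> I -> I -> K) : I -> I -> I -> I -> I -> K :=
  fun i j x y z => ((i, j) == p)%:R * v x y z.

Lemma sum_spin b (w : I -> I -> I -> K) n :
  \sum_a \sum_z w a.1 a.2 z * spin b a z n =
  if b then - \sum_x \sum_y Ch s x y * \sum_c \sum_d Rinv s y n c d * w x c d
  else - (kap * s) * \sum_x \sum_y Ch s x y * w n x y.
Proof.
rewrite sum_pair !sum2 /spin; case: b; rewrite ?sum2 /=; first by ring.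
by move: n; apply: ord2P; rewrite /= ?mulr1 ?mulr0; ring.
Qed.

Lemma st_delta p v r x a z :
  st1234 s e e' (tens_delta p v) r x a.1 a.2 z =
  \sum_y \sum_t stilde_mx s e e' ((r, x), a) (p, (y, t)) * v y t z.
Proof.
rewrite -mxact_stilde /mxact sum_pair (bigD1 p) //= [X in _ + X]big1 ?addr0.
  rewrite sum_pair; apply: eq_bigr => y _; apply: eq_bigr => t _.
  by case: a => a1 a2; case: (p) => p1 p2; rewrite /tens_delta eqxx mul1r.
move=> [p1 p2] /negPf ne; rewrite big1 // => -[y t] _.
by rewrite /tens_delta /= ne mul0r mulr0.
Qed.

Lemma spcapE b p v r x n :
  spcap b (st1234 s e e' (tens_delta p v)) r x n =
  \sum_y \sum_t \sum_z v y t z *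
    \sum_a stilde_mx s e e' ((r, x), a) (p, (y, t)) * spin b a z n.
Proof.
transitivity (\sum_a \sum_z
    st1234 s e e' (tens_delta p v) r x a.1 a.2 z * spin b a z n).
  rewrite (sum_spin b (fun a c z => st1234 s e e' (tens_delta p v) r x a c z)).
  by rewrite /spcap; case: (b).
under eq_bigr => a _ do under eq_bigr => z _ do rewrite st_delta mulr_suml.
under eq_bigr => a _ do rewrite exchange_big /=.
rewrite exchange_big; apply: eq_bigr => y _ /=.
under eq_bigr => a _ do under eq_bigr => z _ do rewrite mulr_suml.
under eq_bigr => a _ do rewrite exchange_big /=.
rewrite exchange_big; apply: eq_bigr => t _ /=.
rewrite exchange_big; apply: eq_bigr => z _ /=.
by rewrite mulr_sumr; apply: eq_bigr => a _; rewrite mulrAC mulrC.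
Qed.

Notation PhiC := (Phi (hGam := hGam) (N := Cl) (l := algl iC) stilde nu (mulact jC)).
Notation Phi := (Phi (hGam := hGam) (N := M) (l := S0l) stilde nu cact).
Let PD := PhiD s0 hA hnu0 nu hstilde cact_action.
Let PDl := PhiDl s0 hA hnu0 nu hstilde cact_action.
Let PZl := PhiZl s0 hA hnu0 nu hstilde cact_action.
Let PZr := PhiZr s0 hA hnu0 nu hstilde cact_action.
Let Ppure := Phi_pure s0 hA hnu0 nu hstilde cact_action.

Lemma PhiK rho (c : K) (t : GS) : Phi rho (c%:A *: t) = c%:A *: Phi rho t.
Proof. by rewrite PZr (rm_scalar hGam) PZl. Qed.

Lemma tpureK x (c : K) (phi : M) :
  (tpure x (c%:A *: phi) : GS) = c%:A *: (tpure x phi : GS).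
Proof.
by rewrite -[c%:A *: phi]/(S0l c%:A phi) -tpureA (rm_scalar hGam) GT_scale_pure.
Qed.

(** [Phi (th_p)] is the diagram of [stilde] with the cap of the spin matrix below
    its last strands. *)
Lemma Phi_tvec p b v :
  Phi (th' p) (tvec b v) =
  nu%:A *: tvec (~~ b) (spcap b (st1234 s e e' (tens_delta p v))).
Proof.
have stn_th x y : stn stilde nu (tpure (th' p) (th x y) : GG) =
    \sum_r \sum_a (nu * stilde_mx s e e' (r, a) (p, (x, y)))%:A *: th2 (r, a).
  case: hstilde => _ _ sth; rewrite /stn [stilde _](sth (p, (x, y))) scaler_sumr.
  rewrite sum_pair; apply: eq_bigr => r _; apply: eq_bigr => a _.
  by rewrite -GT_scaleE scalerA scalarM scalerA.
have term x y z : Phi (th' p) (tpure (th x y) (psJ (b, z))) =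
    tvec (~~ b) (fun r1 r2 n => \sum_a nu *
      (stilde_mx s e e' ((r1, r2), a) (p, (x, y)) * spin b a z n)).
  rewrite Ppure stn_th (morphD_sum (GGmulDl cact_action _)) sum_pair.
  apply: eq_bigr => r1 _; apply: eq_bigr => r2 _.
  rewrite (morphD_sum (GGmulDl cact_action _)).
  under [RHS]eq_bigr do rewrite !scaler_suml.
  rewrite [RHS]exchange_big; apply: eq_bigr => a _ /=.
  rewrite (GGmulZ cact_action) (GGmul_pure hGam cact_action) cact_psJ.
  rewrite tpure_sumr scaler_sumr; apply: eq_bigr => n _ /=.
  by rewrite tpureK scalerA scalarM scalerA mulrA.
rewrite /tvec (morphD_sum (PD _)).
under eq_bigr do (rewrite (morphD_sum (PD _)); under eq_bigr do
  (rewrite (morphD_sum (PD _)); under eq_bigr do rewrite PhiK term)).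
rewrite -/(tvec (~~ b) _) tvecZ.
under eq_bigr do (under eq_bigr do rewrite tvec_sum; rewrite tvec_sum1).
rewrite tvec_sum1; congr tvec.
apply: funext => r1; apply: funext => r2; apply: funext => n.
rewrite spcapE mulr_sumr; apply: eq_bigr => x _; rewrite mulr_sumr.
apply: eq_bigr => y _; rewrite mulr_sumr; apply: eq_bigr => z _.
by rewrite -mulr_sumr mulrCA.
Qed.

Lemma Top_scale b (c : K) v r x t : Top b (fun n => c * v n) r x t = c * Top b v r x t.
Proof.
by rewrite /Top; case: b; rewrite /p23 /p12 /cup23 !sum2; ring.
Qed.

Definition delta3 (p : pr) (m : I) : I -> I -> I -> K :=
  fun i j k => (((i, j) == p) && (k == m))%:R.

Lemma spin_true_delta p m n :
  spin true p m n = -1 * cap12 s (p23 (Rinv s) (delta3 p m)) n.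
Proof.
rewrite /spin /cap12 /p23 /delta3; case: p => i j; rewrite !sum2.
by move: i j m; do 3!apply: ord2P; rewrite /= ?mulr1 ?mulr0 ?addr0 ?add0r; ring.
Qed.

Lemma spin_false_delta p m n :
  spin false p m n = - (kap * s) * cap23 s (delta3 p m) n.
Proof.
rewrite /spin /cap23 /delta3; case: p => i j; rewrite !sum2.
by move: i j m n; do 4!apply: ord2P; rewrite /= ?mulr1 ?mulr0 ?addr0 ?add0r; ring.
Qed.

(** Both sides are diagrams: [tau_plus] for [b = true], [tau_minus] for
    [b = false].  The signs and the factors [kap] agree since [nu * nu = 1]. *)
Lemma tauth_cact_psJ p b m :
  tauth (cact (th' p) (psJ (b, m))) = Phi (th' p) (tauth (psJ (b, m))).
Proof.
pose d3 := delta3 p m.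
pose d1 : I -> K := fun n => (n == m)%:R.
have tb : tauth (psJ (b, m)) = (tsc b)%:A *: tvec b (Top b d1).
  rewrite -tauth_sum (bigD1 m) //= /d1 eqxx !scale1r big1 ?addr0 // => n ne.
  by rewrite (negPf ne) !scale0r.
rewrite tb PhiK Phi_tvec cact_psJ (morphD_sum tauthD).
under eq_bigr do rewrite tauthZ; rewrite tauth_sum !tvecZ; congr tvec.
apply: funext => r; apply: funext => x; apply: funext => t.
case: (b) @d1 tb => d1 tb.
- have dE : tens_delta p (Top true d1) = b45 (Rh s) (b34 (Rsgn s e) (u45 s d3)).
    apply: funext => i; apply: funext => j; apply: funext => y;
    apply: funext => z; apply: funext => w.
    rewrite /tens_delta /Top /d3 /delta3 /d1 /b45 /b34 /u45 /p23 /p12 /cup23.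
    by rewrite !sum2 -!mulnb !natrM; ring.
  have := congr1 (fun f => f r x t) (tau_plus s0 e e' d3).
  rewrite dE /spcap => ->.
  rewrite -/(Top false (cap12 s (p23 (Rinv s) d3))).
  have -> : spin true p m = (fun n => -1 * cap12 s (p23 (Rinv s) d3) n).
    by apply: funext => n; exact: spin_true_delta.
  by rewrite Top_scale /tsc /=; ring.
have dE : tens_delta p (Top false d1) =
    b45 (Rsgn s e') (b34 (Rinv s) (u45 s d3)).
  apply: funext => i; apply: funext => j; apply: funext => y;
  apply: funext => z; apply: funext => w.
  rewrite /tens_delta /Top /d3 /delta3 /d1 /b45 /b34 /u45 /p23 /p12 /cup23.
  by rewrite !sum2 -!mulnb !natrM; ring.
have := congr1 (fun f => f r x t) (tau_minus s0 e e' d3).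
rewrite dE /spcap => ->.
rewrite -/(Top true (cap23 s d3)).
have -> : spin false p m = (fun n => - (kap * s) * cap23 s d3 n).
  by apply: funext => n; exact: spin_false_delta.
rewrite Top_scale /tsc /= -[LHS]mul1r -nuK; ring.
Qed.

Variables (nablaT : T -> GT (algl iT) hGam).
Hypothesis hnablaT : is_nabla_T q s th jT stilde nu nablaT.
Notation GBC := (GT (algl iC) hGam).
Variables (nablaC : Cl -> GBC).
Hypothesis hnablaC : is_nabla_Cl nablaT nablaC.
Variables (sigmaC : BG Gam iC -> GBC).
Hypothesis hsigmaC : is_sigma_Cl q s th nablaC sigmaC.

Let pi_onto := hCl.1.
Let actC := mulact_action (bimodC hT pi).

Definition mS (t : GBC) (phi : M) : GS :=
  tmap (hGam := hGam) (N := Cl) (N' := M) (l := algl iC) S0l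
    (fun x => lact x (phi : S0)) t.

Let fD phi : {morph (fun x : Cl => @lact _ _ psi x phi : M) : x y / x + y}.
Proof. by move=> x y; apply: S0_eq; rewrite /= mulrDl. Qed.
Let fl phi a x : lact (algl iC a x) phi = S0l a (lact x phi : S0).
Proof. by rewrite /algl lactM. Qed.
Let fj phi x y : lact (mulact jC x y) phi = cact x (lact y phi).
Proof. by rewrite /mulact lactM. Qed.

Lemma mS_pure x y phi : mS (tpure x y) phi = tpure x (lact y phi).
Proof.
exact: (@tmap_pure _ _ _ _ _ _ _ _ hGam Cl M (algl iC) S0l _ (fD phi) (fl phi)).
Qed.
Lemma mSDl phi : {morph mS^~ phi : t t' / t + t'}.
Proof. exact: (tmapD (fD phi) (fl phi)). Qed.
Lemma mSZ a t phi : mS (a *: t) phi = a *: mS t phi.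
Proof. exact: (tmapZ (fD phi) (fl phi)). Qed.
Lemma mS_Phi rho t phi : mS (PhiC rho t) phi = Phi rho (mS t phi).
Proof. exact: (tmap_Phi s0 hA hnu0 nu hstilde actC cact_action (fD phi) (fl phi) (fj phi)). Qed.
Lemma mSDr t : {morph mS t : phi phi' / phi + phi'}.
Proof.
move=> phi phi'; move: t; apply: tens_ext => [t t'|t t'|x y].
- exact: mSDl.
- by rewrite !mSDl addrACA.
by rewrite !mS_pure lactDr tpureDr.
Qed.
Lemma mS_rC t a phi : mS (rC t a) phi = mS t (S0l a phi).
Proof.
move: t; apply: tens_ext => [t t'|t t'|x y].
- by rewrite rCD mSDl.
- exact: mSDl.
by rewrite rC_pure !mS_pure lactM.
Qed.

(** The second term of the Leibniz rule for [nablaS (x phi)]. *)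
Definition Sig (x : Cl) (t : GS) : GS :=
  tlift (fun rho phi => mS (sigmaC (tpure x rho)) phi) t.

Let sD : {morph sigmaC : t t' / t + t'}. Proof. by case: hsigmaC. Qed.

Fact Sig_balanced x : balanced rm S0l (fun rho phi => mS (sigmaC (tpure x rho)) phi).
Proof.
split=> [y y' phi|y phi phi'|y a phi].
- by rewrite tpureDr sD mSDl.
- exact: mSDr.
have bal : balanced (algr iC) (@lsc K A Gam)
    (fun m n => tpure m (rm n a) : tens (algr iC) (@lsc K A Gam)).
  split=> [m m' n|m n n'|m b n].
  - exact: tpureDl.
  - by rewrite (rmDl hGam) tpureDr.
  by rewrite /lsc (rmZ hGam) tpureA.
case: hsigmaC => _ _ sr _; rewrite -mS_rC -[rC _ _]sr /tactr.
by rewrite (tlift_pure _ _ bal).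
Qed.

Lemma Sig_pure x rho phi : Sig x (tpure rho phi) = mS (sigmaC (tpure x rho)) phi.
Proof. exact: tlift_pure (Sig_balanced x). Qed.
Lemma SigD x : {morph Sig x : t t' / t + t'}.
Proof. exact: tliftD (Sig_balanced x). Qed.

Lemma SigDl t : {morph Sig^~ t : x y / x + y}.
Proof.
move=> x y; move: t; apply: tens_ext => [t t'|t t'|rho phi].
- exact: SigD.
- by rewrite !SigD addrACA.
by rewrite !Sig_pure tpureDl sD mSDl.
Qed.

Lemma Sig_1 t : Sig 1 t = t.
Proof.
move: t; apply: (@tens_ext _ _ _ _ _ GS _ idfun) => // [t t'|rho phi].
  exact: SigD.
rewrite Sig_pure (sigmaC_1 s0 s2 q_nroot hA hnu0 hnablaT hnablaC hsigmaC).
by rewrite mS_pure lact1.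
Qed.

Lemma Sig_iC a x t : Sig (iC a * x) t = a *: Sig x t.
Proof.
move: t; apply: tens_ext => [t t'|t t'|rho phi].
- exact: SigD.
- by rewrite SigD scalerDr.
by rewrite !Sig_pure (sigmaC_iC hsigmaC) mSZ.
Qed.

Lemma Sig_jC rho x t : Sig (jC rho * x) t = Phi rho (Sig x t).
Proof.
move: t; apply: tens_ext => [t t'|t t'|w phi].
- exact: SigD.
- by rewrite SigD [LHS]PD.
rewrite !Sig_pure -mS_Phi; congr mS.
exact: (sigmaC_jC s0 s2 q_nroot hA hnu0 hstilde hT pi_onto hnablaT hnablaC hsigmaC).
Qed.

(** The coefficient of [psi_r] is moved into the form, which is then expanded in
    the [th_p]; thus [tauth_cact_psJ] suffices. *)
Lemma tauth_jC rho phi : tauth (lact (jC rho) phi) = Phi rho (tauth phi).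
Proof.
have [cDl cDr cZl cZr] := cact_action; rewrite -/M in cDl cDr cZl cZr.
pose P (rho : Gam) (phi : M) := tauth (cact rho phi) = Phi rho (tauth phi).
have PlD phi' x x' : P x phi' -> P x' phi' -> P (x + x') phi'.
  by rewrite /P cDl tauthD => -> ->; rewrite PDl.
have PlZ phi' a x : P x phi' -> P (a *: x) phi'.
  by rewrite /P cZl => e1; rewrite [LHS]tauthZ e1 PZl.
have Pl phi' : (forall p, P (th' p) phi') -> forall x, P x phi'.
  move=> Pp x; rewrite (coE hGam x); apply: (big_ind (P^~ phi')) => [|? ?|p _].
  - by rewrite /P (morphD0 (cDl _)) (morphD0 tauthD) (morphD0 (PDl _)).
  - exact: PlD.
  exact/PlZ/Pp.
rewrite -/(P rho phi); move: rho; apply: (Pl phi) => p.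
rewrite (scE phi).
apply: (big_ind (P (th' p))) => [|x y|r _].
- by rewrite /P (morphD0 (cDr _)) (morphD0 tauthD) (morphD0 (PD _)).
- by rewrite /P cDr tauthD => -> ->; rewrite tauthD PD.
rewrite /P tauthZ PZr -cZr.
move: (rm _ _); apply: (Pl (psJ r)).
case: r => b m p'.
exact: tauth_cact_psJ.
Qed.

(** That [Sig] is multiplicative is needed to pass from [x] and [y] to [x y] in
    the second statement, so both are proved together. *)
Lemma Sig_tauth x : (forall y t, Sig (x * y) t = Sig x (Sig y t)) /\
  forall phi, tauth (lact x phi) = Sig x (tauth phi).
Proof.
have [t <-] := pi_onto x; move: t; apply: (tensor_algebra_ind hT).
- split=> [|t t' [m1 n1] [m2 n2]|t t' [m1 n1] [m2 n2]|c t [m1 n1]].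
  + by rewrite rmorph1; split=> [y t|phi]; rewrite ?mul1r ?lact1 Sig_1.
  + rewrite linearD; split=> [y w|phi].
      by rewrite mulrDl !SigDl m1 m2.
    by rewrite lactDl tauthD SigDl n1 n2.
  + rewrite rmorphM; split=> [y w|phi]; first by rewrite -mulrA !m1 m2.
    by rewrite lactM n1 n2 m1.
  have -> : pi (c *: t) = iC c%:A * pi t.
    by rewrite linearZZ iC_scalar -!scalerAl mul1r.
  split=> [y w|phi]; first by rewrite -mulrA !Sig_iC m1.
  by rewrite lactM Sig_iC -n1; exact: tauthZ.
- move=> a; split=> [y w|phi]; first by rewrite Sig_iC -[pi _]mulr1 Sig_iC Sig_1.
  by rewrite -[pi _]mulr1 Sig_iC Sig_1 mulr1; exact: tauthZ.
move=> rho; split=> [y w|phi].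
  by rewrite Sig_jC -[pi _]mulr1 Sig_jC Sig_1.
by rewrite -[pi _]mulr1 Sig_jC Sig_1 mulr1; exact: tauth_jC.
Qed.

Definition nablaS (phi : M) : GS := tpure theta phi - tauth phi.

Lemma nablaS_connection : is_spin_connection nablaC sigmaC nablaS.
Proof.
split=> [phi phi'|c phi|x phi].
- by rewrite /nablaS tpureDr tauthD opprD addrACA.
- rewrite -[S0l _ _]/(c%:A *: (phi : M)) /nablaS tpureK tauthZ -(GT_scaleE (hGam := hGam)).
  exact/esym/(@scalerBr A GS).
rewrite -[GBmulS _ _]/(mS _ _) -[tlift _ _]/(Sig x _) /nablaS.
have [_ ->] := Sig_tauth x.
rewrite (morphDB (SigD x)) addrA; congr (_ - _).
rewrite (nablaCE s0 s2 q_nroot hA hnu0 hstilde hT pi_onto hnablaT hnablaC hsigmaC).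
by rewrite (morphDB (mSDl phi)) mS_pure Sig_pure subrK.
Qed.

Lemma inGS0_pure b rho phi : inS0 iT b phi -> inGS0 b (tpure rho phi : GS).
Proof.
by move=> h; exists 1, (fun=> rho), (fun=> phi); rewrite big_ord1.
Qed.

Lemma inGS0D b t t' : inGS0 b t -> inGS0 b t' -> inGS0 b (t + t' : GS).
Proof.
move=> [n [rho [z [Pz ->]]]] [n' [rho' [z' [Pz' ->]]]].
exists (n + n')%N,
  (fun k => match split k with inl i => rho i | inr j => rho' j end),
  (fun k => match split k with inl i => z i | inr j => z' j end).
split=> [k|]; first by case: (split k).
rewrite big_split_ord; congr (_ + _); apply: eq_bigr => k _.
  by rewrite (unsplitK (inl k)).
by rewrite (unsplitK (inr k)).
Qed.

Lemma inS0_psi b m : inS0 iT b (psJ (b, m)).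
Proof.
exists (fun n => (n == m)%:R); rewrite (bigD1 m) //= eqxx.
rewrite -[S0l _ _]/(_ *: (psJ (b, m) : M)) scale1r big1 ?addr0 // => n /negPf ne.
by rewrite ne -[S0l _ _]/(_ *: (psJ (b, n) : M)) scale0r.
Qed.

Lemma nablaS_inv b phi : inS0 iT b phi -> inGS0 b (nablaS phi).
Proof.
move=> hphi; apply: inGS0D; first exact: inGS0_pure.
have inN t : inGS0 b t -> inGS0 b (- t : GS).
  move=> [n [rho [z [Pz ->]]]]; exists n, (fun k => - rho k), z; split=> //.
  rewrite -sumrN; apply: eq_bigr => k _.
  apply/esym/(morphDN (f := fun x => tpure x (z k) : GS)) => x y.
  exact: tpureDl.
have in0 : inGS0 b (0 : GS).
  by exists 0, (fun=> 0), (fun=> 0); split=> [[]//|]; rewrite big_ord0.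
apply: inN; case: hphi => a ->.
rewrite (morphD_sum tauthD); apply: (big_ind (inGS0 b)) => // [|m _]; first exact: inGS0D.
rewrite -[S0l _ _]/(_ *: (psJ (b, m) : M)) tauthZ.
rewrite tauth_psJ.
rewrite scaler_sumr; apply: (big_ind (inGS0 b)) => // [|k _]; first exact: inGS0D.
rewrite taucE /= scalerA /tvec !scaler_sumr.
apply: (big_ind (inGS0 b)) => // [|r _]; first exact: inGS0D.
rewrite !scaler_sumr; apply: (big_ind (inGS0 b)) => // [|x _]; first exact: inGS0D.
rewrite !scaler_sumr; apply: (big_ind (inGS0 b)) => // [|y _]; first exact: inGS0D.
rewrite scalerA GT_scale_pure; apply: inGS0_pure; exact: inS0_psi.
Qed.

Lemma tau_is_tau (i : 'I_4) : eta_ i = e -> eta'_ i = e' -> is_tau s nu i gamma tau.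
Proof.
move=> ei ei'; split=> [||m j k|m j k].
- exact: tauD.
- move=> a t; rewrite -(GT_scaleE (hGam := hGam)); apply: tauZ.
- rewrite -[psiS true m]/(psJ (true, m)) -[th j k]/(th' (j, k)) tau_psJ /tauc /= -ei.
  by [].
rewrite -[psiS false m]/(psJ (false, m)) -[th j k]/(th' (j, k)) tau_psJ /tauc /= -ei'.
by [].
Qed.

Definition cmult (t : GS) : M := tlift cact t.

Fact cmult_balanced : balanced rm S0l cact.
Proof.
by case: cact_action => cDl cDr cZl cZr; split=> [x y phi|x y phi|x a phi];
  [exact: cDl|exact: cDr|exact: cZr].
Qed.

Lemma cmult_pure x phi : cmult (tpure x phi) = cact x phi.
Proof. exact: tlift_pure cmult_balanced. Qed.
Lemma cmultD : {morph cmult : t t' / t + t'}.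
Proof. exact: tliftD cmult_balanced. Qed.
Lemma cmultZ a t : cmult (a *: t) = a *: cmult t.
Proof.
move: t; apply: tens_ext => [t t'|t t'|x phi].
- by rewrite scalerDr cmultD.
- by rewrite cmultD scalerDr.
by rewrite GT_scale_pure !cmult_pure; case: cact_action => _ _ -> _.
Qed.

(** The diagrams of the spin matrices on three strands. *)
Definition tcap (b : bool) (v : I -> I -> I -> K) : I -> K :=
  if b then fun n => - cap12 s (p23 (Rinv s) v) n
  else fun n => - (kap * s) * cap23 s v n.

Lemma cmult_tvec b v :
  cmult (tvec b v) = \sum_n (tcap b v n)%:A *: psJ (~~ b, n).
Proof.
rewrite /tvec (morphD_sum cmultD).
under eq_bigr => x _ do (rewrite (morphD_sum cmultD); under eq_bigr => y _ do
  (rewrite (morphD_sum cmultD); under eq_bigr => z _ do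
   rewrite cmultZ cmult_pure -/(th' (x, y)) cact_psJ scaler_sumr)).
rewrite /=.
pose F n x y z := ((v x y z)%:A * (spin b (x, y) z n)%:A) *: psJ (~~ b, n).
transitivity (\sum_x \sum_y \sum_n \sum_z F n x y z).
  apply: eq_bigr => x _; apply: eq_bigr => y _. etransitivity; first exact: (@exchange_big M).
  by apply: eq_bigr => n _; apply: eq_bigr => z _; rewrite scalerA.
transitivity (\sum_x \sum_n \sum_y \sum_z F n x y z).
  by apply: eq_bigr => x _; exact: (@exchange_big M).
etransitivity; first exact: (@exchange_big M).
rewrite /F /=.
apply: eq_bigr => n _.
under eq_bigr do under eq_bigr do rewrite -scaler_suml.
under eq_bigr do rewrite -scaler_suml; rewrite -scaler_suml; congr (_ *: _).
under eq_bigr do under eq_bigr do under eq_bigr do rewrite scalarM scalerA.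
under eq_bigr do under eq_bigr do rewrite -scaler_suml.
under eq_bigr do rewrite -scaler_suml; rewrite -scaler_suml; congr (_ *: _).
rewrite /tcap /spin !sum2 /=; case: (b).
  rewrite /cap12 /p23 !sum2; ring.
by move: n; apply: ord2P; rewrite /cap23 !sum2 /=; ring.
Qed.

Lemma cap_twist23 b (v : I -> I -> I -> K) x :
  cap23 s (p23 (Rsgn s b) v) x = - (if b then s^-1 ^+ 3 else s ^+ 3) * cap23 s v x.
Proof.
rewrite /cap23 /p23 !sum2; case: b; rewrite /Rsgn !(RE s0); field; exact: s0.
Qed.

Lemma p23_RinvK (v : I -> I -> I -> K) : p23 (Rinv s) (p23 (Rh s) v) = v.
Proof.
apply: funext => x; apply: funext => y; apply: funext => z.
move: y z; do 2!apply: ord2P; rewrite /p23 !sum2 !(RE s0); field; exact: s0.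
Qed.

Definition twist (b : bool) : K := if b then s^-1 ^+ 3 else s ^+ 3.

Definition tth (b : bool) : K :=
  if b then q^-1 / (q - q^-1) else - (q * kap / (q - q^-1)).

(** The scalar by which [m (tau (psi (x) theta))] differs from the spinor of the
    other sign. *)
Definition lam (b : bool) : K :=
  if b then gamma * (q ^+ 3 * s / (q - q^-1) * twist e)
  else - (nu * gamma * (kap * (q ^+ 2 * s / (q - q^-1)) * twist e')).

(** For [b = true] the spin matrix undoes the outer crossing of [Top] and leaves a
    curl and a zigzag; for [b = false] it leaves a curl and a partial trace. *)
Lemma cmult_tauth b m : cmult (tauth (psJ (b, m))) = (lam b)%:A *: psJ (~~ b, m).
Proof.
pose d n : K := (n == m)%:R.
have -> : tauth (psJ (b, m)) = (tsc b)%:A *: tvec b (Top b d).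
  rewrite -tauth_sum (bigD1 m) //= /d eqxx !scale1r big1 ?addr0 // => n ne.
  by rewrite (negPf ne) !scale0r.
rewrite cmultZ cmult_tvec (bigD1 m) //= big1 ?addr0 => [|n ne].
  rewrite scalerA scalarM scalerA; congr (_%:A *: _).
  rewrite /tcap /Top /tsc /lam; case: (b).
    rewrite p23_RinvK cap_twist // zigzag // /d eqxx mulr1.
    by rewrite /twist; case: (e); ring.
  rewrite cap_twist23 partial_trace // /d eqxx mulr1 -s2.
  have h1 : s ^+ 2 * s ^+ 2 - 1 != 0 by rewrite s2 -expr2 subr_eq0 q_nroot.
  by rewrite /twist; case: (e'); field; rewrite ?s0 ?h1.
rewrite [X in X%:A](_ : _ = 0) ?scale0r ?scaler0 //.
rewrite /tcap /Top; case: (b).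
  by rewrite p23_RinvK cap_twist // zigzag // /d (negPf ne) !mulr0 oppr0.
by rewrite cap_twist23 partial_trace // /d (negPf ne) !mulr0.
Qed.

Lemma cact_theta b m : cact theta (psJ (b, m)) = (tth b)%:A *: psJ (~~ b, m).
Proof.
have [cDl _ cZl _] := cact_action.
have cZ a x (phi : M) : cact (a *: x) phi = a *: cact x phi := cZl a x phi.
rewrite (thetaE q s th) (morphD_sum (cDl _)).
under eq_bigr do rewrite cZ cact_psJ scaler_sumr.
transitivity (\sum_n (\sum_p tc q s p * spin b p m n)%:A *: psJ (~~ b, n)).
  etransitivity; first exact: (@exchange_big M).
  apply: eq_bigr => n _; rewrite !scaler_suml; apply: eq_bigr => p _.
  by rewrite scalerA scalarM scalerA.
have h0 : q - q^-1 != 0 := qhat_neq0 s0 s2 q_nroot.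
have q0 : q != 0 by rewrite -s2 expf_neq0.
have h1 : q * q - 1 != 0 by rewrite -expr2 subr_eq0 q_nroot.
have tcs n : \sum_p tc q s p * spin b p m n = tth b * (n == m)%:R.
  rewrite sum_pair !sum2 !(tcE s0 s2) /tth; move: m n; do 2!apply: ord2P;
    by case: (b); rewrite !(spinE c1 s0 s2) /=; field; rewrite ?q0 ?h1.
under eq_bigr do rewrite tcs.
rewrite (bigD1 m) //= eqxx mulr1 big1 ?addr0 // => n /negPf ->.
by rewrite mulr0 !scale0r.
Qed.

Lemma dirac_psi a b m :
  dirac nablaS (a *: psJ (b, m)) =
  cact theta (a *: psJ (b, m)) - (a * (lam b)%:A) *: psJ (~~ b, m).
Proof.
rewrite -[dirac _ _]/(cmult _) /nablaS (morphDB cmultD) cmult_pure.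
rewrite tauthZ.
by rewrite cmultZ cmult_tauth scalerA.
Qed.

Lemma sc_dirac m :
  sc (dirac nablaS (psJ (true, m))) (false, m) = (tth true - lam true)%:A.
Proof.
rewrite -[psJ _]scale1r dirac_psi scale1r mul1r cact_theta -scalerBl -scalerBl /=.
rewrite scZ.
by rewrite sc_psJ eqxx mulr1.
Qed.

End Spinors.

(** * Adjoints for the Haar functional *)

Section HaarAdjoint.
Variables (K : fieldType) (q s : K).
Variables (A : algType K) (u : I -> I -> A).
Hypothesis hA : is_OSLq2 q s u.
Variables (nu0 : K).
Variables (Gam : lmodType A) (th : I -> I -> Gam) (rm : Gam -> A -> Gam).
Hypothesis hGam : is_4Dcalc s u th rm nu0.
Notation pr := (I * I)%type.
Notation Fm := (Fm hGam).
Notation AAl := (fun (x : A) (c : K) => c *: x).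
Notation AAr := (fun (c : K) (y : A) => c *: y).
Notation AA := (tens AAl AAr).

Lemma counit_exists : exists f : {lrmorphism A -> K^o}, forall i j, f (u i j) = (i == j)%:R.
Proof.
pose b (i j : I) : K^o := (i == j)%:R.
have relb : SLq2_rel q s b.
  split=> [i j m n|].
    have pick (F : I -> I -> K) : \sum_k \sum_l F k l *: (b k m * b l n : K^o) = F m n.
      rewrite (bigD1 m) //= (bigD1 n) //= /b !eqxx mulr1 -[_ *: _]/(_ * _) mulr1.
      rewrite !big1 ?addr0 // => k /negPf ne; last first.
        by rewrite ne mulr0 scaler0.
      by rewrite big1 // => l _; rewrite ne mul0r scaler0.
    rewrite pick.
    have pick' (F : I -> I -> K) : \sum_k \sum_l F k l *: (b i k * b j l : K^o) = F i j.
      rewrite (bigD1 i) //= (bigD1 j) //= /b !eqxx mulr1 -[_ *: _]/(_ * _) mulr1.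
      rewrite !big1 ?addr0 // => k; rewrite eq_sym => /negPf ne; last first.
        by rewrite ne mulr0 scaler0.
      by rewrite big1 // => l _; rewrite ne mul0r scaler0.
    by rewrite pick'.
  by rewrite /b /= mulr0 scaler0 subr0 mulr1.
have [f [fE _]] := hA.2 _ b relb.
by exists f.
Qed.

Variables (Delta : A -> AA) (h : A -> K).
Hypotheses (hDelta : is_comult u Delta) (hh : is_haar Delta h).

Section Counit.
Variable eps : {lrmorphism A -> K^o}.
Hypothesis epsE : forall i j, eps (u i j) = (i == j)%:R.

Definition bil (f : A -> K) (t : AA) : A := tlift (fun x y => f y *: x) t.

Fact bil_balanced (f : {linear A -> K^o}) :
  balanced AAl AAr (fun x y => f y *: x).
Proof.
split=> [x x' y|x y y'|x c y]; first by rewrite scalerDr.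
  by rewrite linearD scalerDl.
by rewrite scalerA [f (c *: y)]linearZ mulrC.
Qed.

Definition Fe p r : A -> K^o := eps \o Fm p r.
Fact Fe_linear p r : linear (Fe p r).
Proof. by move=> c x y; rewrite /Fe /= FD FZ linearP. Qed.
HB.instance Definition _ p r := GRing.isLinear.Build K A K^o _ (Fe p r) (Fe_linear p r).

Lemma bil_pure p r x y : bil (Fe p r) (tpure x y) = Fe p r y *: x.
Proof. exact: tlift_pure (bil_balanced _). Qed.
Lemma bilD p r : {morph bil (Fe p r) : t t' / t + t'}.
Proof. exact: tliftD (bil_balanced _). Qed.

Lemma Fe_M p r a b : Fe p r (a * b) = \sum_k Fe p k a * Fe k r b.
Proof.
rewrite /Fe /= FM linear_sum; apply: eq_bigr => k _; exact: rmorphM.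
Qed.

Lemma AA_mul_balanced x y : balanced AAl AAr
  (fun x' y' => tpure (x * x') (y * y') : AA).
Proof.
split=> [a a' b|a b b'|a c b].
- by rewrite mulrDr tpureDl.
- by rewrite mulrDr tpureDr.
by rewrite -!scalerAr tpureA.
Qed.

Lemma AA_mul_balanced2 t : balanced AAl AAr
  (fun x y => @tlift _ _ _ AAl AAr AA (fun x' y' => tpure (x * x') (y * y')) t).
Proof.
split=> [a a' b|a b b'|a c b]; move: t; apply: tens_ext.
all: try by move=> t t'; rewrite ?(tliftD (AA_mul_balanced _ _)) // addrACA.
- by move=> x y; rewrite !(tlift_pure _ _ (AA_mul_balanced _ _)) mulrDl tpureDl.
- by move=> x y; rewrite !(tlift_pure _ _ (AA_mul_balanced _ _)) mulrDl tpureDr.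
by move=> x y; rewrite !(tlift_pure _ _ (AA_mul_balanced _ _)) -!scalerAl tpureA.
Qed.

Lemma bil_mul p r t t' :
  bil (Fe p r) (AA_mul t t') = \sum_k bil (Fe p k) t * bil (Fe k r) t'.
Proof.
move: t; apply: tens_ext.
- by move=> t1 t2; rewrite /AA_mul (tliftD (AA_mul_balanced2 _)) bilD.
- move=> t1 t2; rewrite -big_split; apply: eq_bigr => k _ /=.
  by rewrite bilD mulrDl.
move=> x y; rewrite /AA_mul (tlift_pure _ _ (AA_mul_balanced2 _)).
move: t'; apply: tens_ext.
- by move=> t1 t2; rewrite (tliftD (AA_mul_balanced _ _)) bilD.
- move=> t1 t2; rewrite -big_split; apply: eq_bigr => k _ /=.
  by rewrite bilD mulrDr.
move=> x' y'; rewrite (tlift_pure _ _ (AA_mul_balanced _ _)) bil_pure Fe_M.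
rewrite scaler_suml; apply: eq_bigr => k _; rewrite !bil_pure.
by rewrite -scalerAl -scalerAr scalerA.
Qed.

(** On the generators this is [F_u]; both sides are multiplicative as matrices. *)
Lemma Fm_convolution a : forall p r, Fm p r a = bil (Fe p r) (Delta a).
Proof.
have [DD D1 DZ DM Du] := hDelta.
move: a; apply: (OSLq2_ind hA); last first.
  move=> k l p r; rewrite F_u Du (morphD_sum (@bilD p r)); apply: eq_bigr => m _.
  rewrite bil_pure /Fe /= F_u linear_sum /= (bigD1 m) //= big1 ?addr0.
    by rewrite linearZ /= epsE eqxx -[_ *: 1]/(_ * _) mulr1.
  by move=> n ne; rewrite linearZ /= epsE eq_sym (negPf ne) scaler0.
have F1' p r : bil (Fe p r) (tpure 1 1) = Fm p r 1.
  by rewrite bil_pure /Fe /= F1 rmorph_nat scaler_nat.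
have bM a b : (forall p r, Fm p r a = bil (Fe p r) (Delta a)) ->
    (forall p r, Fm p r b = bil (Fe p r) (Delta b)) ->
    forall p r, Fm p r (a * b) = bil (Fe p r) (AA_mul (Delta a) (Delta b)).
  by move=> ha hb p r; rewrite bil_mul FM; apply: eq_bigr => k _; rewrite ha hb.
split=> [p r|a b ha hb p r|a b ha hb p r|c a ha p r].
- by rewrite D1 F1'.
- by rewrite DD bilD FD ha hb.
- by rewrite DM bM.
rewrite DZ FZ bil_mul (bigD1 p) //= big1 ?addr0; last first.
  move=> k ne; rewrite bil_pure /Fe /= F1 eq_sym (negPf ne) linear0 scale0r.
  by rewrite mul0r.
by rewrite bil_pure /Fe /= F1 eqxx rmorph1 scale1r -scalerAl mul1r ha.
Qed.

End Counit.

Lemma hD : {morph h : a b / a + b}. Proof. by case: hh. Qed.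
Lemma hZ c a : h (c *: a) = c * h a. Proof. by case: hh. Qed.

(** By [Fm_convolution], applying [h] leaves the counit of [Fm p r 1]. *)
Lemma haar_Fm p r a : h (Fm p r a) = (p == r)%:R * h a.
Proof.
have [eps epsE] := counit_exists.
rewrite (Fm_convolution epsE).
have hl : linear (h : A -> K^o) by move=> c x y; rewrite hD hZ.
have balh : balanced AAl AAr (fun x y => h x *: y).
  split=> [x x' y|x y y'|x c y]; first by rewrite hD scalerDl.
    by rewrite scalerDr.
  by rewrite hZ scalerA mulrC.
have e : forall t, h (bil (Fe eps p r) t) = Fe eps p r (tlift (fun x y => h x *: y) t).
  apply: tens_ext.
  - by move=> t t'; rewrite bilD hD.
  - by move=> t t'; rewrite (tliftD balh) linearD.
  by move=> x y; rewrite bil_pure hZ (tlift_pure _ _ balh) linearZ /= mulrC.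
rewrite e; case: hh => _ _ _ _ ->.
by rewrite linearZ /= /Fe /= F1 rmorph_nat mulrC.
Qed.

(** [N p r c] is replaced by the sum of the hypothesis; the product
    [Fm p k a * Fm k j x] is then an entry of [Fm] at [a * x], where [h] is known. *)
Lemma haar_adjoint (H : pr -> pr -> A -> A) (N : pr -> pr -> K) :
  (forall c p r, \sum_k Fm p k (\sum_a N k a *: H a r c) = N p r *: c) ->
  forall a c p r,
  \sum_k N k r * h (Fm p k a * c) = \sum_b N p b * h (a * H b r c).
Proof.
move=> NH a c p r.
have hs (J : finType) (f : J -> A) : h (\sum_j f j) = \sum_j h (f j).
  by exact: (morphD_sum hD).
under eq_bigr => k _ do rewrite -hZ scalerAr -(NH c k r) mulr_sumr hs.
rewrite exchange_big /=.
under eq_bigr => k _ do rewrite -hs -FM haar_Fm.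
rewrite (bigD1 p) //= eqxx mul1r [X in _ + X]big1 ?addr0 => [|k ne].
  rewrite mulr_sumr hs; apply: eq_bigr => b _.
  by rewrite -scalerAr hZ.
by rewrite eq_sym (negPf ne) mul0r.
Qed.

End HaarAdjoint.

(** * The three involutions *)

Section StarMatrices.
Variable (K : numClosedFieldType).
Notation pr := (I * I)%type.

(** [fmx] depends on [q] only, not on the choice of its square root. *)
Lemma fmxN (s : K) p r m l : fmx (- s) p r m l = fmx s p r m l.
Proof.
by rewrite /fmx !sum2 /Rh /Rinv /Ch /Cc invrN !mulNrn; ring.
Qed.

Lemma fmx_sq (s t : K) : s ^+ 2 = t ^+ 2 -> forall p r m l, fmx s p r m l = fmx t p r m l.
Proof.
by move=> /eqP; rewrite eqf_sqr => /orP[] /eqP -> // p r m l; rewrite fmxN.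
Qed.

Lemma fmx_conj (s : K) p r m l : (fmx s p r m l)^* = fmx s^* p r m l.
Proof.
rewrite /fmx rmorph_sum; apply: eq_bigr => t _ /=.
by rewrite rmorphM /Rh /Rinv /Ch /Cc !(rmorphD, rmorphB, rmorphN, rmorphM, rmorphMn) /= !fmorphV.
Qed.

Variables (q s : K).
Hypotheses (s0 : s != 0) (s2 : s ^+ 2 = q).

Definition flip (i : I) : I := if i == i1 then i2 else i1.
Definition ksign (k : star_kind) : K := if k is Dagger then -1 else 1.

(** The matrix of [Hm] on the generators, see [Hm_u]. *)
Definition hmx (k : star_kind) (a r : pr) (m l : I) : K :=
  if k is Sharp then fmx s^-1 a r m l
  else (if m == l then 1 else if l == i1 then ksign k * q^-1 else ksign k * q)
       * fmx s a r (flip m) (flip l).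

(** The matrix that relates [Fm] to its conjugate by the involution of kind [k],
    see [Nmx_Hm]; [tc_Nmx] fixes its scale. *)
Definition Nmx (k : star_kind) (p a : pr) : K :=
  let d i j := ((a.1 == i) && (a.2 == j))%:R in
  if k is Sharp then
    if p.1 == i1 then
      if p.2 == i1 then - q^-1 * d i1 i1
      else - d i1 i2 - (q - q^-1) * d i2 i1
    else if p.2 == i1 then - d i2 i1 else - q ^+ 3 * d i2 i2
  else
    if p.1 == i1 then
      if p.2 == i1 then ksign k * q^-1 ^+ 3 * d i2 i2 else d i1 i2
    else if p.2 == i1 then d i2 i1 else ksign k * q ^+ 3 * d i1 i1.

Lemma Nmx_sum_sharp (f : pr -> K) :
  (\sum_a Nmx Sharp (i1, i1) a * f a = - q^-1 * f (i1, i1)) *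
  (\sum_a Nmx Sharp (i1, i2) a * f a = - f (i1, i2) - (q - q^-1) * f (i2, i1)) *
  (\sum_a Nmx Sharp (i2, i1) a * f a = - f (i2, i1)) *
  (\sum_a Nmx Sharp (i2, i2) a * f a = - q ^+ 3 * f (i2, i2)).
Proof. by do !split; rewrite sum_pair !sum2 /Nmx /=; ring. Qed.

Lemma Nmx_sum k (f : pr -> K) : k <> Sharp ->
  (\sum_a Nmx k (i1, i1) a * f a = ksign k * q^-1 ^+ 3 * f (i2, i2)) *
  (\sum_a Nmx k (i1, i2) a * f a = f (i1, i2)) *
  (\sum_a Nmx k (i2, i1) a * f a = f (i2, i1)) *
  (\sum_a Nmx k (i2, i2) a * f a = ksign k * q ^+ 3 * f (i1, i1)).
Proof. by case: k => // _; do !split; rewrite sum_pair !sum2 /Nmx /=; ring. Qed.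

Lemma Nmx_fmx k (p r : pr) n l :
  \sum_b \sum_m (\sum_a Nmx k b a * hmx k a r m l) * fmx s p b n m =
  Nmx k p r * (n == l)%:R.
Proof.
have q0 : q != 0 by rewrite -s2 expf_neq0.
have s0' : s^-1 != 0 by rewrite invr_eq0.
have s2' : s^-1 ^+ 2 = q^-1 by rewrite -s2 exprVn.
have fs p' r' m' l' := fmxE s0 s2 p' r' m' l'.
have fs' p' r' m' l' := fmxE s0' s2' p' r' m' l'.
case: p r => p1 p2 [r1 r2].
case: k; rewrite sum_pair !sum2; move: p1 p2 r1 r2 n l; do 6!apply: ord2P;
  rewrite ?Nmx_sum_sharp ?Nmx_sum // /hmx !fs ?fs' /flip /ksign /Nmx /= ?zeroE //;
  by field; rewrite ?q0.
Qed.

End StarMatrices.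

Section StarAdjoint.
Variables (K : numClosedFieldType) (q s : K).
Hypotheses (s0 : s != 0) (s2 : s ^+ 2 = q).
Hypothesis q_nroot : forall n : nat, (0 < n)%N -> q ^+ n != 1.
Variables (A : algType K) (u : I -> I -> A).
Hypothesis hA : is_OSLq2 q s u.
Variables (nu0 : K).
Hypothesis hnu0 : nu0 = 1 \/ nu0 = -1.
Variables (Gam : lmodType A) (th : I -> I -> Gam) (rm : Gam -> A -> Gam).
Hypothesis hGam : is_4Dcalc s u th rm nu0.
Notation pr := (I * I)%type.
Notation Fm := (Fm hGam).
Variables (k : star_kind) (st : A -> A).
Hypotheses (hk : star_cond q k) (hst : is_star q u k st).

Lemma stD : {morph st : a b / a + b}. Proof. by case: hst. Qed.
Lemma stZ c a : st (c *: a) = c^* *: st a. Proof. by case: hst. Qed.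
Lemma stM a b : st (a * b) = st b * st a. Proof. by case: hst. Qed.
Lemma stK : involutive st. Proof. by case: hst. Qed.
Lemma st_sum (J : finType) (f : J -> A) : st (\sum_j f j) = \sum_j st (f j).
Proof. exact: (morphD_sum stD). Qed.
Lemma st1 : st 1 = 1.
Proof. by rewrite -[LHS]mulr1 -[X in _ * X]stK -stM mulr1 stK. Qed.

Let q0 : q != 0. Proof. by rewrite -s2 expf_neq0. Qed.

Lemma conj_real (x : K) : x \is Num.real -> x^* = x. Proof. by move/CrealP. Qed.

Lemma conj_unit (x : K) : `|x| = 1 -> x^* = x^-1.
Proof.
move=> x1; have := normCK x; rewrite x1 expr1n => e.
have x0 : x != 0 by rewrite -normr_eq0 x1 oner_eq0.
by apply: (mulfI x0); rewrite -e divff.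
Qed.

Lemma norm_s : `|q| = 1 -> `|s| = 1.
Proof.
move=> q1; have : `|s| ^+ 2 = 1 by rewrite -normrX s2.
by move/eqP; rewrite sqrp_eq1 // => /eqP.
Qed.

Lemma nu0_conj : nu0^* = nu0.
Proof. by case: hnu0 => ->; rewrite ?rmorphN ?rmorph1. Qed.

(** The candidate for the adjoint of [Fm]. *)
Definition Hm (p r : pr) (c : A) : A := st (Fm p r (st c)).

Lemma HmD p r : {morph Hm p r : c d / c + d}.
Proof. by move=> c d; rewrite /Hm stD FD stD. Qed.
Lemma HmZ p r c a : Hm p r (c *: a) = c *: Hm p r a.
Proof. by rewrite /Hm stZ FZ stZ conjCK. Qed.
Lemma Hm1 p r : Hm p r 1 = (p == r)%:R *: 1.
Proof.
by rewrite /Hm st1 F1; case: (p == r); rewrite ?st1 ?(morphD0 stD) ?scale1r ?scale0r.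
Qed.
Lemma HmM p r c d : Hm p r (c * d) = \sum_j Hm j r c * Hm p j d.
Proof.
rewrite /Hm stM FM st_sum; apply: eq_bigr => j _; exact: stM.
Qed.

Definition rho (i l : I) : K :=
  if i == l then 1 else ksign K k * (if i == i1 then q else q^-1).

Lemma st_u i l : k <> Sharp -> st (u i l) = rho i l *: u (flip i) (flip l).
Proof.
case: hst => _ _ _ _; rewrite /rho /flip /ksign; case: (k) => // -[h11 h12 h21 h22] _;
  by move: i l; do 2!apply: ord2P; rewrite /= ?scale1r ?mul1r ?mulN1r ?scaleNr.
Qed.

Lemma rho_conj i l : k <> Sharp -> (rho i l)^* = rho i l.
Proof.
move=> kS; have qr : q^* = q by case: (k) hk kS => // /conj_real.
have er : (ksign K k)^* = ksign K k by case: (k); rewrite /= ?rmorphN ?rmorph1.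
rewrite /rho; case: ifP => _; first exact: rmorph1.
by rewrite rmorphM /= er; case: ifP; rewrite ?fmorphV /= qr.
Qed.

Lemma rho_hmx p r i m l : k <> Sharp ->
  rho i l * rho (flip i) m * fmx s p r m (flip l) = hmx q s k p r (flip m) l.
Proof.
move=> kS; have -> : hmx q s k p r (flip m) l =
    (if flip m == l then 1 else if l == i1 then ksign K k * q^-1 else ksign K k * q)
    * fmx s p r (flip (flip m)) (flip l) by rewrite /hmx; case: (k) kS.
have ee : ksign K k * ksign K k = 1 by case: (k); rewrite /= ?mulrNN mulr1.
have -> : flip (flip m) = m by move: m; apply: ord2P.
congr (_ * _); rewrite /rho /flip; move: i m l; do 3!apply: ord2P; rewrite /= ?mul1r ?mulr1 //.
  by rewrite mulrACA ee mulfV // mulr1.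
by rewrite mulrACA ee mulVf // mulr1.
Qed.

Lemma Hm_u p r i l : Hm p r (u i l) = \sum_m (nu0 * hmx q s k p r m l) *: u i m.
Proof.
have [kS|kS] : k = Sharp \/ k <> Sharp by case: (k); [right|right|left].
  case: hst => _ _ _ _; rewrite /Hm /hmx; case: (k) kS hk => //= _ hq.
  move=> stu; rewrite stu F_u st_sum; apply: eq_bigr => m _.
  rewrite stZ stu rmorphM /= nu0_conj fmx_conj conj_unit //.
  exact: norm_s.
have qr : q^* = q by case: (k) hk kS => // /conj_real.
have fK : involutive flip by apply: ord2P.
rewrite (reindex_inj (inv_inj fK)) /Hm st_u // FZ F_u scaler_sumr st_sum.
apply: eq_bigr => m _ /=.
rewrite !stZ st_u // fK !scalerA; congr (_ *: _).
rewrite -(rho_hmx _ _ i) // rho_conj // rmorphM /= nu0_conj fmx_conj.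
rewrite (@fmx_sq _ s^* s); last by rewrite -rmorphXn /= s2.
by ring.
Qed.

(** [Hm] reverses products, but so does the order in which the two matrices are
    applied; on the generators this is [Nmx_fmx]. *)
Lemma Nmx_Hm c : forall p r,
  \sum_j Fm p j (\sum_a Nmx q k j a *: Hm a r c) = Nmx q k p r *: c.
Proof.
have FS p r (J : finType) (f : J -> A) : Fm p r (\sum_j f j) = \sum_j Fm p r (f j).
  exact: (morphD_sum (FD hGam p r)).
move: c; apply: (OSLq2_ind hA); last first.
  move=> i l p r.
  transitivity (\sum_n (\sum_b \sum_m
      (\sum_a Nmx q k b a * hmx q s k a r m l) * fmx s p b n m) *: u i n).
    have hb b : \sum_a Nmx q k b a *: Hm a r (u i l) =
        \sum_m (nu0 * \sum_a Nmx q k b a * hmx q s k a r m l) *: u i m.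
      under eq_bigr do rewrite Hm_u scaler_sumr.
      rewrite exchange_big; apply: eq_bigr => m _ /=.
      under eq_bigr do rewrite scalerA.
      by rewrite -scaler_suml mulr_sumr; congr (_ *: _); apply: eq_bigr => a _; rewrite mulrCA.
    under eq_bigr => b _.
      rewrite hb FS.
      under eq_bigr => m _ do rewrite FZ F_u scaler_sumr.
      rewrite exchange_big /=.
      under eq_bigr => n _ do (under eq_bigr do rewrite scalerA; rewrite -scaler_suml).
      over.
    rewrite exchange_big; apply: eq_bigr => n _ /=; rewrite -scaler_suml.
    congr (_ *: _); apply: eq_bigr => b _; apply: eq_bigr => m _.
    by rewrite mulrACA (nu0K hnu0) mul1r.
  under eq_bigr do rewrite Nmx_fmx //.
  rewrite (bigD1 l) //= eqxx mulr1 big1 ?addr0 // => n /negPf ->.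
  by rewrite mulr0 scale0r.
split=> [p r|c d hc hd p r|c d hc hd p r|x c hc p r].
- have h1 b : \sum_a Nmx q k b a *: Hm a r 1 = Nmx q k b r *: 1.
    rewrite (bigD1 r) //= big1 ?addr0 => [|a /negPf ne].
      by rewrite Hm1 eqxx scale1r.
    by rewrite Hm1 ne scale0r scaler0.
  under eq_bigr do rewrite h1 FZ F1.
  rewrite (bigD1 p) //= eqxx big1 ?addr0 // => b; rewrite eq_sym => /negPf ->.
  by rewrite scaler0.
- under eq_bigr do (under eq_bigr do rewrite HmD scalerDr; rewrite big_split FD /=).
  by rewrite big_split /= hc hd scalerDr.
- have hb j : \sum_a Nmx q k j a *: Hm a r (c * d) =
      \sum_b Hm b r c * \sum_a Nmx q k j a *: Hm a b d.
    under eq_bigr do rewrite HmM scaler_sumr.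
    rewrite exchange_big; apply: eq_bigr => b _ /=; rewrite mulr_sumr.
    by apply: eq_bigr => a _; rewrite scalerAr.
  under eq_bigr => j _.
    rewrite hb FS; under eq_bigr do rewrite FM; over.
  rewrite exchange_big /=.
  under eq_bigr => b _.
    rewrite exchange_big /=; under eq_bigr do rewrite -mulr_sumr hd -scalerAr scalerAl -FZ.
    over.
  rewrite exchange_big /=.
  under eq_bigr => j _ do rewrite -mulr_suml -FS.
  by rewrite -mulr_suml hc scalerAl.
under eq_bigr do under eq_bigr do rewrite HmZ scalerA mulrC -scalerA.
under eq_bigr do rewrite -scaler_sumr FZ.
by rewrite -scaler_sumr hc !scalerA mulrC.
Qed.

Lemma tc_Nmx a : \sum_p tc q s p * Nmx q k p a = (tc q s a)^*.
Proof.
have h0 : q - q^-1 != 0 := qhat_neq0 s0 s2 q_nroot.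
have h1 : q * q - 1 != 0 by rewrite -expr2 subr_eq0 q_nroot.
have h2 : 1 + - q * q != 0 by rewrite mulNr -oppr_eq0 opprB.
rewrite sum_pair !sum2 !(tcE s0 s2) /Nmx; case: a => a1 a2.
have [kS|kS] : k = Sharp \/ k <> Sharp by case: (k); [right|right|left].
  have qc : q^* = q^-1 by rewrite conj_unit //; case: (k) kS hk.
  rewrite kS; move: a1 a2; do 2!apply: ord2P;
    rewrite !(tcE s0 s2) /= ?rmorph0 ?rmorphN ?rmorphM ?fmorphV ?rmorphB ?fmorphV /= ?qc;
    by field; rewrite ?q0 ?h1 ?h2.
have qr : q^* = q by case: (k) hk kS => // /conj_real.
case: (k) kS => // _; move: a1 a2; do 2!apply: ord2P;
    rewrite !(tcE s0 s2) /= ?rmorph0 ?rmorphN ?rmorphM ?fmorphV ?rmorphB ?fmorphV /= ?qr;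
    by field; rewrite ?q0 ?h1 ?h2.
Qed.

End StarAdjoint.

Section SpinMetricTable.
Variables (K : numClosedFieldType) (q s c1 c2 : K) (k : star_kind).
Hypotheses (s0 : s != 0) (s2 : s ^+ 2 = q).
Hypothesis q_nroot : forall n : nat, (0 < n)%N -> q ^+ n != 1.
Hypothesis hk : star_cond q k.
Hypothesis c1_real : c1^* = c1.
Notation spin := (spin q s c1).
Notation kap := (kap q c1).
Notation W := (spin_mx q s c1 c2 k).

(** Like [ftab], for the case analyses over the indices. *)
Definition stab (e p1 p2 m n : bool) : K :=
  match e, p1, p2, m, n with
  | true, true, true, false, true => 1
  | true, true, false, true, true => - (q - q^-1)
  | true, true, false, false, false => q^-1
  | true, false, true, true, true => - 1
  | true, false, false, true, false => - q
  | false, true, true, false, true => kap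
  | false, true, false, true, true => - (q * kap)
  | false, false, true, false, false => kap
  | false, false, false, true, false => - (q * kap)
  | _, _, _, _, _ => 0
  end.

Lemma spin_stab e p m n :
  spin e p m n = stab e (p.1 == i1) (p.2 == i1) (m == i1) (n == i1).
Proof.
case: p => p1 p2; case: e; move: p1 p2 m n; do 4!apply: ord2P;
  by rewrite !(spinE c1 s0 s2).
Qed.

Let q0 : q != 0. Proof. by rewrite -s2 expf_neq0. Qed.

Lemma conj_q : q^* = if k is Sharp then q^-1 else q.
Proof.
case: (k) hk => /=; [exact: conj_real|exact: conj_real|exact: conj_unit].
Qed.

Lemma conj_kap : kap^* = kap.
Proof.
rewrite /kap /two_q rmorphM rmorphD fmorphV /= c1_real conj_q.
by case: (k); rewrite // invrK addrC.
Qed.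

Lemma spin_metric_compat e e' m l r :
  \sum_n spin e r m n * W (~~ e) n e' l =
  \sum_a Nmx q k r a * \sum_n (spin e' a l n)^* * W e m (~~ e') n.
Proof.
have cq := conj_q; have ck := conj_kap.
case: r => r1 r2.
case: (k) cq => cq; move: r1 r2; do 2!apply: ord2P;
  rewrite ?Nmx_sum_sharp ?Nmx_sum // !sum2 !spin_stab /=;
  move: m l; do 2!apply: ord2P; case: e; case: e';
  rewrite /= -?[two_q q * c1]/kap; move: kap ck => kp ck;
  rewrite ?zeroE ?rmorphN ?rmorphB ?rmorphM ?fmorphV /= ?ck ?cq
    ?rmorph0 ?rmorph1 ?zeroE -?s2 //; by field.
Qed.
End SpinMetricTable.

(** * Symmetry of the Dirac operator *)

Section DiracSymmetry.
Variables (K : numClosedFieldType) (q s c1 : K).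
Hypotheses (s0 : s != 0) (s2 : s ^+ 2 = q).
Hypothesis q_nroot : forall n : nat, (0 < n)%N -> q ^+ n != 1.
Hypothesis c1_neq0 : c1 != 0.
Variables (A : algType K) (u : I -> I -> A).
Hypothesis hA : is_OSLq2 q s u.
Variables (nu0 : K).
Hypothesis hnu0 : nu0 = 1 \/ nu0 = -1.
Variables (Gam : lmodType A) (th : I -> I -> Gam) (rm : Gam -> A -> Gam).
Hypothesis hGam : is_4Dcalc s u th rm nu0.
Notation Fm := (Fm hGam).
Notation GG := (GT (@lsc K A Gam) hGam).
Notation theta := (theta q s th).
Variables (sigma : GG -> GG) (g : GG -> A).
Hypothesis hsigma : is_sigma s th sigma.
Hypothesis hg : is_metric_g s th c1 g.
Variables (T : algType K) (iT : {lrmorphism A -> T}) (jT : Gam -> T).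
Hypothesis hT : is_tensor_algebra rm iT jT.
Variables (Cl : algType K) (pi : {lrmorphism T -> Cl}).
Hypothesis hCl : is_clifford iT jT sigma g pi.
Notation spin := (spin q s c1).
Notation J := (bool * I)%type.
Notation S0 := (S0 q th jT pi c1).
Notation S0l := (@S0l K q A Gam th T iT jT Cl pi c1).

Notation M := (S0m q c1 th jT pi iT).
Notation psJ := (psJ q c1 th iT jT pi : J -> M).
Notation cact := (cact (q := q) (c1 := c1) (th := th) (iT := iT) (jT := jT) (pi := pi)).
Notation GS := (GT S0l hGam).
Variables (e e' : bool) (nu gamma : K).

Notation nablaS :=
  (nablaS s0 s2 q_nroot c1_neq0 hsigma hg hT hCl e e' nu gamma).
Let cactA := cact_action q c1 th hT pi.
Variables (k : star_kind) (st : A -> A).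
Hypotheses (hk : star_cond q k) (hst : is_star q u k st).
Notation AA := (tens (fun (x : A) (c : K) => c *: x) (fun (c : K) (y : A) => c *: y)).
Variables (Delta : A -> AA) (h : A -> K) (c2 : K).
Hypotheses (hDelta : is_comult u Delta) (hh : is_haar Delta h).
Hypothesis c1_real : c1^* = c1.
Variable met : S0 -> S0 -> K.
Hypothesis hmet : is_spin_metric s iT h st c2 k met.
Notation W := (spin_mx q s c1 c2 k).
Notation Hm := (Hm hGam st).
Notation D := (dirac nablaS).
Notation lam := (lam q s c1 e e' nu gamma).

Lemma metDl x y z : met (x + y) z = met x z + met y z. Proof. by case: hmet. Qed.
Lemma metDr x y z : met x (y + z) = met x y + met x z. Proof. by case: hmet. Qed.
Lemma met_suml (X : finType) (f : X -> M) z : met (\sum_j f j) z = \sum_j met (f j) z.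
Proof. by apply: (@morphD_sum M K (met^~ z)) => x y; exact: metDl. Qed.
Lemma met_sumr (X : finType) (f : X -> M) z : met z (\sum_j f j) = \sum_j met z (f j).
Proof. by apply: (@morphD_sum M K (met z)) => x y; exact: metDr. Qed.
Lemma met_psJ a b p r : met (a *: psJ p) (b *: psJ r) = h (a * st b) * W p.1 p.2 r.1 r.2.
Proof. by case: hmet => _ _ hm; exact: hm. Qed.

Let hsum (X : finType) (f : X -> A) : h (\sum_j f j) = \sum_j h (f j).
Proof. exact: (morphD_sum (hD hh)). Qed.

Lemma cact_theta_left a b m : cact theta (a *: psJ (b, m)) =
  \sum_r \sum_n (\sum_p (tc q s p * spin b r m n) *: Fm p r a) *: psJ (~~ b, n).
Proof.
have [cDl _ cZl cZr] := cactA.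
have cZ x y (phi : M) : cact (x *: y) phi = x *: cact y phi := cZl x y phi.
rewrite -[cact theta _](cZr theta a) (thetaE q s th) (rm_suml hGam) (morphD_sum (cDl _)).
transitivity (\sum_p \sum_r \sum_n ((tc q s p * spin b r m n) *: Fm p r a) *: psJ (~~ b, n)).
  apply: eq_bigr => p _; rewrite (rmZ hGam) (FE hGam) cZ (morphD_sum (cDl _)).
  rewrite scaler_sumr; apply: eq_bigr => r _.
  rewrite cZ (cact_psJ s0 s2 q_nroot c1_neq0 hsigma hg hT hCl) !scaler_sumr.
  apply: eq_bigr => n _; rewrite !scalerA -mulrA Mscalar scalarM scalerA mulrC.
  by [].
etransitivity; first exact: (@exchange_big M).
apply: eq_bigr => r _; etransitivity; first exact: (@exchange_big M).
by apply: eq_bigr => n _; rewrite scaler_suml.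
Qed.

(** The matrix [Nmx] produced by [spin_metric_compat] is exactly what
    [haar_adjoint] needs to move [Fm] to the other side, and [tc_Nmx] absorbs what
    that leaves. *)
Lemma theta_symmetric a b x m y l :
  met (cact theta (a *: psJ (x, m))) (b *: psJ (y, l)) =
  met (a *: psJ (x, m)) (cact theta (b *: psJ (y, l))).
Proof.
have hZ' := hZ hh.
pose c := st b.
pose Y r := \sum_n (spin y r l n)^* * W x m (~~ y) n.
transitivity (\sum_p tc q s p * \sum_r h (Fm p r a * c) * \sum_n spin x r m n * W (~~ x) n y l).
  rewrite cact_theta_left met_suml.
  under eq_bigr do rewrite met_suml.
  under eq_bigr => r _ do under eq_bigr => n _ do rewrite met_psJ mulr_suml hsum mulr_suml.
  under eq_bigr do rewrite exchange_big; rewrite exchange_big /=.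
  apply: eq_bigr => p _; rewrite mulr_sumr; apply: eq_bigr => r _.
  rewrite !mulr_sumr; apply: eq_bigr => n _; rewrite -scalerAl hZ'; ring.
transitivity (\sum_r Y r * \sum_p (tc q s p)^* * h (a * Hm p r c)).
  have adj p r := haar_adjoint hA hDelta hh (Nmx_Hm s0 s2 hA hnu0 hGam hk hst) a c p r.
  transitivity (\sum_p \sum_r tc q s p * (Y r * \sum_j Nmx q k j r * h (Fm p j a * c))).
    apply: eq_bigr => p _; rewrite -mulr_sumr; congr (_ * _).
    under eq_bigr do rewrite (spin_metric_compat c2 s0 s2 hk c1_real) mulr_sumr.
    rewrite exchange_big; apply: eq_bigr => r _ /=.
    by rewrite mulr_sumr; apply: eq_bigr => j _; rewrite /Y; ring.
  rewrite exchange_big; apply: eq_bigr => r _ /=.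
  under eq_bigr do rewrite adj mulrCA.
  rewrite -mulr_sumr; congr (_ * _).
  under [in RHS]eq_bigr do rewrite -(tc_Nmx s0 s2 q_nroot hk) mulr_suml.
  rewrite [in RHS]exchange_big /=; apply: eq_bigr => p _; rewrite mulr_sumr.
  by apply: eq_bigr => j _; rewrite mulrA.
rewrite cact_theta_left met_sumr; apply: eq_bigr => r _.
rewrite met_sumr; under [RHS]eq_bigr => n _ do
  rewrite met_psJ (st_sum hst) mulr_sumr hsum mulr_suml.
rewrite [RHS]exchange_big /= mulr_sumr; apply: eq_bigr => p _.
rewrite /Y mulr_suml; apply: eq_bigr => n _.
rewrite (stZ hst) -scalerAr hZ' [(tc q s p * _)^*]rmorphM /= /Hm /c (stK hst).
ring.
Qed.

Lemma dirac_psJ a b m : D (a *: psJ (b, m)) =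
  cact theta (a *: psJ (b, m)) - (lam b *: a) *: psJ (~~ b, m).
Proof.
by rewrite (dirac_psi s0 s2 q_nroot c1_neq0 hA hnu0 hsigma hg hT hCl) Mscalar.
Qed.

Lemma dirac_additive : {morph D : x y / x + y}.
Proof.
have thD := tauthD s0 s2 q_nroot c1_neq0 hA hnu0 hsigma hg hT hCl e e' nu gamma.
move=> x y; have nD : nablaS (x + y) = nablaS x + nablaS y :> GS.
  by rewrite /nablaS tpureDr thD opprD addrACA.
transitivity (cmult (hGam := hGam) (nablaS x + nablaS y : GS)).
  exact: (congr1 _ nD).
exact: (cmultD hT).
Qed.

(** The [theta] terms cancel; the rest is tested on [a = b = 1]. *)
Lemma symmetric_lam : symmetric_wrt met D <->
  forall x m y l, lam x * W (~~ x) m y l = (lam y)^* * W x m (~~ y) l.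
Proof.
have hZ' := hZ hh.
have metNl x y : met (- x) y = - met x y := morphDN (fun x x' => metDl x x' y) x.
have metNr x y : met x (- y) = - met x y := morphDN (metDr x) y.
have key a b x m y l :
    met (D (a *: psJ (x, m))) (b *: psJ (y, l)) = met (a *: psJ (x, m)) (D (b *: psJ (y, l)))
    <-> h (a * st b) * (lam x * W (~~ x) m y l) = h (a * st b) * ((lam y)^* * W x m (~~ y) l).
  rewrite !dirac_psJ metDl metNl metDr metNr theta_symmetric !met_psJ.
  rewrite (stZ hst) -scalerAl -scalerAr !hZ' -!mulrA !(mulrCA (h _)) /=.
  split=> [|->] // /addrI /oppr_inj //.
split=> [sym x m y l|lamE phi phi'].
  have [_ _ h1 _ _] := hh.
  have /key := sym (1 *: psJ (x, m)) (1 *: psJ (y, l)).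
  by rewrite (st1 hst) mulr1 h1 !mul1r.
rewrite (scE s0 s2 q_nroot c1_neq0 hsigma hg hT hCl phi).
rewrite (scE s0 s2 q_nroot c1_neq0 hsigma hg hT hCl phi').
rewrite !(morphD_sum dirac_additive) met_suml [RHS]met_suml.
apply: eq_bigr => -[x m] _; rewrite !met_sumr; apply: eq_bigr => -[y l] _.
by apply/key; rewrite lamE.
Qed.

End DiracSymmetry.

Section LamCondition.
Variables (K : numClosedFieldType) (q s c1 c2 : K) (k : star_kind).
Hypotheses (s0 : s != 0) (s2 : s ^+ 2 = q).
Hypothesis q_nroot : forall n : nat, (0 < n)%N -> q ^+ n != 1.
Hypothesis hk : star_cond q k.
Hypotheses (c1_real : c1^* = c1) (c1_neq0 : c1 != 0) (c2_neq0 : c2 != 0).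
Variables (e e' : bool) (nu gamma : K).
Hypothesis hnu : nu = 1 \/ nu = -1.
Notation W := (spin_mx q s c1 c2 k).
Notation lam := (lam q s c1 e e' nu gamma).
Notation kap := (kap q c1).

Let q0 : q != 0. Proof. by rewrite -s2 expf_neq0. Qed.
Let qh0 : q - q^-1 != 0 := qhat_neq0 s0 s2 q_nroot.
Let k0 : kap != 0. Proof. exact: (kap_neq0 s0 s2 q_nroot c1_neq0). Qed.
Let nuc : nu^* = nu. Proof. by case: hnu => ->; rewrite ?rmorphN ?rmorph1. Qed.
Let nuK : nu * nu = 1. Proof. exact: nuK. Qed.

Lemma real_not_unit : ~ (q \is Num.real /\ `|q| = 1).
Proof.
move=> [/conj_real qr /conj_unit]; rewrite qr => qi.
have := q_nroot (isT : (0 < 2)%N); rewrite expr2 {2}qi mulfV ?eqxx //.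
Qed.

Lemma twist_neq0 b : twist s b != 0.
Proof. by rewrite /twist; case: b; rewrite ?expf_neq0 ?invr_eq0. Qed.

(** For real [q] the root [s] may be imaginary; [lam] is still a real multiple of
    [gamma] because it only contains [s * twist]. *)
Lemma s_twist b : s * twist s b = if b then q^-1 else q ^+ 2.
Proof. by rewrite /twist; case: b; rewrite -s2; field. Qed.

(** The metric pairs [psi^+] with [psi^-], so each [lam] is compared with its own
    conjugate. *)
Lemma real_lam : k <> Sharp ->
  (forall x, (lam x)^* = lam x) <-> gamma^* = gamma.
Proof.
move=> kS; have cq : q^* = q by have := conj_q hk; case: (k) kS.
have ck := conj_kap hk c1_real.
have ct b : (if b then q^-1 else q ^+ 2)^* = if b then q^-1 else q ^+ 2.
  by case: b; rewrite ?fmorphV ?rmorphXn /= cq.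
have ch : (q - q^-1)^* = q - q^-1 by rewrite rmorphB fmorphV /= cq.
have lamE x : lam x = gamma * if x then q ^+ 3 / (q - q^-1) * (if e then q^-1 else q ^+ 2)
    else - (nu * kap * (q ^+ 2 / (q - q^-1)) * (if e' then q^-1 else q ^+ 2)).
  by rewrite -!s_twist /lam; case: x; ring.
have cr x : (lam x)^* = gamma^* * if x then q ^+ 3 / (q - q^-1) * (if e then q^-1 else q ^+ 2)
    else - (nu * kap * (q ^+ 2 / (q - q^-1)) * (if e' then q^-1 else q ^+ 2)).
  rewrite lamE rmorphM /=; congr (_ * _); case: x.
    by rewrite !rmorphM ?fmorphV ?rmorphXn /= ct ch !cq !exprS !expr0 mulr1.
  move: (kap) ck => kp ck; rewrite [LHS]rmorphN !rmorphM fmorphV ?rmorphXn /= ct ch ck nuc ?cq.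
  by rewrite !expr2.
split=> [h|h x]; last by rewrite cr lamE h.
have := h true; rewrite cr lamE; apply: mulIf.
rewrite !mulf_neq0 ?expf_neq0 ?invr_eq0 //; case: (e); by rewrite ?expf_neq0 ?invr_eq0.
Qed.

(** Here the metric pairs each half with itself, so the two [lam] are compared
    with each other; [kap] is the ratio of the metrics of the two halves. *)
Lemma unit_lam : k = Sharp ->
  lam true * kap = (lam false)^* <->
  gamma^* = s ^ (12 - 3 * zsign e - 3 * zsign e') * nu * gamma.
Proof.
move=> kS; have q1 : `|q| = 1 by case: (k) kS hk.
have cs : s^* = s^-1 by apply/conj_unit/(norm_s s2).
have cq : q^* = q^-1 by apply/conj_unit.
have ck := conj_kap hk c1_real.
have ct b : (twist s b)^* = (twist s b)^-1.
  by rewrite /twist; case: b; rewrite rmorphXn ?fmorphV /= cs ?exprVn.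
have ch : (q - q^-1)^* = - (q - q^-1) by rewrite rmorphB fmorphV /= cq invrK opprB.
pose C := kap * (q ^- 2 * s^-1 / (q - q^-1)) / twist s e'.
have C0 : C != 0.
  have t0 := twist_neq0 e'.
  apply: mulf_neq0; last by rewrite invr_eq0.
  by apply: (mulf_neq0 k0); rewrite !mulf_neq0 ?invr_eq0 ?expf_neq0.
have -> : (lam false)^* = C * (nu * gamma^*).
  rewrite /lam /C; move: (kap) ck => kp ck.
  rewrite [LHS]rmorphN !rmorphM fmorphV /= ch ?rmorphXn /= cq ck nuc ct cs.
  by rewrite invrN -[q ^- 2]exprVn expr2; ring.
have sN : s ^ (12 - 3 * zsign e - 3 * zsign e') =
    q ^+ 5 * s ^+ 2 * twist s e * twist s e'.
  have -> : 12 - 3 * zsign e - 3 * zsign e' =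
      Posz (if e then if e' then 6 else 12 else if e' then 12 else 18)%N.
    by case: (e); case: (e').
  by rewrite -exprnP /twist -s2; case: (e); case: (e'); field.
have -> : lam true * kap = C * (s ^ (12 - 3 * zsign e - 3 * zsign e') * gamma).
  rewrite sN /lam /C; have t0 := twist_neq0 e'.
  have h1 : q * q - 1 != 0 by rewrite -expr2 subr_eq0 q_nroot.
  by field; rewrite q0 s0 t0 h1.
split=> [/(mulfI C0) h|->].
  by rewrite -[LHS]mul1r -nuK -mulrA -h mulrCA mulrA.
by congr (_ * _); rewrite -mulrA mulrCA (mulrA nu) nuK mul1r.
Qed.

Lemma spin_mx_real x m y l : k <> Sharp ->
  W x m y l = (x == ~~ y)%:R * W true m false l.
Proof.
by rewrite /spin_mx; case: (k) => // _; case: (x == ~~ y);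
  rewrite /= ?mulr1 ?mulr0 ?mul1r ?mul0r.
Qed.

Lemma spin_mx_unit x m y l : k = Sharp ->
  W x m y l = (x == y)%:R * (if x then 1 else kap) * W true m true l.
Proof.
move=> ->; rewrite /spin_mx /= -[two_q q * c1]/kap; case: (x == y);
  rewrite /= ?mulr1 ?mulr0 ?mul1r ?mul0r //.
by rewrite mulrC.
Qed.

Lemma lam_condition :
  (forall x m y l, lam x * W (~~ x) m y l = (lam y)^* * W x m (~~ y) l) <->
  (q \is Num.real /\ gamma^* = gamma) \/
  (`|q| = 1 /\ gamma^* = s ^ (12 - 3 * zsign e - 3 * zsign e') * nu * gamma).
Proof.
have [kS|kS] : k = Sharp \/ k <> Sharp by case: (k); [right|right|left].
  have q1 : `|q| = 1 by case: (k) kS hk.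
  have -> : (q \is Num.real /\ gamma^* = gamma) \/
      (`|q| = 1 /\ gamma^* = s ^ (12 - 3 * zsign e - 3 * zsign e') * nu * gamma) <->
      gamma^* = s ^ (12 - 3 * zsign e - 3 * zsign e') * nu * gamma.
    split=> [[[qr _]|[] //]|]; last by right.
    by case: real_not_unit.
  pose w m l := W true m true l.
  have Ww x m y l : W x m y l = (x == y)%:R * (if x then 1 else kap) * w m l :=
    spin_mx_unit x m y l kS.
  rewrite -(unit_lam kS); split=> [h|h x m y l].
    have W0 : W true i1 true i2 != 0.
      rewrite kS /spin_mx /= !mulr1 !mulr0 subr0.
      by rewrite !mulf_neq0 ?invr_eq0 ?neq0Ci.
    have := h true i1 false i2; rewrite !Ww !mul1r => hw.
    by apply: (mulIf W0); rewrite -[LHS]mulrA; exact: hw.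
  have h' : lam false = (lam true)^* * kap.
    by rewrite -[LHS]conjCK -h rmorphM /= (conj_kap hk c1_real).
  rewrite !Ww; case: x; case: y; move: (lam true) (lam false) h h' => lt lf h h';
    rewrite /= ?mul0r ?mulr0 ?mul1r //.
    by rewrite mulrA h.
  by rewrite h' [RHS]mulrA.
have qr : q \is Num.real by case: (k) hk kS.
have -> : (q \is Num.real /\ gamma^* = gamma) \/
    (`|q| = 1 /\ gamma^* = s ^ (12 - 3 * zsign e - 3 * zsign e') * nu * gamma) <->
    gamma^* = gamma.
  split=> [[[] //|[q1 _]]|]; last by left.
  by case: real_not_unit.
pose w m l := W true m false l.
have Ww x m y l : W x m y l = (x == ~~ y)%:R * w m l := spin_mx_real x m y l kS.
rewrite -(real_lam kS); split=> [h x|h x m y l].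
  have W0 : W true i1 false i1 != 0.
    by rewrite /spin_mx; case: (k) kS => // _ /=; rewrite !mulr0 ?addr0 ?subr0 !mulr1.
  have := h x i1 x i1; rewrite !Ww negbK !eqxx /= !mul1r.
  by move/(mulIf W0) => <-.
rewrite !Ww negbK; case: (eqVneq x y) => [->|ne].
  by rewrite eqxx !mul1r h.
have -> : (~~ x == ~~ y) = false by rewrite (inj_eq negb_inj) (negPf ne).
by rewrite !mul0r !mulr0.
Qed.

End LamCondition.

(** * The theorem *)

Theorem theorem6p7
    (R : realType) (q s : R[i])
    (q_neq0 : q != 0) (q_nroot : forall n : nat, (0 < n)%N -> q ^+ n != 1)
    (s_sqrt : s ^+ 2 = q)
    (* the quantum group *)
    (A : algType R[i]) (u : 'I_2 -> 'I_2 -> A) (hA : is_OSLq2 q s u)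
    (* the calculus, its braiding and its metric *)
    (nu0 : R[i]) (hnu0 : nu0 = 1 \/ nu0 = -1)
    (Gam : lmodType A) (th : 'I_2 -> 'I_2 -> Gam) (rm : Gam -> A -> Gam)
    (hGam : is_4Dcalc s u th rm nu0)
    (sigma : GG rm -> GG rm) (hsigma : is_sigma s th sigma)
    (c1 : R) (hc1 : c1 != 0)
    (g : GG rm -> A) (hg : is_metric_g s th c1%:C%C g)
    (* the tensor algebra of Gam over A and the Clifford algebra *)
    (T : algType R[i]) (iT : {lrmorphism A -> T}) (jT : Gam -> T)
    (hT : is_tensor_algebra rm iT jT)
    (Cl : algType R[i]) (pi : {lrmorphism T -> Cl})
    (hCl : is_clifford iT jT sigma g pi)
    (* the connection on Gam, its extension and the induced one on Cl *)
    (i : 'I_4) (stilde : GG rm -> GG rm) (hstilde : is_stilde s th i stilde)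
    (nu : R[i]) (hnu : nu = 1 \/ nu = -1)
    (nablaT : T -> GB rm iT) (hnablaT : is_nabla_T q s th jT stilde nu nablaT)
    (nablaC : Cl -> GB rm (iC iT pi)) (hnablaC : is_nabla_Cl nablaT nablaC)
    (sigmaC : BG Gam (iC iT pi) -> GB rm (iC iT pi))
    (hsigmaC : is_sigma_Cl q s th nablaC sigmaC) :
  exists nablaS : R[i] -> S0 q th jT pi c1%:C%C -> GS q th rm iT jT pi c1%:C%C,
    (forall gamma gamma', nablaS gamma =1 nablaS gamma' -> gamma = gamma') /\
    forall gamma : R[i],
      [/\ is_spin_connection nablaC sigmaC (nablaS gamma),
          exists tau : SG q th iT jT pi c1%:C%C -> GS q th rm iT jT pi c1%:C%C,
            is_tau s nu i gamma tau /\
            forall phi, nablaS gamma phi =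
              tpure (theta q s th) phi - tau (tpure phi (theta q s th)),
          forall (e : bool) phi, inS0 iT e phi -> inGS0 e (nablaS gamma phi)
        & forall (k : star_kind) (st : A -> A)
            (Delta : A -> AA A) (h : A -> R[i]) (c2 : R)
            (met : S0 q th jT pi c1%:C%C -> S0 q th jT pi c1%:C%C -> R[i]),
            star_cond q k -> is_star q u k st ->
            is_comult u Delta -> is_haar Delta h -> c2 != 0 ->
            is_spin_metric s iT h st c2%:C%C k met ->
            symmetric_wrt met (dirac (nablaS gamma)) <->
            (q \is Num.real /\ gamma^* = gamma) \/
            (`|q| = 1 /\
             gamma^* = s ^ (12 - 3 * zsign (eta_ i) - 3 * zsign (eta'_ i))
                       * nu * gamma)].
Proof.
have s0 : s != 0 by apply: contra_neq q_neq0 => s0; rewrite -s_sqrt s0 expr0n.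
have c10 : c1%:C%C != 0 :> R[i] by rewrite fmorph_eq0.
pose nS gamma := nablaS (hGam := hGam) s0 s_sqrt q_nroot c10 hsigma hg hT hCl
  (eta_ i) (eta'_ i) nu gamma.
exists nS; split=> [gamma gamma' eqS|gamma].
  have dE g0 := sc_dirac s0 s_sqrt q_nroot c10 hA hnu0 hsigma hg hT hCl
    (eta_ i) (eta'_ i) nu g0 i1.
  have dS : dirac (nS gamma) =1 dirac (nS gamma').
    by move=> phi; rewrite /dirac eqS.
  have := dE hGam gamma; rewrite -/(nS gamma) dS (dE hGam) => /(@fmorph_inj _ _ (in_alg A)).
  move=> /addrI /oppr_inj; rewrite /lam => /mulIf -> //.
  rewrite !mulf_neq0 ?expf_neq0 ?invr_eq0 ?twist_neq0 //.
  exact: (qhat_neq0 s0 s_sqrt q_nroot).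
split.
- exact: (nablaS_connection s0 s_sqrt q_nroot c10 hA hnu0 hsigma hg hT hCl
    hstilde hnu gamma hnablaT hnablaC hsigmaC).
- exists (tau (hGam := hGam) s0 s_sqrt q_nroot c10 hsigma hg hT hCl
    (eta_ i) (eta'_ i) nu gamma); split=> //.
  exact: (tau_is_tau s0 s_sqrt q_nroot c10 hA hnu0 hsigma hg hT hCl).
- move=> e phi; exact: (nablaS_inv s0 s_sqrt q_nroot c10 hA hnu0 hsigma hg hT hCl).
move=> k st Delta h c2 met hk hst hDelta hh c20 hmet.
have c1r : (c1%:C%C : R[i])^* = c1%:C%C.
  by apply/CrealP; rewrite realE -!(rmorph0 (@real_complex_def R _)) !lecR le_total.
have c2C : c2%:C%C != 0 :> R[i] by rewrite fmorph_eq0.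
rewrite -(lam_condition s0 s_sqrt q_nroot hk c1r c10 c2C (eta_ i) (eta'_ i) gamma hnu).
exact: (symmetric_lam (hGam := hGam) s0 s_sqrt q_nroot c10 hA hnu0 hsigma hg hT hCl (eta_ i)
  (eta'_ i) nu gamma hk hst hDelta hh c1r hmet).
Qed.
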